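(* Let $q\ge 3$ and $p=2q+1$ both be prime. There are (exactly) six permutation groups $G$ of degree $pq$, up to isomorphism, which are realised by Hopf-Galois structures of both cyclic type $C_{pq}$ and non-abelian type $C_p\rtimes C_q$. Their orders and structures, and the numbers of Hopf-Galois structures of cyclic type and of non-abelian type on a field extension realising them, are: - order $2pq^2$, $C_q\times(C_p\rtimes C_{2q})$: $1$ cyclic, $2(q-1)$ non-abelian; - order $pq^2$, $C_q\times(C_p\rtimes C_q)$: $1$ cyclic, $2(q-1)$ non-abelian; - order $2pq$, $C_p\rtimes C_{2q}$: $1$ cyclic, $2(q-1)$ non-abelian; - order $2pq$, $D_{2p}\times C_q$: $1$ cyclic, $2(q-1)$ non-abelian; - order $pq$, $C_p\rtimes C_q$: $p$ cyclic, $2p(q-2)+2$ non-abelian; - order $pq$, $C_{pq}$: $1$ cyclic, $2(q-1)$ non-abelian. In all these cases, the corresponding field extensions are almost classically Galois.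
   Context: All permutation groups are finite and transitive. A permutation group of degree $n$ is a group $G$ with an injective homomorphism $G\to\mathrm{Perm}(X)$, $|X|=n$; up to isomorphism it is $G$ acting by left multiplication $\lambda$ on $X=G/G'$, where $G'$ (the stabiliser of a point) is a subgroup of index $n$ with trivial core. Two permutation groups are isomorphic (as permutation groups) if there is a group isomorphism between them taking a point stabiliser to a point stabiliser. Let $L/K$ be a finite separable field extension with normal closure $E$. A Hopf-Galois structure on $L/K$ consists of a cocommutative $K$-Hopf algebra $H$ together with an action of $H$ on $L$ making $L$ an $H$-module algebra such that the $K$-linear map $L\otimes_K H\to \mathrm{End}_K(L)$, $x\otimes h\mapsto (y\mapsto x(h\cdot y))$, is bijective. By the theorem of Greither and Pareigis, with $\Gamma=\mathrm{Gal}(E/K)$, $\Gamma'=\mathrm{Gal}(E/L)$, $X=\Gamma/\Gamma'$, the Hopf-Galois structures on $L/K$ correspond bijectively to the regular subgroups $N$ of $\mathrm{Perm}(X)$ normalised by $\lambda(\Gamma)$; the isomorphism class of $N$ is called the type of the structure. A separable extension $L/K$ realises the permutation group $G$ (with point stabiliser $G'$) if there is an isomorphism $G\to\mathrm{Gal}(E/K)$ taking $G'$ to $\mathrm{Gal}(E/L)$ (these $L/K$ are the field extensions corresponding to $G$). $G$ is realised by a Hopf-Galois structure of type $N$ if an extension $L/K$ realising $G$ admits a Hopf-Galois structure of type $N$; this and the number of such structures depend only on $G$ as a permutation group. $L/K$ is almost classically Galois if $\mathrm{Gal}(E/L)$ has a normal complement in $\mathrm{Gal}(E/K)$. $A\rtimes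 B$ denotes a semidirect product with respect to a faithful action of $B$ on $A$; $D_{2p}$ is the dihedral group of order $2p$. *)

(* Defs.v *)
From HB Require Import structures.
From mathcomp Require Export all_boot all_order all_algebra.
From mathcomp Require Export all_fingroup all_solvable all_field.
From mathcomp Require Export sesquilinear.

Set Implicit Arguments.
Unset Strict Implicit.
Unset Printing Implicit Defensive.

Import GRing.Theory.
Local Open Scope ring_scope.

(* A list of pairs [(u_1, v_1); ...; (u_k, v_k)] represents the tensor
   u_1 (x) v_1 + ... + u_k (x) v_k.  By the universal property of the tensor
   product, two lists represent the same tensor of U (x)_K V exactly when no
   K-bilinear map on U x V separates them; likewise for triples. *)
Section Tensors.
Variable K : fieldType.

Definition tensor_eq (U V : lmodType K) (s t : seq (U * V)) : Prop :=
  forall (W : lmodType K) (b : {bilinear U -> V -> W}),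
    \sum_(u <- s) b u.1 u.2 = \sum_(u <- t) b u.1 u.2.

Definition trilinear (U V T W : lmodType K) (f : U -> V -> T -> W) : Prop :=
  [/\ forall y z, linear (fun x => f x y z),
      forall x z, linear (fun y => f x y z)
    & forall x y, linear (fun z => f x y z)].

Definition tensor3_eq (U V T : lmodType K) (s t : seq (U * V * T)) : Prop :=
  forall (W : lmodType K) (f : U -> V -> T -> W), trilinear f ->
    \sum_(u <- s) f u.1.1 u.1.2 u.2 = \sum_(u <- t) f u.1.1 u.1.2 u.2.

End Tensors.

(* [comul h] is some list representing the coproduct of h, so identities
   between coproducts are stated up to [tensor_eq]. *)
Record hopf_algebra (K : fieldType) := HopfAlgebra {
  hopf_alg :> algType K;
  comul : hopf_alg -> seq (hopf_alg * hopf_alg);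
  counit : hopf_alg -> K;
  antipode : hopf_alg -> hopf_alg;
  comul_linear : forall (a : K) (x y : hopf_alg),
    tensor_eq (comul (a *: x + y))
              ([seq (a *: u.1, u.2) | u <- comul x] ++ comul y);
  comul1 : tensor_eq (comul 1) [:: (1, 1)];
  comulM : forall x y : hopf_alg,
    tensor_eq (comul (x * y))
              [seq (u.1 * v.1, u.2 * v.2) | u <- comul x, v <- comul y];
  comulA : forall x : hopf_alg,
    tensor3_eq [seq (v.1, v.2, u.2) | u <- comul x, v <- comul u.1]
               [seq (u.1, v.1, v.2) | u <- comul x, v <- comul u.2];
  counit_scalar : scalar counit;
  counit1 : counit 1 = 1;
  counitM : forall x y : hopf_alg, counit (x * y) = counit x * counit y;
  comul_counitl : forall x : hopf_alg,
    \sum_(u <- comul x) counit u.1 *: u.2 = x;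
  comul_counitr : forall x : hopf_alg,
    \sum_(u <- comul x) counit u.2 *: u.1 = x;
  antipode_linear : linear antipode;
  comul_antipodel : forall x : hopf_alg,
    \sum_(u <- comul x) antipode u.1 * u.2 = (counit x)%:A;
  comul_antipoder : forall x : hopf_alg,
    \sum_(u <- comul x) u.1 * antipode u.2 = (counit x)%:A
}.

Definition cocommutative (K : fieldType) (H : hopf_algebra K) : Prop :=
  forall h : H, tensor_eq (comul h) [seq (u.2, u.1) | u <- comul h].

Section HopfGalois.
Variables (K : fieldType) (L : fieldExtType K).

(* The image of a tensor in L (x)_K H under x (x) h |-> (y |-> x (h . y)). *)
Definition act_endo (H : hopf_algebra K) (act : H -> L -> L)
    (s : seq (L * H)) (y : L) : L :=
  \sum_(u <- s) u.1 * act u.2 y.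

Record hopf_galois := HopfGalois {
  hg_hopf :> hopf_algebra K;
  hg_cocomm : cocommutative hg_hopf;
  hg_act : hg_hopf -> L -> L;
  hg_act_linearl : forall y : L, linear (hg_act^~ y);
  hg_act_linearr : forall h : hg_hopf, linear (hg_act h);
  hg_act1 : forall y : L, hg_act 1 y = y;
  hg_actM : forall (g h : hg_hopf) (y : L),
    hg_act (g * h) y = hg_act g (hg_act h y);
  hg_act_mul : forall (h : hg_hopf) (x y : L),
    hg_act h (x * y) = \sum_(u <- comul h) hg_act u.1 x * hg_act u.2 y;
  hg_act_one : forall h : hg_hopf, hg_act h 1 = (counit h)%:A;
  hg_endo_inj : forall s t : seq (L * hg_hopf),
    act_endo hg_act s =1 act_endo hg_act t -> tensor_eq s t;
  hg_endo_surj : forall f : L -> L, linear f ->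
    exists s : seq (L * hg_hopf), act_endo hg_act s =1 f
}.

Definition hg_isom (S T : hopf_galois) : Prop :=
  exists f : {lrmorphism S -> T},
    [/\ bijective f,
        forall h : S, tensor_eq (comul (f h)) [seq (f u.1, f u.2) | u <- comul h],
        forall h : S, counit (f h) = counit h,
        forall h : S, antipode (f h) = f (antipode h)
      & forall (h : S) (y : L), hg_act (f h) y = hg_act h y].

(* There are exactly n structures satisfying P, up to isomorphism. *)
Definition hg_number (P : hopf_galois -> Prop) (n : nat) : Prop :=
  exists s : 'I_n -> hopf_galois,
    [/\ forall i, P (s i),
        forall i j, hg_isom (s i) (s j) -> i = j
      & forall T, P T -> exists i, hg_isom T (s i)].

End HopfGalois.

Local Open Scope group_scope.

Definition group_prop := forall gT : finGroupType, {group gT} -> Prop.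

Definition is_cyclic (n : nat) : group_prop :=
  fun gT G => cyclic G /\ #|G| = n.

(* C_m ><| C_n, with C_n acting faithfully on C_m. *)
Definition is_sdprod_cyclic (m n : nat) : group_prop :=
  fun gT G => exists A B : {group gT},
    [/\ A ><| B = G, is_cyclic m A, is_cyclic n B & 'C_B(A) = 1].

Definition is_dihedral (n : nat) : group_prop := fun gT G => G \isog 'D_n.

Definition is_dprod (P Q : group_prop) : group_prop :=
  fun gT G => exists A B : {group gT}, [/\ A \x B = G, P gT A & Q gT B].

(* A transitive permutation group of degree n, given by the abstract group and
   a point stabiliser. *)
Record perm_group (n : nat) := PermGroup {
  pg_type : finGroupType;
  pg_group :> {group pg_type};
  pg_stab : {group pg_type};
  pg_stab_sub : pg_stab \subset pg_group;
  pg_index : #|pg_group : pg_stab| = n;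
  pg_core : gcore pg_stab pg_group = 1
}.

Definition pg_isog (n : nat) (P Q : perm_group n) : Prop :=
  exists f : {morphism P >-> pg_type Q},
    [/\ 'injm f, f @* P = Q & f @* pg_stab P = pg_stab Q].

Section Extensions.
Variables (K : fieldType) (E : splittingFieldType K) (L : {subfield E}).

(* L / K is separable and E is the normal closure of L / K. *)
Definition separable_with_closure : Prop :=
  separable 1%VS L /\
  forall M : {subfield E},
    (L <= M)%VS -> normalField 1%VS M -> M = {:E}%AS.

Local Notation Gamma := ('Gal({:E} / 1))%G.
Local Notation Gamma' := ('Gal({:E} / L))%G.

Definition realises (n : nat) (P : perm_group n) : Prop :=
  separable_with_closure /\
  exists f : {morphism P >-> gal_of {:E}},
    [/\ 'injm f, f @* P = Gamma & f @* pg_stab P = Gamma'].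

Definition almost_classically_galois : Prop :=
  exists C : {group gal_of {:E}}, C ><| Gamma' = Gamma.

(* The product x * y of [gal_of] is "first x, then y", so the left cosets of
   Gamma' for the usual composition of automorphisms are MathComp's right
   cosets, and the left multiplication action lambda is 'Rs.  Permutations of
   X are the n with [perm_on cosetX n]. *)
Definition cosetX : {set {set gal_of {:E}}} := rcosets Gamma' Gamma.
Definition lambda (g : gal_of {:E}) : {perm {set gal_of {:E}}} :=
  actperm 'Rs g.

Definition regular_on_cosets (N : {group {perm {set gal_of {:E}}}}) : Prop :=
  [/\ {in N, forall n, perm_on cosetX n}, [transitive N, on cosetX | 'P]
    & forall x, x \in cosetX -> 'C_N[x | 'P] = 1].

Definition normalised_by_lambda (N : {group {perm {set gal_of {:E}}}}) : Prop :=
  forall g, g \in Gamma -> lambda g \in 'N(N).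

Local Open Scope ring_scope.

(* The Greither-Pareigis correspondence.  N corresponds to the Hopf algebra
   E[N]^Gamma, where Gamma acts on E by automorphisms and on N by conjugation
   through lambda, acting on L by
     (\sum_n c_n n) . x = \sum_n c_n (n^-1 (1 Gamma')) (x).
   Here \sum_n c_n n in E[N] is the function n |-> c_n (only its values on N
   matter), and [iota] identifies S with E[N]^Gamma.  The product n o m of N
   is MathComp's m * n, and E[N] (x)_E E[N] is the space of functions on
   N x N. *)
Definition gp_corresponds (S : hopf_galois (subvs_of L))
    (N : {group {perm {set gal_of {:E}}}}) : Prop :=
  exists iota : S -> {perm {set gal_of {:E}}} -> E,
  [/\ [/\ forall n, n \in N -> linear (iota^~ n),
          forall n, n \in N -> iota 1 n = (n == 1%g)%:R
        & forall (g h : S) k, k \in N ->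
            iota (g * h) k =
            \sum_(n in N) \sum_(m in N | (m * n)%g == k) iota g n * iota h m],
      [/\ forall (h : S) n m, n \in N -> m \in N ->
            \sum_(u <- comul h) iota u.1 n * iota u.2 m = iota h n *+ (n == m),
          forall h : S, (counit h)%:A = \sum_(n in N) iota h n
        & forall (h : S) n, n \in N -> iota (antipode h) n = iota h n^-1%g],
      forall g h : S, {in N, iota g =1 iota h} -> g = h,
      forall c : {perm {set gal_of {:E}}} -> E,
        (forall g n, g \in Gamma -> n \in N ->
           c (n ^ lambda g)%g = (g : gal_of {:E}) (c n)) <->
        (exists h : S, {in N, iota h =1 c})
    & forall (h : S) (x : subvs_of L),
        vsval (hg_act h x) =
        \sum_(n in N) iota h n *
          (repr (n^-1%g (Gamma' : {set gal_of {:E}})) : gal_of {:E}) (vsval x)].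

(* The type of S is a group satisfying P. *)
Definition hg_of_type (P : group_prop) (S : hopf_galois (subvs_of L)) : Prop :=
  exists N : {group {perm {set gal_of {:E}}}},
    [/\ regular_on_cosets N, normalised_by_lambda N, gp_corresponds S N
      & P _ N].

End Extensions.

Definition realised_by_type (n : nat) (P : group_prop) (G : perm_group n) : Prop :=
  exists (K : fieldType) (E : splittingFieldType K) (L : {subfield E}),
    realises L G /\ exists S : hopf_galois (subvs_of L), hg_of_type P S.

(* Every extension realising G has exactly k structures of type P. *)
Definition number_of_type (n : nat) (P : group_prop) (G : perm_group n)
    (k : nat) : Prop :=
  forall (K : fieldType) (E : splittingFieldType K) (L : {subfield E}),
    realises L G -> @hg_number K (subvs_of L) (@hg_of_type K E L P) k.

Definition row (p q : nat) (G : perm_group (p * q)) (order : nat)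
    (structure : group_prop) (ncyclic nnonabelian : nat) : Prop :=
  [/\ #|G| = order, structure _ (pg_group G),
      number_of_type (is_cyclic (p * q)) G ncyclic
    & number_of_type (is_sdprod_cyclic p q) G nnonabelian].

(* Main.v *)
From HB Require Import structures.
From mathcomp Require Import ring zify mpoly.
Require Import Defs.

(** Greither and Pareigis translate the statement into permutation groups: on
    an extension realising [G], the structures of a given type are counted by
    the regular groups [N] of that type on the points of [G] that [G]
    normalises.  One has to find the groups [G] of degree [pq] that normalise
    both a cyclic regular group and a regular group [C_p ><| C_q], and for each
    of them to count these regular groups.

    For the translation, the algebra attached to [N] is [H = E[N]^Gamma].  All
    that is used about it is one form of Galois descent, a finite dual basis of
    [H] inside [E[N]] ([descent_dual]).  It gives the coproduct, it reduces
    equality of tensors to equality of functions on powers of [N], and it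
    shows that [H] spans [E[N]] over [E].  Hence [H] acts as required
    ([hopf_galois_exists]), two structures attached to [N] are isomorphic
    ([corresponds_isom]), and an isomorphism between structures attached to [N]
    and [M] extends to [E[N]] and [E[M]], where it permutes group-like elements
    and forces [N = M] ([corresponds_inj]).

    A cyclic regular group [N0] identifies the points with the plane
    [F_p x F_q], where it becomes the group of translations; a transitive group
    normalising it then consists of maps [(u x + v, c y + d)].  It contains
    [t = (x + 1, y)] and, because [F_p] has [2q] units, some
    [g = (w x, y + 1)] with [w^q = 1] ([trans_t], [trans_g]).  The regular
    groups normalised by [t] and [g] have a normal form, generated by
    [(x + mu^y, y)] and [(a x + al w^y, y + 1)], with [mu] and [a] roots of
    unity of order dividing [q], at least one of them equal to 1
    ([regular_presented]).  Such a group is cyclic when [mu = a = 1] and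
    non-abelian otherwise.  If a non-abelian one is normalised, all [c] are 1
    ([trans_c1]), and the group is determined by [w] and by a subgroup of the
    cyclic group of order [2q] of multipliers, with four possibilities
    ([classify_family]).  Scaling [y] reduces [w] to 1 or to one fixed primitive
    root; for the two larger subgroups the choice of [w] does not change the
    group.  This leaves six groups ([common_normaliser]), told apart by order,
    centre and commutativity ([six_isog_inj]).

    The counts are numbers of normal forms.  There are [q] roots of unity, so
    one pair [(1, 1)] and [2 (q - 1)] other pairs [(mu, a)].  The coefficient
    [al] is forced to be 0 unless every map [(u x + v, y + d)] of the group has
    [u = w^d]; this happens with [w <> 1] for exactly one of the six groups,
    and there [al] is free whenever [w] is neither [mu] nor [a], which turns
    [1] into [p] and [2 (q - 1)] into [2 p (q - 2) + 2].  In each of the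
    groups the maps with [u = w^d] form a regular normal subgroup, a complement
    of every point stabiliser ([fam_complement]).

    Finally, for being realised, each [G] must be the group of some extension.
    Any finite group acts faithfully on a field of rational functions by
    permuting the variables ([faithful_action]), and Artin's theorem presents
    this field as a Galois extension of the fixed field ([artin_isom],
    [fixed_galois]). *)

Set Implicit Arguments.
Unset Strict Implicit.
Unset Printing Implicit Defensive.
Import GRing.Theory.
Local Open Scope ring_scope.

(** * Galois descent *)

Section LinearMaps.
Variables (K : fieldType) (U V : lmodType K) (f : U -> V).
Hypothesis lf : linear f.
Let fL : {linear U -> V} := HB.pack f (GRing.isLinear.Build K U V _ f lf).

Lemma linZ a : {morph f : x / a *: x}. Proof. exact: (linearZ_LR fL). Qed.
Lemma lin_sum I (r : seq I) (P : pred I) (F : I -> U) :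
  f (\sum_(i <- r | P i) F i) = \sum_(i <- r | P i) f (F i).
Proof. exact: (linear_sum fL). Qed.
End LinearMaps.

Section BilinearMaps.
Variables (K : fieldType) (U V W : lmodType K) (B : {bilinear U -> V -> W}).

Lemma bilinear_linl v : linear (B^~ v).
Proof. by move=> a x y; rewrite linearPl. Qed.

Lemma bilinear_linr u : linear (B u).
Proof. by move=> a x y; rewrite linearPr. Qed.
End BilinearMaps.

Section GaloisDual.
Variables (K : fieldType) (E : splittingFieldType K).
Local Notation gE := (gal_of {:E}).

Lemma gal_full (g : gE) : g \in 'Gal({:E} / 1)%g.
Proof. by rewrite gal_kHom ?sub1v ?k1AHom. Qed.

Lemma gal1M (x y : gE) a : (x * y)%g a = y (x a).
Proof. by rewrite galM ?memvf. Qed.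

(** Dedekind independence makes the matrix of the [g (w j)] invertible for some
    [w]; a column of its inverse is dual to [w], and translating the relation
    for [g * h^-1] by [h] gives its form in two variables. *)
Lemma gal_dual : exists r (a b : 'I_r -> E),
  forall g h : gE, \sum_k g (b k) * h (a k) = (g == h)%:R.
Proof.
have [w [_ _] [uM _ _]] := gal_matrix [set: gE].
set M := \matrix_(i, j) _ in uM.
have i1 : 1%g \in [set: gE] by rewrite inE.
pose i0 := enum_rank_in i1 (1%g : gE).
exists #|[set: gE]|, (fun k => invmx M k i0), (fun k => tnth w k) => g h.
have gi : (g * h^-1)%g \in [set: gE] by rewrite inE.
pose i := enum_rank_in gi (g * h^-1)%g.
have := congr1 (fun A : 'M[E]__ => h (A i i0)) (mulmxV uM).
rewrite !mxE rmorph_sum /= => /eqP.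
have -> : (i == i0) = (g == h).
  rewrite -(inj_eq enum_val_inj) /i /i0 !enum_rankK_in //.
  exact/esym/eq_mulgV1.
rewrite rmorph_nat => /eqP <-; apply: eq_bigr => k _.
by rewrite rmorphM mxE /i enum_rankK_in //= -gal1M mulgKV.
Qed.

(** The trace does not vanish, again by independence of automorphisms, and its
    values are fixed, so one of them can be scaled to 1. *)
Lemma gal_trace1 : exists th : E, \sum_(g : gE) g th = 1.
Proof.
have [x _ nz] := @gal_independent_contra K E {:E} predT (fun=> 1) 1%g isT (oner_neq0 _).
have /eqP/= : (\sum_(g : gE) 1 * g x) == \sum_(g : gE) g x.
  by apply/eqP/eq_bigr => g _; rewrite mul1r.
move=> eT; rewrite eT in nz; set t := \sum_g _ in nz.
have ft (h : gE) : h t = t.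
  rewrite /t rmorph_sum [RHS](reindex_inj (mulIg h)) /=.
  by apply: eq_bigr => g _; rewrite gal1M.
exists (x / t); transitivity (\sum_(g : gE) g x / t); last first.
  by rewrite -mulr_suml divff.
by apply: eq_bigr => g _; rewrite fmorph_div /= ft.
Qed.

(** A K-linear retraction of the inclusion of [K] in [E]. *)
Definition scalar_part (x : E) : K := coord [tuple (1 : E)] ord0 x.

Lemma scalar_part_scalar : scalar scalar_part.
Proof. by move=> a x y; rewrite /scalar_part linearP. Qed.

Lemma scalar_partA k : scalar_part k%:A = k.
Proof.
rewrite /scalar_part linearZ /=.
have /(coord_free ord0) -> : free [tuple (1 : E)] by rewrite seq1_free oner_neq0.
by rewrite mulr1.
Qed.

Lemma scalar_partK (galE : galois 1 {:E}) (x : E) :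
  (forall g : gE, g x = x) -> (scalar_part x)%:A = x.
Proof.
move=> fx; have : x \in 1%VS.
  rewrite -[1%VS](galois_fixedField galE); apply/fixedFieldP; rewrite ?memvf //.
by case/vlineP=> k ->; rewrite scalar_partA.
Qed.

End GaloisDual.

Section Descent.
Variables (K : fieldType) (E : splittingFieldType K).
Hypothesis galE : galois 1 {:E}.
Local Notation gE := (gal_of {:E}).
Variables (rT : finGroupType) (N : {group rT}) (lam : gE -> rT).
Hypothesis lamM : {morph lam : x y / (x * y)%g}.
Hypothesis lamN : forall g, lam g \in 'N(N)%g.

Definition equivariant (c : rT -> E) :=
  forall (g : gE) n, n \in N -> c (n ^ lam g)%g = g (c n).

(** Through [iota], the space [H] is [E[N]^Gamma], seen as functions on [N].
    Keeping [H] abstract lets the results below apply to any Hopf algebra that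
    corresponds to [N], and not only to the one constructed from [N]. *)
Record descends (H : lmodType K) (iota : H -> rT -> E) : Prop := Descends {
  desc_lin : forall n, n \in N -> linear (iota^~ n);
  desc_inj : forall g h, {in N, iota g =1 iota h} -> g = h;
  desc_img : forall c, equivariant c <-> exists h, {in N, iota h =1 c}
}.

Lemma orbit_sum_equivariant (a : E) (m : rT) :
  equivariant (fun n => \sum_(g | (m ^ lam g == n)%g) g a).
Proof.
move=> h n _ /=; rewrite rmorph_sum (reindex_inj (mulIg h)) /=.
by apply: eq_big => [g | g _]; rewrite ?gal1M // lamM conjgM (inj_eq (conjg_inj _)).
Qed.

(** Galois descent.  The [e] and [f] are the orbit sums of the functions [(th *
    b k) delta_m] and [a k delta_m], for [a], [b] dual as in [gal_dual] and [th]
    of trace 1.  Summing over [k] leaves only the diagonal of two orbit sums,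
    and the trace of [th] removes the remaining sum over the group.  The
    pairings with [e i] are fixed by the group, hence scalars, so that the [f i]
    span [H] over [K]. *)
Lemma descent_dual (H : lmodType K) (iota : H -> rT -> E) :
  descends iota ->
  exists (I : finType) (e f : I -> H) (phi : I -> H -> K),
  [/\ forall i, scalar (phi i),
      forall h, h = \sum_i phi i h *: f i,
      forall i h, (phi i h)%:A = \sum_(m in N) iota (e i) m * iota h m
    & forall m n, m \in N -> n \in N ->
        \sum_i iota (e i) m * iota (f i) n = (m == n)%:R].
Proof.
case=> iL iI iS.
have [r [a [b ab]]] := gal_dual E; have [th trth] := gal_trace1 E.
pose tau c (i : 'I_r * rT) n : E :=
  if i.2 \in N then \sum_(g | (i.2 ^ lam g == n)%g) g (c i.1) else 0.
have tauE c i : equivariant (tau c i).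
  move=> g n Nn; rewrite /tau; case: ifP => // _; last by rewrite rmorph0.
  exact: orbit_sum_equivariant.
have /fin_all_exists[e eE] : forall i, exists h, {in N, iota h =1 tau (fun k => th * b k) i}.
  by move=> i; apply/iS/tauE.
have /fin_all_exists[f fE] : forall i, exists h, {in N, iota h =1 tau a i}.
  by move=> i; apply/iS/tauE.
have ef m n : m \in N -> n \in N ->
    \sum_i iota (e i) m * iota (f i) n = (m == n)%:R.
  move=> Nm Nn.
  transitivity (\sum_k \sum_(m0 in N) \sum_(g | (m0 ^ lam g == m)%g)
     \sum_(h | (m0 ^ lam h == n)%g) g th * (g (b k) * h (a k))).
    rewrite pair_big_dep /= [RHS]big_mkcond /=; apply: eq_bigr => [[k m0]] _.
    rewrite eE // fE // /tau /=; case: ifP => _; last by rewrite mul0r.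
    rewrite mulr_suml; apply: eq_bigr => g _; rewrite mulr_sumr.
    by apply: eq_bigr => h _; rewrite rmorphM mulrA.
  rewrite exchange_big /=.
  transitivity (\sum_(m0 in N) \sum_(g | (m0 ^ lam g == m)%g)
     \sum_(h | (m0 ^ lam h == n)%g) g th * (g == h)%:R).
    apply: eq_bigr => m0 _; rewrite exchange_big; apply: eq_bigr => g _ /=.
    rewrite exchange_big; apply: eq_bigr => h _ /=.
    by rewrite -mulr_sumr ab.
  transitivity (\sum_(m0 in N) \sum_(g | (m0 ^ lam g == m)%g) g th * (m == n)%:R).
    apply: eq_bigr => m0 _; apply: eq_bigr => g /eqP gm.
    rewrite big_mkcond (bigD1 g) //= big1 ?addr0 => [|h]; last first.
      by rewrite eq_sym => /negPf->; rewrite mulr0 if_same.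
    by rewrite gm eqxx mulr1; case: eqP => // _; rewrite ?mulr1 ?mulr0.
  under eq_bigr do rewrite -mulr_suml.
  rewrite -mulr_suml; set S := (X in X * _); suff -> : S = 1 by rewrite mul1r.
  rewrite -trth /S (exchange_big_dep xpredT) //=; apply: eq_bigr => g _.
  rewrite (big_pred1 (m ^ (lam g)^-1)%g) // => m0 /=.
  apply/andP/eqP => [[_ /eqP <-]|->]; first by rewrite conjgK.
  by rewrite conjgKV eqxx memJ_norm ?groupV.
pose S i h := \sum_(m in N) iota (e i) m * iota h m.
have SE i h : (scalar_part (S i h))%:A = S i h.
  apply: scalar_partK => // g; rewrite /S rmorph_sum /=.
  have cE h' : equivariant (iota h') by apply/iS; exists h'.
  rewrite [RHS](reindex_inj (conjg_inj (lam g))) /=.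
  apply: eq_big => [n|n Nn]; first by rewrite memJ_norm.
  by rewrite rmorphM !cE.
exists _, e, f, (fun i h => scalar_part (S i h)); split=> //.
  move=> i c x y; rewrite -scalar_part_scalar; congr (scalar_part _); rewrite /S scaler_sumr -big_split /=.
  by apply: eq_bigr => m Nm; rewrite (iL m Nm) mulrDr scalerAr.
move=> h; apply: iI => n Nn; rewrite (lin_sum (iL n Nn)).
under eq_bigr => i _ do rewrite (linZ (iL n Nn)) -mulr_algl SE mulr_suml.
rewrite exchange_big /= (bigD1 n) //= [X in _ + X]big1 ?addr0 => [|m /andP[Nm mn]].
  transitivity ((n == n)%:R * iota h n); first by rewrite eqxx mul1r.
  by rewrite -ef // mulr_suml; apply: eq_bigr => i _; rewrite mulrAC.
under eq_bigr => i _ do rewrite mulrAC.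
by rewrite -mulr_suml ef // (negPf mn) mul0r.
Qed.

Section Consequences.
Variables (H : lmodType K) (iota : H -> rT -> E).
Hypothesis dH : descends iota.

(** [H] spans [E[N]] over [E], so an [E]-linear form on [E[N]] that vanishes on
    [H] is zero. *)
Lemma descent_separates (A : rT -> E) :
  (forall h, \sum_(n in N) A n * iota h n = 0) -> {in N, forall n, A n = 0}.
Proof.
move=> A0 m Nm; have [I [e [f [_ [_ _ _ ef]]]]] := descent_dual dH.
transitivity (\sum_i iota (e i) m * \sum_(n in N) A n * iota (f i) n); last first.
  by rewrite big1 // => i _; rewrite A0 mulr0.
under eq_bigr do rewrite mulr_sumr; rewrite exchange_big /= (bigD1 m) //=.
rewrite [X in _ + X]big1 ?addr0 => [|n /andP[Nn nm]].
  under eq_bigr do rewrite mulrCA; rewrite -mulr_sumr ef // eqxx mulr1 //.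
by under eq_bigr do rewrite mulrCA; rewrite -mulr_sumr ef // eq_sym (negPf nm) mulr0.
Qed.

(** Linear forms extend along [H] inside [E[N]]: [E] tensored with [H] is all of
    [E[N]]. *)
Lemma descent_functional (Lam : H -> E) : linear Lam ->
  exists A : rT -> E, forall h, Lam h = \sum_(n in N) A n * iota h n.
Proof.
move=> LL; have [I [e [f [phi [_ hE phiE _]]]]] := descent_dual dH.
exists (fun n => \sum_i iota (e i) n * Lam (f i)) => h.
rewrite {1}[h]hE (lin_sum LL); under eq_bigr do rewrite (linZ LL) -mulr_algl phiE mulr_suml.
rewrite exchange_big /=; apply: eq_bigr => n _; rewrite mulr_suml.
by apply: eq_bigr => i _; rewrite mulrAC.
Qed.

(** Expanding the second factors on the dual basis brings a tensor to the form
    of a sum of [u i (x) f i], where the [u i] are read off from the values of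
    the second factors on [N].  The maps [j^~ x] are coordinates that separate
    the points of [U]. *)
Lemma tensor_eq_descent (U : lmodType K) (X : Type) (j : U -> X -> E) :
    (forall x, linear (j^~ x)) -> (forall u v, j u =1 j v -> u = v) ->
  forall s t : seq (U * H),
    (forall x m, m \in N -> \sum_(w <- s) j w.1 x * iota w.2 m =
                           \sum_(w <- t) j w.1 x * iota w.2 m) ->
  tensor_eq s t.
Proof.
move=> jL jI s t st W B.
have [I [e [f [phi [phiL hE phiE _]]]]] := descent_dual dH.
have key (v : seq (U * H)) :
    \sum_(w <- v) B w.1 w.2 = \sum_i B (\sum_(w <- v) phi i w.2 *: w.1) (f i).
  transitivity (\sum_(w <- v) \sum_i B (phi i w.2 *: w.1) (f i)).
    apply: eq_bigr => w _; rewrite {1}[w.2]hE (lin_sum (bilinear_linr B _)).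
    apply: eq_bigr => i _.
    by rewrite (linZ (bilinear_linr B _)) (linZ (bilinear_linl B _)).
  by rewrite exchange_big /=; apply: eq_bigr => i _; rewrite (lin_sum (bilinear_linl B _)).
rewrite !key; apply: eq_bigr => i _; congr (B _ _); apply: jI => x.
rewrite !(lin_sum (jL x)).
have expand (v : seq (U * H)) : \sum_(w <- v) j (phi i w.2 *: w.1) x =
    \sum_(m in N) iota (e i) m * \sum_(w <- v) j w.1 x * iota w.2 m.
  under [RHS]eq_bigr do rewrite mulr_sumr.
  rewrite exchange_big /=; apply: eq_bigr => w _.
  rewrite (linZ (jL x)) -mulr_algl phiE mulr_suml.
  by apply: eq_bigr => m _; rewrite mulrAC -mulrA.
by rewrite !expand; apply: eq_bigr => m Nm; rewrite st.
Qed.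

Lemma tensor_eq_descent2 (s t : seq (H * H)) :
    (forall n m, n \in N -> m \in N -> \sum_(w <- s) iota w.1 n * iota w.2 m =
                           \sum_(w <- t) iota w.1 n * iota w.2 m) ->
  tensor_eq s t.
Proof.
move=> st; apply: (@tensor_eq_descent H {n | n \in N} (fun h x => iota h (val x))).
- by move=> [n Nn]; apply: (desc_lin dH).
- by move=> u v uv; apply: (desc_inj dH) => n Nn; have := uv (exist _ n Nn).
- by move=> [n Nn] m Nm; apply: st.
Qed.

Lemma tensor3_eq_descent (s t : seq (H * H * H)) :
    (forall n m k, n \in N -> m \in N -> k \in N ->
       \sum_(w <- s) iota w.1.1 n * iota w.1.2 m * iota w.2 k =
       \sum_(w <- t) iota w.1.1 n * iota w.1.2 m * iota w.2 k) ->
  tensor3_eq s t.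
Proof.
move=> st W F [F1 F2 F3].
have [I [e [f [phi [phiL hE phiE _]]]]] := descent_dual dH.
have key (v : seq (H * H * H)) :
    \sum_(w <- v) F w.1.1 w.1.2 w.2 =
    \sum_i \sum_l F (\sum_(w <- v) (phi i w.1.2 * phi l w.2) *: w.1.1) (f i) (f l).
  transitivity (\sum_(w <- v) \sum_i \sum_l
      F ((phi i w.1.2 * phi l w.2) *: w.1.1) (f i) (f l)).
    apply: eq_bigr => w _; rewrite {1}[w.1.2]hE (lin_sum (F2 _ _)).
    apply: eq_bigr => i _; rewrite {1}[w.2]hE (lin_sum (F3 _ _)).
    apply: eq_bigr => l _; rewrite (linZ (F2 _ _)) (linZ (F3 _ _)) (linZ (F1 _ _)).
    by rewrite scalerA.
  rewrite exchange_big /=; apply: eq_bigr => i _.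
  by rewrite exchange_big /=; apply: eq_bigr => l _; rewrite (lin_sum (F1 _ _)).
rewrite !key; apply: eq_bigr => i _; apply: eq_bigr => l _; congr (F _ _ _).
apply: (desc_inj dH) => n Nn; have nL := desc_lin dH Nn; rewrite !(lin_sum nL).
have expand (v : seq (H * H * H)) :
    \sum_(w <- v) iota ((phi i w.1.2 * phi l w.2) *: w.1.1) n =
    \sum_(m in N) \sum_(k in N) iota (e i) m * iota (e l) k *
       \sum_(w <- v) iota w.1.1 n * iota w.1.2 m * iota w.2 k.
  under [RHS]eq_bigr do under eq_bigr do rewrite mulr_sumr.
  under [RHS]eq_bigr do rewrite exchange_big /=.
  rewrite exchange_big /=; apply: eq_bigr => w _.
  rewrite (linZ nL) -scalerA -mulr_algl phiE mulr_suml.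
  apply: eq_bigr => m _; rewrite -mulr_algl phiE mulr_suml mulr_sumr.
  by apply: eq_bigr => k _; ring.
by rewrite !expand; apply: eq_bigr => m Nm; apply: eq_bigr => k Nk; rewrite st.
Qed.

End Consequences.
End Descent.

(** * Regular groups on the cosets of a point stabiliser *)

Section Closure.
Variables (K : fieldType) (E : splittingFieldType K) (L : {subfield E}).
Local Notation gE := (gal_of {:E}).

(** The conjugates of a primitive element of [L] are separable and generate a
    normal field that contains [L], hence [E]. *)
Lemma separable_closure_galois : separable_with_closure L -> galois 1 {:E}.
Proof.
case=> sepL clE; rewrite /galois sub1v normalFieldf andbT /=.
pose x := separable_generator 1 L.
have defL : <<1; x>>%VS = L by apply/esym/eq_adjoin_separable_generator; rewrite ?sub1v.
have [r /allP _ Dr] := normalFieldP (normalFieldf 1) x (memvf x).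
have sepr : all (separable_element 1) r.
  apply/allP => y ry.
  have root_y : root (minPoly 1 x) y by rewrite Dr root_prod_XsubC.
  have Lx : x \in L by rewrite -defL memv_adjoin.
  have /separableP/(_ _ Lx) sx := sepL.
  rewrite /separable_element; apply: dvdp_separable sx.
  by apply: minPoly_dvdp => //; apply: minPolyOver.
have xr : x \in r by rewrite -root_prod_XsubC -Dr root_minPoly.
have <- : <<1 & r>>%VS = {:E}%VS; last exact: separable_Fadjoin_seq.
apply: (congr1 val (clE <<1 & r>>%AS _ _)) => /=.
- rewrite -defL; apply/FadjoinP; rewrite subv_adjoin_seq; split=> //.
  by apply: seqv_sub_adjoin.
- apply/splitting_normalField; first exact: subv_adjoin_seq.
  exists (minPoly 1 x); first exact: minPolyOver.
  by exists r; rewrite // Dr eqpxx.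
Qed.
End Closure.

Section Cosets.
Variables (K : fieldType) (E : splittingFieldType K) (L : {subfield E}).
Local Notation gE := (gal_of {:E}).
Local Notation Gamma' := ('Gal({:E} / L))%G.
Local Notation X0 := (Gamma' : {set gE}).
Local Notation X := (cosetX L).
Implicit Types (N : {group {perm {set gE}}}).

Lemma lambdaE (g : gE) A : lambda g A = (A :* g)%g.
Proof. by rewrite /lambda actpermE /= rcosetE. Qed.

Lemma lambdaM : {morph (@lambda K E) : x y / (x * y)%g}.
Proof. by move=> x y; apply/permP => A; rewrite permM !lambdaE rcosetM. Qed.

Lemma mem_cosetX (g : gE) : (Gamma' :* g)%g \in X.
Proof. by apply/rcosetsP; exists g; rewrite ?gal_full. Qed.

Lemma base_cosetX : X0 \in X.
Proof. by rewrite -[X0]mulg1 mem_cosetX. Qed.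

Lemma coset_lambda (g : gE) : (Gamma' :* g)%g = lambda g X0.
Proof. by rewrite lambdaE. Qed.

Lemma cosetX_repr A : A \in X -> A = (Gamma' :* repr A)%g.
Proof. by case/rcosetsP => g _ ->; rewrite rcoset_repr. Qed.

Lemma coset_eval (g h : gE) x :
  x \in L -> (Gamma' :* g = Gamma' :* h)%g -> g x = h x.
Proof.
move=> Lx gh; have : g \in (Gamma' :* h)%g by rewrite -gh rcoset_refl.
case/rcosetP=> c Gc ->; rewrite gal1M; congr (h _).
by apply: (fixed_gal (subvf L) Gc).
Qed.

(** By [coset_eval] the value of [rep n] at elements of [L] depends only on the
    coset [n^-1 (Gamma')], so this is the embedding of [L] through which [n]
    acts. *)
Definition rep (n : {perm {set gE}}) : gE := repr (n^-1%g X0).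

Section Regular.
Variable N : {group {perm {set gE}}}.
Hypothesis regN : regular_on_cosets L N.

Lemma regular_closed n A : n \in N -> A \in X -> n A \in X.
Proof. by case: regN => on _ _ Nn; rewrite perm_closed ?on. Qed.

Lemma regular_eq n m A : n \in N -> m \in N -> A \in X -> n A = m A -> n = m.
Proof.
case: regN => _ _ st Nn Nm XA nm; apply/eqP; rewrite eq_mulgV1.
have : (n * m^-1)%g \in 'C_N[A | 'P]%g.
  rewrite inE groupM ?groupV //=; apply/astab1P; rewrite /= /aperm permM nm.
  by rewrite -permM mulgV perm1.
by rewrite st // inE.
Qed.

Lemma rep_coset n : n \in N -> n^-1%g X0 = (Gamma' :* rep n)%g.
Proof. by move=> Nn; apply/cosetX_repr/regular_closed; rewrite ?groupV // base_cosetX. Qed.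

Lemma regular_rep_eq n m : n \in N -> m \in N -> n^-1%g X0 = m^-1%g X0 -> n = m.
Proof.
move=> Nn Nm e; apply: invg_inj; apply: (@regular_eq _ _ X0); rewrite ?groupV //.
exact: base_cosetX.
Qed.

Lemma regular_surj A : A \in X -> exists2 n, n \in N & n^-1%g X0 = A.
Proof.
case: regN => _ /atransP/(_ _ base_cosetX) oN _; rewrite -oN => /orbitP[n Nn <-].
by exists n^-1%g; rewrite ?groupV ?invgK.
Qed.

Hypothesis galE : galois 1 {:E}.

(** The embeddings [rep n] of [L] are distinct, hence independent.  To use the
    independence of automorphisms of [E] instead, evaluate the relation at
    traces from [E] to [L]: it becomes a relation whose coefficients are
    constant on cosets. *)
Lemma rep_independent (F : {perm {set gE}} -> E) :
  (forall x, x \in L -> \sum_(n in N) F n * rep n x = 0) ->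
  {in N, forall n, F n = 0}.
Proof.
move=> F0 m Nm.
pose c (g : gE) := \sum_(n in N | n^-1%g X0 == (Gamma' :* g)%g) F n.
have c0 (g : gE) : c g = 0.
  apply: (@gal_independent K E {:E} predT) => // z _.
  pose T := \sum_(h in Gamma') h z.
  have LT : T \in L.
    have gEL : galois L {:E} by apply: galoisS galE; rewrite sub1v subvf.
    by have := mem_galTrace gEL (memvf z).
  rewrite -[RHS](F0 _ LT).
  under eq_bigr do rewrite mulr_suml.
  rewrite (exchange_big_dep [in N]) //=; last by move=> g' n _ /andP[].
  apply: eq_bigr => n Nn; rewrite -mulr_sumr; congr (_ * _).
  rewrite /T rmorph_sum /=.
  transitivity (\sum_(g' in (Gamma' :* rep n)%g) g' z).
    apply: eq_bigl => g'; rewrite Nn rep_coset //=.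
    apply/eqP/idP => [->|]; first exact: rcoset_refl.
    by move/rcoset_eqP.
  rewrite (reindex_inj (mulIg (rep n))) /=.
  by apply: eq_big => [h | h _]; rewrite ?gal1M // mem_rcoset mulgK.
rewrite -(c0 (rep m)) /c (big_pred1 m) // => n /=; rewrite -rep_coset //.
by apply/andP/eqP => [[Nn /eqP/regular_rep_eq->]|->].
Qed.

Hypothesis normN : normalised_by_lambda N.

Lemma normalised_lambda g : lambda g \in 'N(N)%g.
Proof. by apply: normN; apply: gal_full. Qed.

(** This and [rep_mul] relate [n |-> rep n] to conjugation by [lambda] and to
    products; they say that the sums of [c_n (rep n x)] with [c] in [E[N]^Gamma]
    stay in [L] and compose as elements of [E[N]]. *)
Lemma rep_conj n (g : gE) x : n \in N -> g \in Gamma' -> x \in L ->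
  rep (n ^ lambda g)%g x = g (rep n x).
Proof.
move=> Nn Gg Lx; rewrite -gal1M; apply: coset_eval => //.
rewrite -rep_coset ?memJ_norm ?normalised_lambda // -conjVg conjgE !permM.
have -> : (lambda g)^-1%g X0 = X0.
  by apply: (canLR (permK _)); rewrite lambdaE rcoset_id.
by rewrite lambdaE rep_coset // -rcosetM.
Qed.

Lemma rep_mul n m x : n \in N -> m \in N -> x \in L ->
  rep (m * n)%g x = rep n (rep (m ^ (lambda (rep n))^-1)%g x).
Proof.
move=> Nn Nm Lx; rewrite -gal1M; apply: coset_eval => //.
have Nm' : (m ^ (lambda (rep n))^-1)%g \in N.
  by rewrite memJ_norm ?groupV ?normalised_lambda.
rewrite -rep_coset ?groupM // rcosetM -rep_coset // -conjVg conjgE invgK invMg !permM.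
by rewrite -lambdaE permKV rep_coset // -coset_lambda.
Qed.
End Regular.
End Cosets.

(** * The Hopf algebra of a twisted group algebra *)

(** The data from which [E[N]^Gamma] is formed: the group [N], and an action of
    [Gamma] on it by conjugation inside a larger group. *)
Record twist (K : fieldType) (E : splittingFieldType K) := Twist {
  tw_type : finGroupType;
  tw_group : {group tw_type};
  tw_lam : gal_of {:E} -> tw_type;
  tw_lamM : {morph tw_lam : x y / (x * y)%g};
  tw_lamN : forall g, tw_lam g \in 'N(tw_group)%g
}.

Section TwistedGroupAlgebra.
Variables (K : fieldType) (E : splittingFieldType K) (D : twist E).
Local Notation gE := (gal_of {:E}).
Local Notation rT := (tw_type D).
Local Notation N := (tw_group D).
Local Notation lam := (@tw_lam K E D).

(** Functions are required to vanish outside [N], so that equality of elements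
    is equality of functions. *)
Definition fixed_element : pred {ffun rT -> E} := fun c =>
  [forall n, (n \notin N) ==> (c n == 0)] &&
  [forall g : gE, forall n, c (n ^ lam g)%g == g (c n)].

Lemma fixed_elementP (c : {ffun rT -> E}) :
  reflect ((forall n, n \notin N -> c n = 0) /\
           (forall (g : gE) n, c (n ^ lam g)%g = g (c n))) (c \in fixed_element).
Proof.
apply: (iffP andP) => [[/forallP c0 /forallP cg]|[c0 cg]]; split.
- by move=> n nN; apply/eqP/(implyP (c0 n)).
- by move=> g n; apply/eqP/(forallP (cg g)).
- by apply/forallP => n; apply/implyP => /c0/eqP.
- by apply/forallP => g; apply/forallP => n; apply/eqP/cg.
Qed.

Lemma fixed_element_submod : submod_closed fixed_element.
Proof.
split=> [|a x y /fixed_elementP[x0 xg] /fixed_elementP[y0 yg]]; apply/fixed_elementP; split.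
- by move=> n _; rewrite ffunE.
- by move=> g n; rewrite !ffunE rmorph0.
- by move=> n nN; rewrite !ffunE x0 ?y0 // scaler0 addr0.
- by move=> g n; rewrite !ffunE xg yg linearP.
Qed.
HB.instance Definition _ := GRing.isSubmodClosed.Build K {ffun rT -> E} fixed_element
  fixed_element_submod.

Record twisted := Twisted {tw_fun :> {ffun rT -> E}; _ : tw_fun \in fixed_element}.
HB.instance Definition _ := [isSub for tw_fun].
HB.instance Definition _ := [Choice of twisted by <:].
HB.instance Definition _ := [SubChoice_isSubLmodule of twisted by <:].

Lemma twisted_out (h : twisted) n : n \notin N -> h n = 0.
Proof. by case: h => c /= hc; have [c0 _] := fixed_elementP _ hc; apply: c0. Qed.

Lemma twisted_conj (h : twisted) (g : gE) n : h (n ^ lam g)%g = g (h n).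
Proof. by case: h => c /= hc; have [_ cg] := fixed_elementP _ hc; apply: cg. Qed.

Lemma twisted_eq (g h : twisted) : {in N, g =1 h} -> g = h.
Proof.
move=> gh; apply/val_inj/ffunP => n /=.
by have [/gh //|nN] := boolP (n \in N); rewrite !twisted_out.
Qed.

Lemma twistedP (c : rT -> E) : equivariant N lam c ->
  exists h : twisted, {in N, h =1 c}.
Proof.
move=> cg; pose d := [ffun n => if n \in N then c n else 0].
have dP : d \in fixed_element.
  apply/fixed_elementP; split=> [n|g n]; rewrite !ffunE; first by move/negPf->.
  by rewrite memJ_norm ?tw_lamN //; case: ifP => Nn; rewrite ?rmorph0 ?cg.
by exists (Twisted dP) => n Nn; rewrite ffunE Nn.
Qed.

Fact tw_one_subproof : [ffun n : rT => ((n == 1%g)%:R : E)] \in fixed_element.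
Proof.
apply/fixed_elementP; split=> [n|g n]; rewrite !ffunE.
  by case: eqP => [->|//]; rewrite group1.
by rewrite -(conj1g (lam g)) (inj_eq (conjg_inj _)) conj1g rmorph_nat.
Qed.
Definition tw_one := Twisted tw_one_subproof.

Fact tw_mul_subproof (g h : twisted) :
  [ffun k => \sum_(n in N) g n * h (k * n^-1)%g] \in fixed_element.
Proof.
apply/fixed_elementP; split=> [k kN|s k]; rewrite !ffunE.
  by apply: big1 => n Nn; rewrite (twisted_out h) ?mulr0 // groupMr ?groupV.
rewrite rmorph_sum (reindex_inj (conjg_inj (lam s))) /=.
apply: eq_big => n; rewrite ?memJ_norm ?tw_lamN // => Nn.
by rewrite rmorphM /= -!twisted_conj conjMg conjVg.
Qed.
Definition tw_mul g h := Twisted (tw_mul_subproof g h).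

Lemma tw_mulA : associative tw_mul.
Proof.
move=> f g h; apply/val_inj/ffunP => k; rewrite !ffunE.
under eq_bigr do rewrite ffunE mulr_sumr.
under [RHS]eq_bigr do rewrite ffunE mulr_suml.
rewrite [RHS]exchange_big /=; apply: eq_bigr => n Nn.
rewrite [RHS](reindex_inj (mulIg n)) /=.
apply: eq_big => [m|m _]; first by rewrite groupMr.
by rewrite mulgK invMg !mulgA mulrA.
Qed.

Lemma tw_mul1l : left_id tw_one tw_mul.
Proof.
move=> h; apply/val_inj/ffunP => k; rewrite !ffunE (bigD1 1%g) //= big1.
  by rewrite ffunE eqxx mul1r invg1 mulg1 addr0.
by move=> n /andP[_ /negPf n1]; rewrite ffunE n1 mul0r.
Qed.

Lemma tw_mulr1 : right_id tw_one tw_mul.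
Proof.
move=> h; apply: twisted_eq => k Nk; rewrite !ffunE (bigD1 k) //= big1.
  by rewrite ffunE mulgV eqxx mulr1 addr0.
by move=> n /andP[_ /negPf nk]; rewrite ffunE -eq_mulgV1 eq_sym nk mulr0.
Qed.

Lemma tw_mulDl : left_distributive tw_mul +%R.
Proof.
move=> f g h; apply/val_inj/ffunP => k; rewrite !ffunE -big_split /=.
by apply: eq_bigr => n _; rewrite ffunE mulrDl.
Qed.

Lemma tw_mulDr : right_distributive tw_mul +%R.
Proof.
move=> f g h; apply/val_inj/ffunP => k; rewrite !ffunE -big_split /=.
by apply: eq_bigr => n _; rewrite ffunE mulrDr.
Qed.

Lemma tw_one_neq0 : tw_one != 0.
Proof.
apply/eqP => /(congr1 (fun h : twisted => h 1%g)); rewrite !ffunE eqxx => /eqP.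
by rewrite oner_eq0.
Qed.

HB.instance Definition _ := GRing.Zmodule_isNzRing.Build twisted
  tw_mulA tw_mul1l tw_mulr1 tw_mulDl tw_mulDr tw_one_neq0.

Lemma tw_scaleAl (a : K) (g h : twisted) : a *: (g * h) = a *: g * h.
Proof.
apply/val_inj/ffunP => k; rewrite !ffunE scaler_sumr.
by apply: eq_bigr => n _; rewrite ffunE scalerAl.
Qed.

HB.instance Definition _ := GRing.Lmodule_isLalgebra.Build K twisted tw_scaleAl.

Lemma tw_scaleAr (a : K) (g h : twisted) : a *: (g * h) = g * (a *: h).
Proof.
apply/val_inj/ffunP => k; rewrite !ffunE scaler_sumr.
by apply: eq_bigr => n _; rewrite ffunE scalerAr.
Qed.

HB.instance Definition _ := GRing.Lalgebra_isAlgebra.Build K twisted tw_scaleAr.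

Lemma twistedZ (a : K) (h : twisted) n : (a *: h) n = a *: h n.
Proof. by rewrite /= ffunE. Qed.
Lemma twistedD (g h : twisted) n : (g + h) n = g n + h n.
Proof. by rewrite /= ffunE. Qed.
Lemma twisted1 n : (1 : twisted) n = (n == 1%g)%:R.
Proof. by rewrite /= ffunE. Qed.
Lemma twistedM (g h : twisted) k :
  (g * h) k = \sum_(n in N) g n * h (k * n^-1)%g.
Proof. by rewrite /= ffunE. Qed.
Lemma twisted_linear n : linear (fun h : twisted => h n).
Proof. by move=> a g h; rewrite twistedD twistedZ. Qed.

Lemma twisted_descends : descends N lam (fun h : twisted => h : rT -> E).
Proof.
split=> [n _|g h|c]; first exact: twisted_linear.
  exact: twisted_eq.
split=> [/twistedP//|[h hc] g n Nn]; rewrite -!hc ?memJ_norm ?tw_lamN //.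
exact: twisted_conj.
Qed.

Lemma tw_pmul_subproof (g h : twisted) : [ffun n => g n * h n] \in fixed_element.
Proof.
apply/fixed_elementP; split=> [n nN|s n]; rewrite !ffunE.
  by rewrite twisted_out ?mul0r.
by rewrite !twisted_conj rmorphM.
Qed.
Definition tw_pmul g h := Twisted (tw_pmul_subproof g h).

Fact tw_inv_subproof (h : twisted) : [ffun n => h n^-1%g] \in fixed_element.
Proof.
apply/fixed_elementP; split=> [n nN|s n]; rewrite !ffunE.
  by rewrite twisted_out // groupV.
by rewrite -conjVg twisted_conj.
Qed.
Definition tw_antipode h := Twisted (tw_inv_subproof h).

Definition tw_counit (h : twisted) : K := scalar_part (\sum_(n in N) h n).

Hypothesis galE : galois 1 {:E}.

Lemma tw_counitE h : (tw_counit h)%:A = \sum_(n in N) h n.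
Proof.
apply: scalar_partK => // g; rewrite rmorph_sum [RHS](reindex_inj (conjg_inj (lam g))) /=.
by apply: eq_big => [n|n _]; rewrite ?memJ_norm ?tw_lamN ?twisted_conj.
Qed.

Lemma kA_inj : injective (fun k : K => k%:A : E).
Proof. by move=> k l kl; rewrite -[k](@scalar_partA K E) kl scalar_partA. Qed.

Variables (I : finType) (e f : I -> twisted).
Hypothesis ef : forall m n, m \in N -> n \in N ->
  \sum_i e i m * f i n = (m == n)%:R.

(** The coproduct sends [n] to [n (x) n].  The summands of [\sum_n h n *: n (x)
    n] lie in [E[N]] only; multiplying [h] by the dual basis, whose sum of [e i
    (x) f i] is the diagonal of [N x N], writes the same tensor with factors in
    [E[N]^Gamma]. *)
Definition tw_comul (h : twisted) : seq (twisted * twisted) :=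
  [seq (tw_pmul h (e i), f i) | i <- index_enum I].

Lemma tw_comulE h n m : n \in N -> m \in N ->
  \sum_(u <- tw_comul h) u.1 n * u.2 m = h n *+ (n == m).
Proof.
move=> Nn Nm; rewrite big_map /= -mulr_natr -ef // mulr_sumr.
by apply: eq_bigr => i _; rewrite ffunE mulrA.
Qed.

Local Notation tens2 := (tensor_eq_descent2 galE (@tw_lamM _ _ D) (@tw_lamN _ _ D) twisted_descends).
Local Notation tens3 := (tensor3_eq_descent galE (@tw_lamM _ _ D) (@tw_lamN _ _ D) twisted_descends).

Lemma tw_comul_linear (a : K) (x y : twisted) :
  tensor_eq (tw_comul (a *: x + y))
            ([seq (a *: u.1, u.2) | u <- tw_comul x] ++ tw_comul y).
Proof.
apply: tens2 => n m Nn Nm; rewrite big_cat /= [in RHS]big_map /= !tw_comulE //.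
rewrite twistedD twistedZ mulrnDl -tw_comulE //; congr (_ + _).
rewrite scalerMnr -(tw_comulE x Nn Nm) scaler_sumr.
by apply: eq_bigr => u _; rewrite twistedZ scalerAl.
Qed.

Lemma tw_comul1 : tensor_eq (tw_comul 1) [:: (1, 1)].
Proof.
apply: tens2 => n m Nn Nm; rewrite tw_comulE // big_seq1 /= !twisted1.
have [->|nm] := eqVneq n m.
  by case: eqP; rewrite ?mulr1 ?mulr0.
have [n1|] := eqVneq n 1%g; rewrite ?mul0r //.
by rewrite -n1 eq_sym (negPf nm) mulr0.
Qed.

(** A sum over the coproduct restricts double sums to the diagonal; the axioms
    for the counit and the antipode follow from it. *)
Lemma tw_comul_sum (h : twisted) (w : rT -> rT -> E) :
  \sum_(u <- tw_comul h) \sum_(n in N) \sum_(m in N) u.1 n * u.2 m * w n m =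
  \sum_(n in N) h n * w n n.
Proof.
rewrite exchange_big /=; apply: eq_bigr => n Nn.
rewrite exchange_big /= (bigD1 n) //= [X in _ + X]big1 ?addr0 => [|m /andP[Nm mn]].
  by rewrite -mulr_suml tw_comulE // eqxx.
by rewrite -mulr_suml tw_comulE // eq_sym (negPf mn) mul0r.
Qed.

Lemma tw_comulM (x y : twisted) :
  tensor_eq (tw_comul (x * y))
            [seq (u.1 * v.1, u.2 * v.2) | u <- tw_comul x, v <- tw_comul y].
Proof.
apply: tens2 => n m Nn Nm; rewrite tw_comulE // big_allpairs_dep /= twistedM.
transitivity (\sum_(u <- tw_comul x) \sum_(a in N) \sum_(b in N) u.1 a * u.2 b *
   (y (n * a^-1)%g *+ (n * a^-1 == m * b^-1)%g)).
  rewrite tw_comul_sum -sumrMnl; apply: eq_bigr => a _.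
  by rewrite (inj_eq (mulIg _)) mulrnAr.
apply: eq_bigr => u _; under [RHS]eq_bigr do rewrite !twistedM big_distrlr.
rewrite [RHS]exchange_big /=; apply: eq_bigr => a Na.
rewrite [RHS]exchange_big /=; apply: eq_bigr => b Nb.
rewrite -tw_comulE ?groupM ?groupV // mulr_sumr.
by apply: eq_bigr => v _; rewrite mulrACA.
Qed.

Lemma tw_comulA (x : twisted) :
  tensor3_eq [seq (v.1, v.2, u.2) | u <- tw_comul x, v <- tw_comul u.1]
             [seq (u.1, v.1, v.2) | u <- tw_comul x, v <- tw_comul u.2].
Proof.
apply: tens3 => n m k Nn Nm Nk; rewrite !big_allpairs_dep /=.
transitivity (x n *+ (n == k) *+ (n == m)).
  rewrite -tw_comulE // -sumrMnl; apply: eq_bigr => u _.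
  by rewrite -mulr_suml tw_comulE // mulrnAl.
transitivity (x n *+ (n == m) *+ (m == k)).
  by have [<-|_] := eqVneq n m; rewrite ?mulr1n ?mulr0n ?mul0rn.
rewrite -tw_comulE // -sumrMnl; apply: eq_bigr => u _.
under eq_bigr do rewrite -mulrA.
by rewrite -mulr_sumr tw_comulE // mulrnAr.
Qed.

Lemma tw_counit_scalar : scalar tw_counit.
Proof.
move=> a x y; rewrite -[RHS]scalar_part_scalar; congr (scalar_part _).
rewrite scaler_sumr -big_split /=; apply: eq_bigr => n _.
exact: (twisted_linear n a x y).
Qed.

Lemma tw_counit1 : tw_counit 1 = 1.
Proof.
apply: kA_inj; rewrite tw_counitE scale1r (bigD1 1%g) //= big1 => [|n /andP[_ /negPf n1]].
  by rewrite twisted1 eqxx addr0.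
by rewrite twisted1 n1.
Qed.

Lemma tw_counitM (x y : twisted) : tw_counit (x * y) = tw_counit x * tw_counit y.
Proof.
apply: kA_inj; rewrite -mulr_algl -scalerAl mul1r.
rewrite -[RHS]scalerA -[RHS]mulr_algl !tw_counitE mulr_suml.
under eq_bigr do rewrite twistedM.
rewrite exchange_big /=; apply: eq_bigr => n Nn; rewrite -mulr_sumr; congr (_ * _).
rewrite (reindex_inj (mulIg n)) /=.
by apply: eq_big => [m|m _]; rewrite ?groupMr // mulgK.
Qed.

Lemma tw_comul_counitl (x : twisted) :
  \sum_(u <- tw_comul x) tw_counit u.1 *: u.2 = x.
Proof.
apply: twisted_eq => n Nn; rewrite (lin_sum (twisted_linear n)).
transitivity (\sum_(u <- tw_comul x) \sum_(a in N) \sum_(b in N)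
   u.1 a * u.2 b * (b == n)%:R).
  apply: eq_bigr => u _; rewrite twistedZ -mulr_algl tw_counitE mulr_suml.
  apply: eq_bigr => a Na; rewrite (bigD1 n) //= eqxx mulr1 big1 ?addr0 // => b.
  by case/andP=> _ /negPf->; rewrite mulr0.
rewrite tw_comul_sum (bigD1 n) //= eqxx mulr1 big1 ?addr0 // => b.
by case/andP=> _ /negPf->; rewrite mulr0.
Qed.

Lemma tw_comul_counitr (x : twisted) :
  \sum_(u <- tw_comul x) tw_counit u.2 *: u.1 = x.
Proof.
apply: twisted_eq => n Nn; rewrite (lin_sum (twisted_linear n)).
transitivity (\sum_(u <- tw_comul x) \sum_(a in N) \sum_(b in N)
   u.1 a * u.2 b * (a == n)%:R).
  apply: eq_bigr => u _; rewrite twistedZ -mulr_algl tw_counitE.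
  rewrite [RHS](bigD1 n) //= [X in _ + X]big1 ?addr0 => [|a /andP[_ /negPf->]].
    by rewrite eqxx mulr_suml; apply: eq_bigr => b _; rewrite mulr1 mulrC.
  by apply: big1 => b _; rewrite mulr0.
rewrite tw_comul_sum (bigD1 n) //= eqxx mulr1 big1 ?addr0 // => b.
by case/andP=> _ /negPf->; rewrite mulr0.
Qed.

Lemma tw_antipode_linear : linear tw_antipode.
Proof.
move=> a x y; apply: twisted_eq => n Nn; rewrite ffunE.
rewrite (twisted_linear n^-1%g a x y) (twisted_linear n a) !ffunE //.
Qed.

Lemma tw_comul_antipodel (x : twisted) :
  \sum_(u <- tw_comul x) tw_antipode u.1 * u.2 = (tw_counit x)%:A.
Proof.
apply: twisted_eq => k Nk; rewrite (lin_sum (twisted_linear k)) twistedZ twisted1.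
transitivity (\sum_(u <- tw_comul x) \sum_(a in N) \sum_(b in N)
   u.1 a * u.2 b * (b * a^-1 == k)%g%:R).
  apply: eq_bigr => u _; rewrite twistedM (reindex_inj invg_inj) /=.
  apply: eq_big => [a|a]; rewrite groupV // => Na; rewrite ffunE invgK.
  rewrite (bigD1 (k * a)%g) ?groupM //= mulgK eqxx mulr1 big1 ?addr0 // => b.
  case/andP=> Nb /eqP bk; case: eqP => [e'|_]; last by rewrite mulr0.
  by case: bk; rewrite -e' mulgKV.
rewrite tw_comul_sum -mulr_algl tw_counitE mulr_suml.
by apply: eq_bigr => n _; rewrite mulgV eq_sym.
Qed.

Lemma tw_comul_antipoder (x : twisted) :
  \sum_(u <- tw_comul x) u.1 * tw_antipode u.2 = (tw_counit x)%:A.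
Proof.
apply: twisted_eq => k Nk; rewrite (lin_sum (twisted_linear k)) twistedZ twisted1.
transitivity (\sum_(u <- tw_comul x) \sum_(a in N) \sum_(b in N)
   u.1 a * u.2 b * (b^-1 * a == k)%g%:R).
  apply: eq_bigr => u _; rewrite twistedM; apply: eq_bigr => a Na.
  rewrite ffunE invMg invgK (bigD1 (a * k^-1)%g) ?groupM ?groupV //=.
  rewrite invMg invgK mulgKV eqxx mulr1 big1 ?addr0 // => b.
  case/andP=> Nb /eqP bk; case: eqP => [e'|_]; last by rewrite mulr0.
  by case: bk; rewrite -e' invMg invgK mulKVg.
rewrite tw_comul_sum -mulr_algl tw_counitE mulr_suml.
by apply: eq_bigr => n _; rewrite mulVg eq_sym.
Qed.

Definition tw_hopf : hopf_algebra K :=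
  @HopfAlgebra K twisted tw_comul tw_counit tw_antipode tw_comul_linear tw_comul1
    tw_comulM tw_comulA tw_counit_scalar tw_counit1 tw_counitM tw_comul_counitl
    tw_comul_counitr tw_antipode_linear tw_comul_antipodel tw_comul_antipoder.

Lemma tw_hopf_cocommutative : cocommutative tw_hopf.
Proof.
move=> h; apply: tens2 => n m Nn Nm; rewrite [RHS]big_map /=.
transitivity (\sum_(u <- tw_comul h) u.1 m * u.2 n); last by apply: eq_bigr => u _; rewrite mulrC.
transitivity (h n *+ (n == m)); first exact: tw_comulE.
by rewrite tw_comulE // eq_sym; case: eqP => // ->.
Qed.
End TwistedGroupAlgebra.

(** * From regular groups to Hopf-Galois structures *)

Section GreitherPareigisExistence.
Variables (K : fieldType) (E : splittingFieldType K) (L : {subfield E}).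
Local Notation gE := (gal_of {:E}).
Local Notation Gamma' := ('Gal({:E} / L))%G.
Local Notation X0 := (Gamma' : {set gE}).
Hypothesis galE : galois 1 {:E}.
Variable N : {group {perm {set gE}}}.
Hypothesis regN : regular_on_cosets L N.
Hypothesis normN : normalised_by_lambda N.

Lemma galEL : galois L {:E}.
Proof. by apply: galoisS galE; rewrite sub1v subvf. Qed.

Lemma mem_fixed x : (forall g : gE, g \in Gamma' -> g x = x) -> x \in L.
Proof. by move=> fx; rewrite -(galois_fixedField galEL); apply/fixedFieldP; rewrite ?memvf. Qed.

Definition lambda_twist : twist E :=
  Twist (@lambdaM K E) (fun g => normalised_lambda normN g).
Local Notation H := (twisted lambda_twist).

Definition coset_eval_sum (h : {perm {set gE}} -> E) (x : E) : E :=
  \sum_(n in N) h n * rep L n x.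

Lemma coset_eval_sum_mem (h : H) x : x \in L -> coset_eval_sum h x \in L.
Proof.
move=> Lx; apply: mem_fixed => g Gg.
rewrite /coset_eval_sum rmorph_sum [RHS](reindex_inj (conjg_inj (lambda g))) /=.
apply: eq_big => [n|n Nn]; first by rewrite memJ_norm ?normalised_lambda.
by rewrite rmorphM (rep_conj regN normN) // (twisted_conj h g).
Qed.

Definition tw_act (h : H) (x : subvs_of L) : subvs_of L :=
  vsproj L (coset_eval_sum h (vsval x)).

Lemma tw_actE h x : vsval (tw_act h x) = \sum_(n in N) h n * rep L n (vsval x).
Proof. by rewrite vsprojK // coset_eval_sum_mem ?subvsP. Qed.

Lemma tw_act_linearl x : linear (tw_act^~ x).
Proof.
move=> a g h; apply: val_inj; rewrite /= !tw_actE scaler_sumr -big_split.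
by apply: eq_bigr => n _; rewrite (@twisted_linear _ _ lambda_twist n a g h) mulrDl scalerAl.
Qed.

Lemma tw_act_linearr h : linear (tw_act h).
Proof.
move=> a x y; apply: val_inj; rewrite /= !tw_actE scaler_sumr -big_split.
by apply: eq_bigr => n _; rewrite !linearP /= mulrDr scalerAr.
Qed.

Lemma rep1 x : x \in L -> rep L 1%g x = x.
Proof.
move=> Lx; rewrite -[RHS](gal_id {:E}); apply: (coset_eval Lx).
by have := rep_coset regN (group1 N); rewrite invg1 perm1 rcoset1 => <-.
Qed.

Lemma tw_act1 x : tw_act 1 x = x.
Proof.
apply: val_inj; rewrite /= tw_actE (bigD1 1%g) //= big1 => [|n /andP[_ /negPf n1]].
  by rewrite (@twisted1 _ _ lambda_twist) eqxx mul1r addr0 rep1 ?subvsP.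
by rewrite (@twisted1 _ _ lambda_twist) n1 mul0r.
Qed.

Lemma tw_actM (g h : H) x : tw_act (g * h) x = tw_act g (tw_act h x).
Proof.
apply: val_inj; rewrite /= !tw_actE.
under eq_bigr do rewrite (@twistedM _ _ lambda_twist) mulr_suml.
rewrite exchange_big /=; apply: eq_bigr => n Nn; rewrite rmorph_sum mulr_sumr /=.
rewrite (reindex_inj (mulIg n)) /=.
rewrite [RHS](reindex_inj (conjg_inj (lambda (rep L n))^-1%g)) /=.
apply: eq_big => [m|m Nm].
  by rewrite groupMr // memJ_norm // groupV normalised_lambda.
rewrite rmorphM /= -(twisted_conj h (rep L n)) conjgKV mulgK -mulrA.
by rewrite (rep_mul regN normN) ?subvsP // -(groupMr m Nn).
Qed.

Variables (I : finType) (e f : I -> H).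
Hypothesis ef : forall m n, m \in N -> n \in N ->
  \sum_i e i m * f i n = (m == n)%:R.
Local Notation hopfH := (@tw_hopf K E lambda_twist galE I e f ef).

Lemma tw_act_mul (h : hopfH) x y :
  tw_act h (x * y) = \sum_(u <- comul h) tw_act u.1 x * tw_act u.2 y.
Proof.
apply: val_inj; rewrite /= linear_sum /= tw_actE.
transitivity (\sum_(u <- tw_comul e f h) \sum_(n in N) \sum_(m in N)
   u.1 n * u.2 m * (rep L n (vsval x) * rep L m (vsval y))).
  rewrite (@tw_comul_sum K E lambda_twist I e f ef); apply: eq_bigr => n _.
  by rewrite -rmorphM.
apply: eq_bigr => u _; rewrite !tw_actE big_distrlr /=.
by apply: eq_bigr => n _; apply: eq_bigr => m _; rewrite mulrACA.
Qed.

Lemma tw_act_one (h : hopfH) : tw_act h 1 = (counit h)%:A.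
Proof.
apply: val_inj; rewrite /= tw_actE /= algid1 (@tw_counitE K E lambda_twist galE).
by apply: eq_bigr => n _; rewrite rmorph1 mulr1.
Qed.

(** As functions on [L], the endomorphisms are combinations of the embeddings
    [rep n], which are independent; so the coefficients agree, and descent turns
    this into equality of tensors. *)
Lemma tw_endo_inj (s t : seq (subvs_of L * hopfH)) :
  act_endo (H := hopfH) tw_act s =1 act_endo (H := hopfH) tw_act t -> tensor_eq s t.
Proof.
move=> st; apply: (tensor_eq_descent galE (@lambdaM K E)
  (fun g => normalised_lambda normN g) (twisted_descends lambda_twist)
  (j := fun (x : subvs_of L) (_ : unit) => vsval x)) => [_|u v /(_ tt)|_ m Nm].
- by move=> a x y; rewrite linearP.
- exact: val_inj.
have := congr1 (fun x => vsval x) (st _).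
pose F (v : seq (subvs_of L * hopfH)) m := \sum_(w <- v) vsval w.1 * (w.2 : H) m.
have FE v x : vsval (act_endo (H := hopfH) tw_act v x) = \sum_(n in N) F v n * rep L n (vsval x).
  rewrite /act_endo linear_sum /=; under [RHS]eq_bigr do rewrite mulr_suml.
  rewrite exchange_big /=; apply: eq_bigr => w _; rewrite tw_actE mulr_sumr.
  by apply: eq_bigr => n _; rewrite mulrA.
move=> {}st; apply/eqP; rewrite -subr_eq0; apply/eqP.
apply: (rep_independent regN galE (F := fun m => F s m - F t m)) Nm => x Lx.
have := st (vsproj L x); rewrite !FE vsprojK // => e'.
by under eq_bigr do rewrite mulrBl; rewrite sumrB e' subrr.
Qed.

(** The sum [h0] of all elements of [N] acts on [L] as the trace.  With [A] and
    [B] dual bases for the trace form, [x] is the sum of the [A k * h0 (B k *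
    x)], so [F x] is the sum of the [F (A k) * h0 (B k * x)], and the coproduct
    of [h0] expands each [h0 (B k * x)].  Dual bases of [L] come from dual bases
    of [E] by applying the trace from [E] to [L], after multiplying one of them
    by an element [z] of trace 1. *)
Lemma tw_endo_surj (F : subvs_of L -> subvs_of L) : linear F ->
  exists s : seq (subvs_of L * hopfH), act_endo (H := hopfH) tw_act s =1 F.
Proof.
move=> FL.
have [h0 h0E] : exists h : H, {in N, h =1 fun=> 1 : E}.
  by apply: twistedP => g n _; rewrite rmorph1.
pose trL x := \sum_(n in N) rep L n x.
pose T x := \sum_(g in Gamma') g x.
have LT x : T x \in L by exact: (mem_galTrace galEL (memvf x)).
(* The trace is transitive, since the cosets of [Gamma'] are the [n^-1
   (Gamma')]. *)
have trT x : trL (T x) = \sum_(g : gE) g x.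
  rewrite /trL (partition_big (fun g : gE => Gamma' :* g)%g (mem (cosetX L))) /=; last first.
    by move=> g _; rewrite mem_cosetX.
  pose c (n : {perm {set gE}}) := n^-1%g X0.
  rewrite [RHS](reindex_omap c (fun A => [pick n in N | c n == A])) /=; last first.
    move=> A /(regular_surj regN)[n Nn nA]; case: pickP => [m /andP[_ /eqP <-]|/(_ n)] //=.
    by rewrite Nn /c nA eqxx.
  apply: eq_big => n.
    rewrite /c; apply/idP/andP => [Nn|[]].
      split; first by rewrite (regular_closed regN) ?groupV // base_cosetX.
      case: pickP => [m /andP[Nm /eqP e']|/(_ n)]; last by rewrite Nn eqxx.
      by rewrite (regular_rep_eq regN Nm Nn e').
    by case: pickP => //= m /andP[Nm _] _ /eqP[<-].
  move=> Nn; rewrite rmorph_sum /= (reindex_inj (mulIg (rep L n)^-1)%g) /=.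
  apply: eq_big => [g|g _].
    by rewrite /c (rep_coset regN) // -mem_rcoset; apply/rcoset_eqP/eqP => ->.
  by rewrite -gal1M mulgKV.
have [r [a [b ab]]] := gal_dual E.
have [z Tz] : exists z, T z = 1.
  have [z _ nz] := @gal_independent_contra K E {:E} [in Gamma'] (fun=> 1) 1%g
     (group1 _) (oner_neq0 _).
  have e1 : T z = \sum_(g in Gamma') 1 * g z by apply: eq_bigr => g _; rewrite mul1r.
  rewrite -e1 in nz; exists (z / T z); rewrite -[RHS](divff nz) {1 3}/T mulr_suml.
  apply: eq_bigr => g Gg; rewrite fmorph_div; congr (_ / _).
  by apply: (fixed_gal (subvf L) Gg (LT z)).
have Tz1 (x : subvs_of L) : T (z * vsval x) = vsval x.
  rewrite -[RHS]mul1r -Tz /T mulr_suml; apply: eq_bigr => g Gg.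
  by rewrite rmorphM /= (fixed_gal (subvf L) Gg (subvsP x)).
pose A k := vsproj L (T (z * a k)); pose B k := vsproj L (T (b k)).
have trfix y (g : gE) : g (trL (T y)) = trL (T y).
  rewrite trT rmorph_sum [RHS](reindex_inj (mulIg g)) /=.
  by apply: eq_bigr => h _; rewrite gal1M.
(* The expansion of an element of [L] on the dual bases. *)
have dual x : x = \sum_k A k * tw_act h0 (B k * x).
  apply: val_inj; rewrite /= linear_sum /=.
  rewrite -[LHS]Tz1.
  have Dx : vsval x = \sum_k a k * trL (T (b k * vsval x)).
    under eq_bigr do rewrite trT mulr_sumr.
    rewrite exchange_big /= (bigD1 1%g) //= [X in _ + X]big1 ?addr0 => [|g /negPf g1].
      transitivity (\sum_k (1%g : gE) (b k) * (1%g : gE) (a k) * vsval x).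
        by rewrite -mulr_suml ab eqxx mul1r.
      by apply: eq_bigr => k _; rewrite !gal_id; ring.
    transitivity (\sum_k g (b k) * (1%g : gE) (a k) * g (vsval x)).
      by apply: eq_bigr => k _; rewrite !gal_id rmorphM /=; ring.
    by rewrite -mulr_suml ab g1 mul0r.
  have Tsum (G : 'I_r -> E) : T (\sum_k G k) = \sum_k T (G k).
    by rewrite exchange_big; apply: eq_bigr => g _; rewrite rmorph_sum.
  rewrite {1}Dx mulr_sumr Tsum; apply: eq_bigr => k _.
  rewrite tw_actE vsprojK // [in RHS]/T mulr_suml.
  apply: eq_bigr => g _; rewrite mulrA rmorphM /=; congr (_ * _).
  rewrite trfix /trL; apply: eq_bigr => n Nn; rewrite h0E // mul1r rmorphM /= vsprojK //.
  rewrite -rmorphM; congr (rep L n _); rewrite /T mulr_suml.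
  by apply: eq_bigr => h Gh; rewrite rmorphM /= (fixed_gal (subvf L) Gh (subvsP x)).
exists [seq (F (A k) * tw_act u.1 (B k), u.2) | k <- index_enum 'I_r, u <- tw_comul e f h0].
move=> y; rewrite {2}[y]dual (lin_sum FL) /act_endo big_allpairs_dep /=.
apply: eq_bigr => k _.
have [c cE] : exists c : K, tw_act h0 (B k * y) = c%:A.
  exists (scalar_part (vsval (tw_act h0 (B k * y)))); apply: val_inj; rewrite [RHS]linearZ /=.
  rewrite algid1 scalar_partK // => g; rewrite tw_actE.
  have -> : \sum_(n in N) h0 n * rep L n (vsval (B k * y)) = trL (vsval (B k * y)).
    by apply: eq_bigr => n Nn; rewrite h0E // mul1r.
  by rewrite -Tz1 trfix.
rewrite cE mulrC mulr_algl (linZ FL) -mulr_algl -cE tw_act_mul mulr_suml.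
by apply: eq_bigr => u _; ring.
Qed.

Definition tw_hopf_galois : hopf_galois (subvs_of L) :=
  @HopfGalois K (subvs_of L) hopfH (@tw_hopf_cocommutative K E lambda_twist galE I e f ef)
    tw_act tw_act_linearl tw_act_linearr tw_act1 tw_actM tw_act_mul tw_act_one
    tw_endo_inj tw_endo_surj.

Lemma tw_hopf_galois_corresponds : gp_corresponds tw_hopf_galois N.
Proof.
exists (fun h : H => h : {perm {set gE}} -> E).
split.
- split.
  + by move=> n Nn; apply: (@twisted_linear _ _ lambda_twist).
  + by move=> n Nn; apply: (@twisted1 _ _ lambda_twist).
  move=> g h k Nk; rewrite [LHS](@twistedM _ _ lambda_twist).
  apply: eq_bigr => n Nn; rewrite (big_pred1 (k * n^-1)%g) // => m /=.
  by apply/andP/eqP => [[_ /eqP <-]|->]; rewrite ?mulgK ?mulgKV ?groupM ?groupV.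
- split.
  + by move=> h n m Nn Nm; apply: (@tw_comulE K E lambda_twist I e f ef).
  + by move=> h; apply: (@tw_counitE K E lambda_twist galE).
  by move=> h n Nn; rewrite ffunE.
- exact: (@twisted_eq K E lambda_twist).
- move=> c; split=> [cg|[h hc] g n _ Nn].
    by apply: (@twistedP K E lambda_twist) => g n Nn; apply: cg => //; apply: gal_full.
  rewrite -!hc ?memJ_norm ?normalised_lambda //.
  exact: (@twisted_conj K E lambda_twist).
by move=> h x; apply: tw_actE.
Qed.
End GreitherPareigisExistence.

(** The structure is [E[N]^Gamma] acting on [L] through the embeddings [rep n]. *)
Theorem hopf_galois_exists (K : fieldType) (E : splittingFieldType K) (L : {subfield E})
    (N : {group {perm {set gal_of {:E}}}}) :
  galois 1 {:E} -> regular_on_cosets L N -> normalised_by_lambda N ->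
  exists S : hopf_galois (subvs_of L), gp_corresponds S N.
Proof.
move=> galE regN normN.
have [I [e [f [phi [_ _ _ ef]]]]] := descent_dual galE (@tw_lamM _ _ (lambda_twist normN))
  (@tw_lamN _ _ (lambda_twist normN)) (twisted_descends (lambda_twist normN)).
by exists (tw_hopf_galois galE regN ef); apply: tw_hopf_galois_corresponds.
Qed.

(** * Counting Hopf-Galois structures by regular groups *)

Lemma tensor_eq_eval (K : fieldType) (E : fieldExtType K) (U V : lmodType K)
    (s t : seq (U * V)) (a : U -> E) (b : V -> E) :
  linear a -> linear b -> tensor_eq s t ->
  \sum_(w <- s) a w.1 * b w.2 = \sum_(w <- t) a w.1 * b w.2.
Proof.
move=> aL bL st; pose B u v := a u * b v.
have BP : bilinear_for *:%R *:%R B.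
  by split=> [v|u] c x y; rewrite /B ?aL ?bL ?mulrDl ?mulrDr -?scalerAl -?scalerAr.
pose B' : {bilinear U -> V -> E} :=
  HB.pack B (bilinear_isBilinear.Build K U V E _ _ B BP).
exact: (st E B').
Qed.

Section Correspondence.
Variables (K : fieldType) (E : splittingFieldType K) (L : {subfield E}).
Local Notation gE := (gal_of {:E}).
Local Notation Gamma' := ('Gal({:E} / L))%G.
Local Notation X0 := (Gamma' : {set gE}).
Hypothesis galE : galois 1 {:E}.

Lemma corresponds_descends (S : hopf_galois (subvs_of L)) (N : {group {perm {set gE}}})
    (iota : S -> {perm {set gE}} -> E) :
  (forall n, n \in N -> linear (iota^~ n)) ->
  (forall g h : S, {in N, iota g =1 iota h} -> g = h) ->
  (forall c : {perm {set gE}} -> E,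
        (forall g n, g \in 'Gal({:E} / 1)%g -> n \in N ->
           c (n ^ lambda g)%g = (g : gE) (c n)) <->
        (exists h : S, {in N, iota h =1 c})) ->
  descends N (@lambda K E) iota.
Proof.
move=> iL iI iS; split=> // c; split=> [cg|/iS cg g n].
  by apply/iS => g n _; apply: cg.
by apply: cg; apply: gal_full.
Qed.

(** Both structures are identified with [E[N]^Gamma], and the operations are
    determined by this identification. *)
Lemma corresponds_isom (N : {group {perm {set gE}}}) (S T : hopf_galois (subvs_of L)) :
  normalised_by_lambda N -> gp_corresponds S N -> gp_corresponds T N -> hg_isom S T.
Proof.
move=> normN [i [[iL i1 iM] [ic iu ia] iI iS iact]] [j [[jL j1 jM] [jc ju ja] jI jS jact]].
have normE g := normalised_lambda normN g.
have dI := corresponds_descends iL iI iS; have dJ := corresponds_descends jL jI jS.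
pose R (h : S) (h' : T) := [forall n, (n \in N) ==> (j h' n == i h n)].
have exR h : exists h', R h h'.
  have [h' hh'] := proj1 (desc_img dJ _) (proj2 (desc_img dI (i h)) (ex_intro _ h (fun n _ => erefl))).
  by exists h'; apply/forallP => n; apply/implyP => Nn; rewrite hh'.
have exR' h' : exists h, R h h'.
  have [h hh'] := proj1 (desc_img dI _) (proj2 (desc_img dJ (j h')) (ex_intro _ h' (fun n _ => erefl))).
  by exists h; apply/forallP => n; apply/implyP => Nn; rewrite hh'.
pose f h := xchoose (exR h); pose f' h' := xchoose (exR' h').
have fE h n : n \in N -> j (f h) n = i h n.
  by move=> Nn; have /forallP/(_ n)/implyP/(_ Nn)/eqP := xchooseP (exR h).
have f'E h' n : n \in N -> i (f' h') n = j h' n.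
  by move=> Nn; have /forallP/(_ n)/implyP/(_ Nn)/eqP := xchooseP (exR' h').
have fL : linear f.
  by move=> a x y; apply: jI => n Nn; rewrite (jL n Nn) !fE // (iL n Nn).
have f1 : monoid_morphism f.
  split=> [|x y]; apply: jI => n Nn; first by rewrite fE // i1 // j1.
  rewrite fE // iM // jM //; apply: eq_bigr => m Nm; apply: eq_bigr => k /andP[Nk _].
  by rewrite !fE.
pose F : {lrmorphism S -> T} := HB.pack f (GRing.isLinear.Build K S T _ f fL)
  (GRing.isMonoidMorphism.Build S T f f1).
exists F; split.
- exists f' => h; [apply: iI | apply: jI] => n Nn /=; first by rewrite f'E // fE.
  by rewrite fE // f'E.
- move=> h; apply: (tensor_eq_descent2 galE (@lambdaM K E) normE dJ) => n m Nn Nm.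
  rewrite big_map /= jc // fE // -ic //.
  by apply: eq_bigr => u _; rewrite !fE.
- move=> h; apply: (@kA_inj K E); rewrite /= ju iu.
  by apply: eq_bigr => n Nn; rewrite fE.
- by move=> h; apply: jI => n Nn; rewrite ja //= !fE ?groupV // ia.
- move=> h y; apply: val_inj; rewrite /= iact jact; apply: eq_bigr => n Nn.
  by rewrite fE.
Qed.

Lemma coset_eval_inv (g h : gE) :
  (forall x, x \in L -> g x = h x) -> (Gamma' :* g = Gamma' :* h)%g.
Proof.
move=> gh; apply/rcoset_eqP; rewrite mem_rcoset gal_kHom ?subvf //.
apply/kAHomP => x Lx; rewrite gal1M gh // -gal1M mulgV gal_id //.
Qed.

Lemma regular_card (N : {group {perm {set gE}}}) :
  regular_on_cosets L N -> #|N| = #|cosetX L|.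
Proof.
move=> regN; rewrite -(card_in_imset (f := fun n : {perm {set gE}} => n^-1%g X0)).
  apply: eq_card => A; apply/imsetP/idP => [[n Nn ->]|XA].
    by rewrite (regular_closed regN) ?groupV // base_cosetX.
  by have [n Nn <-] := regular_surj regN XA; exists n.
by move=> n m Nn Nm; apply: (regular_rep_eq regN).
Qed.

(** The isomorphism extends to an [E]-linear map from [E[N]] to [E[M]] with
    matrix [A].  It respects coproduct and counit, so each [n] is sent to a
    group-like element, that is, to an element [th n] of [M].  Respecting
    products makes [th] multiplicative, and respecting the actions on [L] gives
    [n] and [th n] the same effect on the base coset.  As [N] is transitive, [th
    n] and [n] agree everywhere. *)
Lemma corresponds_inj (S T : hopf_galois (subvs_of L)) (N M : {group {perm {set gE}}}) :
  regular_on_cosets L N -> regular_on_cosets L M ->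
  normalised_by_lambda N -> normalised_by_lambda M ->
  gp_corresponds S N -> gp_corresponds T M -> hg_isom S T -> N = M.
Proof.
move=> regN regM normN normM.
move=> [i [[iL i1 iM] [ic iu ia] iI iS iact]] [j [[jL j1 jM] [jc ju ja] jI jS jact]].
have normE g := normalised_lambda normN g.
have dI := corresponds_descends iL iI iS; have dJ := corresponds_descends jL jI jS.
have sep := descent_separates galE (@lambdaM K E) normE dI.
case=> f [_ fc fu fa fact].
have jfL m : m \in M -> linear (fun h => j (f h) m).
  by move=> Mm a x y; rewrite linearP (jL m Mm).
have /fin_all_exists[A AE] : forall m, exists A : {perm {set gE}} -> E, m \in M -> forall h,
    j (f h) m = \sum_(n in N) A n * i h n.
  move=> m; have [Mm|] := boolP (m \in M); last by exists (fun=> 0).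
  have [A AE] := descent_functional galE (@lambdaM K E) normE dI (jfL m Mm).
  by exists A.
(* The coordinates of the image of [n] are orthogonal idempotents of sum 1. *)
have Aidem m m' : m \in M -> m' \in M -> {in N, forall n, A m n * A m' n - A m n *+ (m == m') = 0}.
  move=> Mm Mm'; apply: sep => h; under eq_bigr do rewrite mulrBl mulrnAl.
  rewrite sumrB sumrMnl -AE // -jc // (tensor_eq_eval (jL _ Mm) (jL _ Mm') (fc h)).
  rewrite big_map /=; apply/eqP; rewrite subr_eq0; apply/eqP.
  under [RHS]eq_bigr do rewrite !AE // big_distrlr.
  rewrite [RHS]exchange_big /=; apply: eq_bigr => n Nn; rewrite [RHS]exchange_big /=.
  rewrite (bigD1 n) //= [X in _ + X]big1 ?addr0 => [|k /andP[Nk nk]].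
    under eq_bigr do rewrite mulrACA.
    by rewrite -mulr_sumr ic // eqxx.
  by under eq_bigr do rewrite mulrACA; rewrite -mulr_sumr ic // eq_sym (negPf nk) mulr0.
have Asum n : n \in N -> \sum_(m in M) A m n - 1 = 0.
  move=> Nn; apply: (sep (fun n => \sum_(m in M) A m n - 1)) Nn => h.
  under eq_bigr do rewrite mulrBl mul1r mulr_suml.
  rewrite sumrB exchange_big /= -iu.
  under eq_bigr => m Mm do rewrite -AE //.
  by rewrite -ju fu subrr.
have /fin_all_exists[th thP] : forall n, exists m, n \in N ->
   m \in M /\ forall m', m' \in M -> A m' n = (m' == m)%:R.
  move=> n; have [Nn|] := boolP (n \in N); last by exists n.
  have [m /andP[Mm Am]|no] := pickP (fun m => (m \in M) && (A m n != 0)).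
    exists m => _; split=> // m' Mm'.
    have [->|mm'] := eqVneq m' m.
      have /eqP := Aidem m m Mm Mm n Nn; rewrite eqxx mulr1n -{3}[A m n]mulr1 -mulrBr.
      by rewrite mulf_eq0 (negPf Am) subr_eq0 => /eqP.
    have /eqP := Aidem m m' Mm Mm' n Nn.
    have -> : (m == m') = false by rewrite eq_sym (negPf mm').
    by rewrite subr0 mulf_eq0 (negPf Am) => /eqP.
  have /eqP := Asum n Nn; rewrite big1 ?sub0r ?oppr_eq0 ?oner_eq0 // => m Mm.
  by have := no m; rewrite Mm /= => /negbFE/eqP.
have thM n : n \in N -> th n \in M by move=> Nn; case: (thP n Nn).
have thA n m : n \in N -> m \in M -> A m n = (m == th n)%:R.
  by move=> Nn Mm; case: (thP n Nn) => _ ->.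
(* Compare the actions on [L]. *)
have threp n : n \in N -> n^-1%g X0 = (th n)^-1%g X0.
  move=> Nn; rewrite (rep_coset regN) // (rep_coset regM) ?thM //.
  apply: coset_eval_inv => x Lx; apply/eqP; rewrite -subr_eq0; apply/eqP.
  apply: (sep (fun n => rep L n x - rep L (th n) x)) Nn => h.
  under eq_bigr do rewrite mulrBl; rewrite sumrB.
  have := congr1 (fun x => vsval x) (fact h (vsproj L x)).
  rewrite /= iact jact vsprojK // => e; apply/eqP; rewrite subr_eq0; apply/eqP.
  transitivity (\sum_(m in M) \sum_(n in N) A m n * i h n * rep L m x).
    transitivity (\sum_(n in N) i h n * rep L n x); first by apply: eq_bigr => n0 _; rewrite mulrC.
    by rewrite -e; apply: eq_bigr => m Mm; rewrite AE // mulr_suml.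
  rewrite exchange_big /=; apply: eq_bigr => a Na.
  rewrite (bigD1 (th a)) ?thM //= thA ?thM // eqxx mul1r mulrC big1 ?addr0 // => m.
  by case/andP=> Mm /negPf mt; rewrite thA // mt !mul0r.
(* Compare the coefficients of a product of two elements of [S]. *)
have thm n n' : n \in N -> n' \in N -> th (n' * n)%g = (th n' * th n)%g.
  move=> Nn Nn'; set k := th (n' * n)%g.
  have Mk : k \in M by rewrite thM ?groupM.
  pose c n n' : E := (k == th (n' * n)%g)%:R - (k == (th n' * th n)%g)%:R.
  suff : c n n' = 0.
    rewrite /c eqxx; case: eqP => // _ /eqP.
    by rewrite subr0 oner_eq0.
  apply: (sep (c n)) Nn' => h.
  apply: (sep (fun n => \sum_(n' in N) c n n' * i h n')) Nn => g.
  have := AE k Mk (g * h); rewrite rmorphM jM // => e.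
  have {e} : \sum_(n in N) \sum_(n' in N) (k == (th n' * th n)%g)%:R * i g n * i h n' =
      \sum_(n in N) \sum_(n' in N) (k == th (n' * n)%g)%:R * i g n * i h n'.
    transitivity (\sum_(n in M) \sum_(m in M | (m * n)%g == k) j (f g) n * j (f h) m).
      transitivity (\sum_(m in M) \sum_(m' in M | (m' * m)%g == k)
          \sum_(n in N) \sum_(n' in N) (m == th n)%:R * (m' == th n')%:R * (i g n * i h n')).
        under [RHS]eq_bigr do rewrite exchange_big /=.
        rewrite [RHS]exchange_big /=; apply: eq_bigr => a Na.
        under [RHS]eq_bigr do rewrite exchange_big /=.
        rewrite [RHS]exchange_big /=; apply: eq_bigr => b Nb.
        rewrite (bigD1 (th a)) ?thM //= [X in _ + X]big1 ?addr0; last first.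
          by move=> m /andP[_ /negPf mt]; apply: big1 => m' _; rewrite mt !mul0r.
        rewrite big_mkcondr /= (bigD1 (th b)) ?thM //= [X in _ + X]big1 ?addr0; last first.
          by move=> m /andP[_ /negPf mt]; rewrite mt mulr0 mul0r if_same.
        by rewrite !eqxx eq_sym; case: eqP; rewrite ?mul1r ?mul0r ?mulrA ?mul1r.
      apply: eq_bigr => m Mm; apply: eq_bigr => m' /andP[Mm' _].
      rewrite !AE // big_distrlr /=; apply: eq_bigr => a Na; apply: eq_bigr => b Nb.
      by rewrite !thA // mulrACA.
    rewrite e; under eq_bigr => n0 Nn0 do rewrite iM // mulr_sumr.
    rewrite exchange_big /=; apply: eq_bigr => a Na.
    under eq_bigr do rewrite mulr_sumr big_mkcondr /=.
    rewrite exchange_big /=; apply: eq_bigr => b Nb.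
    rewrite (bigD1 (b * a)%g) ?groupM //= eqxx big1 ?addr0; last first.
      by move=> m /andP[_ /negPf mt]; rewrite eq_sym mt.
    by rewrite thA ?groupM // mulrA.
  move/eqP; rewrite eq_sym -subr_eq0 -sumrB => /eqP e; rewrite -[RHS]e.
  apply: eq_bigr => a Na; rewrite mulr_suml -sumrB; apply: eq_bigr => b Nb.
  by rewrite /c; ring.
have thid n : n \in N -> th n = n.
  move=> Nn; apply: invg_inj; apply/permP => Y.
  have [onN _ _] := regN; have [onM _ _] := regM.
  have [XY|nXY] := boolP (Y \in cosetX L); last first.
    by rewrite (out_perm (onM _ _) nXY) ?(out_perm (onN _ _) nXY) // groupV ?thM.
  have [n' Nn' <-] := regular_surj regN XY.
  rewrite [in LHS](threp n') // -!permM -!invMg -thm //.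
  by rewrite -(threp (n * n')%g) ?groupM.
have sNM : N \subset M by apply/subsetP => n Nn; rewrite -(thid n Nn) thM.
by apply/val_inj/eqP; rewrite eqEcard sNM (regular_card regN) (regular_card regM) /=.
Qed.

Lemma hg_number_of_groups (P : group_prop) k (nu : 'I_k -> {group {perm {set gE}}}) :
  (forall i, [/\ regular_on_cosets L (nu i), normalised_by_lambda (nu i) & P _ (nu i)]) ->
  injective nu ->
  (forall N, regular_on_cosets L N -> normalised_by_lambda N -> P _ N ->
     exists i, N = nu i) ->
  hg_number (@hg_of_type K E L P) k.
Proof.
move=> nuP nuI nuS.
have /fin_all_exists[s sP] : forall i, exists S : hopf_galois (subvs_of L),
    gp_corresponds S (nu i).
  by move=> i; have [rN nN _] := nuP i; apply: hopf_galois_exists.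
exists s; split=> [i|i j ij|T [N [rN nN cN PN]]].
- by have [rN nN PN] := nuP i; exists (nu i).
- have [rN nN PN] := nuP i; have [rM nM PM] := nuP j.
  exact/nuI/(corresponds_inj rN rM nN nM (sP i) (sP j) ij).
- have [i eN] := nuS N rN nN PN; exists i; apply: (corresponds_isom nN cN).
  by rewrite eN.
Qed.
End Correspondence.

(** * Regular groups on the plane F_p x F_q *)

(** If [y] sends [x] to [x ^+ k], then [k ^ r] is 1 modulo [r], while it is [k]
    by Fermat's little theorem. *)
Lemma commute_prime_order (gT : finGroupType) (x y : gT) r :
  prime r -> #[x]%g = r -> (x ^ y)%g \in <[x]>%g -> (y ^+ r = 1)%g -> (x ^ y = x)%g.
Proof.
move=> pr ox /cycleP[k xy] yr.
have iter_k m : (x ^ (y ^+ m) = x ^+ (k ^ m))%g.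
  elim: m => [|m IHm]; first by rewrite expg0 conjg1 expn0.
  by rewrite expgSr conjgM IHm conjXg xy -expgM expnS.
have := iter_k r; rewrite yr conjg1 => xk.
rewrite xy [in RHS]xk; apply/eqP; rewrite eq_expg_mod_order ox.
by rewrite eq_sym fermat_little.
Qed.

(** The prime [r] does not divide the order of the symmetric group. *)
Lemma perm_small_prime_order (S : finType) (s : {perm S}) r :
  prime r -> (#|S| < r)%N -> (s ^+ r = 1)%g -> s = 1%g.
Proof.
move=> pr Sr sr; apply/eqP; rewrite -order_eq1.
have sS : (#[s]%g %| #|S|`!)%N by rewrite -card_Sym order_dvdG // inE.
have : (#[s]%g %| r)%N by rewrite order_dvdn sr.
case/(primeP pr).2/orP=> [//|/eqP os]; move: sS; rewrite os.
suff Fact_r n : (n < r)%N -> ~~ (r %| n`!)%N by rewrite (negPf (Fact_r _ Sr)).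
elim: n => [_|n IHn nr]; first by rewrite dvdn1 neq_ltn prime_gt1 ?orbT.
by rewrite factS Euclid_dvdM // negb_or IHn ?gtnNdvd // ltnW.
Qed.

(** Since [q < p], the cycle of [t] is the only Sylow p-subgroup of [N], so it
    is characteristic. *)
Lemma normal_prime_subgroup (gT : finGroupType) (N : {group gT}) (t : gT) p q :
  prime p -> prime q -> (q < p)%N -> #|N| = (p * q)%N -> t \in N -> #[t]%g = p ->
  forall g, g \in 'N(N)%g -> (t ^ g \in <[t]>)%g.
Proof.
move=> pp pq qp cN Nt ot g nNg.
have sylT : (p.-Sylow(N) <[t]>)%g.
  rewrite /pHall cycle_subG Nt /pgroup -orderE ot pnat_id //=.
  rewrite -divgS ?cycle_subG // cN -orderE ot mulKn ?prime_gt0 //.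
  by rewrite p'natE // dvdn_prime2 // neq_ltn qp orbT.
have one : #|'Syl_p(N)%g| = 1%N.
  have m1 := card_Syl_mod N pp; have := card_Syl_dvd p N.
  rewrite cN Gauss_dvdr => [|]; last first.
    rewrite coprime_sym prime_coprime //; apply/negP => /eqP; rewrite m1 //.
  case/(primeP pq).2/orP=> [/eqP//|/eqP e]; move: m1.
  rewrite e modn_small // => q1; by rewrite q1 in pq.
have nT : (<[t]> <| N)%g.
  rewrite /normal cycle_subG Nt /=; move/eqP: one; rewrite (card_Syl sylT).
  by rewrite indexg_eq1 subsetI subxx.
rewrite (mem_normal_Hall sylT nT) ?memJ_norm // /p_elt orderJ ot pnat_id //.
Qed.

Lemma pair_inj (A B : Type) (a a' : A) (b b' : B) : (a, b) = (a', b') -> a = a' /\ b = b'.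
Proof. by case=> -> ->. Qed.

Section Plane.
Variables (p q : nat).
Hypotheses (pp : prime p) (pq : prime q) (qp : (q < p)%N).
Local Notation T := ('F_p * 'F_q)%type.

Lemma Fq_ind (P : 'F_q -> Prop) : P 0 -> (forall y, P y -> P (y + 1)) -> forall y, P y.
Proof.
move=> P0 PS y; rewrite -[y]natr_Zp; elim: (y : nat) => //= n IHn.
by rewrite -natr1; apply: PS.
Qed.

Lemma Fp_char : (p%:R : 'F_p) = 0.
Proof. by apply: val_inj; rewrite /= val_Fp_nat ?modnn. Qed.

Lemma Fq_char : (q%:R : 'F_q) = 0.
Proof. by apply: val_inj; rewrite /= val_Fp_nat ?modnn. Qed.

Lemma Fp_q_neq0 : (q%:R : 'F_p) != 0.
Proof. by rewrite -val_eqE /= val_Fp_nat // modn_small // -lt0n prime_gt0. Qed.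

(** The power with exponent in [F_q], which is a homomorphism in [y] when [m ^+
    q = 1]. *)
Definition pw (m : 'F_p) (y : 'F_q) := m ^+ (y : nat).

Lemma pw0 m : pw m 0 = 1. Proof. by []. Qed.

Lemma pw1 m : pw m 1 = m.
Proof. by rewrite /pw /= -[X in (1 %% X)%N]/((Zp_trunc (pdiv q)).+2) modn_small. Qed.

Lemma pwn m k : m ^+ q = 1 -> pw m k%:R = m ^+ k.
Proof. by move=> mq; rewrite /pw val_Fp_nat // expr_mod. Qed.

Lemma pwD m y z : m ^+ q = 1 -> pw m (y + z) = pw m y * pw m z.
Proof. by move=> mq; rewrite -[y]natr_Zp -[z]natr_Zp -natrD !pwn // exprD. Qed.

Lemma pw_1 y : pw 1 y = 1. Proof. exact: expr1n. Qed.

Lemma root1_neq0 (m : 'F_p) : m ^+ q = 1 -> m != 0.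
Proof. by apply: contra_eq_neq => ->; rewrite expr0n gtn_eqF ?prime_gt0 // eq_sym oner_eq0. Qed.

Lemma pw_neq0 m y : m ^+ q = 1 -> pw m y != 0.
Proof. by move=> mq; rewrite expf_neq0 ?root1_neq0. Qed.

Lemma pw_unit m y : m ^+ q = 1 -> pw m y ^+ q = 1.
Proof. by move=> mq; rewrite /pw exprAC mq expr1n. Qed.

(** The translation part is an arbitrary function of the fibre, since the
    elements of the regular groups to be described act on the fibres by
    different translations. *)
Definition affine (s : {perm T}) (c : 'F_p) (b : 'F_q -> 'F_p) (d : 'F_q) :=
  forall x y, s (x, y) = (c * x + b y, y + d).

Lemma affine_exists c b d : c != 0 -> exists s, affine s c b d.
Proof.
move=> c0; pose f (z : T) : T := (c * z.1 + b z.2, z.2 + d).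
have fI : injective f.
  move=> [x y] [x' y'] e; have [/= e1 e2] := pair_inj e; have {}e2 : y = y' := addIr d e2.
  by rewrite e2 in e1 *; rewrite (mulfI c0 (addIr _ e1)).
by exists (perm fI) => x y; rewrite permE.
Qed.

Lemma affine_eq s s' c b b' d : affine s c b d -> affine s' c b' d -> b =1 b' -> s = s'.
Proof. by move=> H H' bb'; apply/permP => [[x y]]; rewrite H H' bb'. Qed.

Lemma affine_uniq s c b d c' b' d' :
  affine s c b d -> affine s c' b' d' -> [/\ c = c', b =1 b' & d = d'].
Proof.
move=> H H'; have bb y : b y = b' y.
  by have := H 0 y; rewrite H' !mulr0 !add0r => e; have [] := pair_inj e.
split=> //; last by have := H 0 0; rewrite H' => e; have {e}[_ e] := pair_inj e; have /esym := addrI _ e.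
by have := H 1 0; rewrite H' bb !mulr1 => e; have {e}[e _] := pair_inj e; have /esym := addIr _ e.
Qed.

Lemma affineM s c b d s' c' b' d' : affine s c b d -> affine s' c' b' d' ->
  affine (s * s')%g (c' * c) (fun y => c' * b y + b' (y + d)) (d + d').
Proof. by move=> H H' x y; rewrite permM H H' mulrDr !mulrA !addrA. Qed.

Lemma affine1 : affine 1%g 1 (fun=> 0) 0.
Proof. by move=> x y; rewrite perm1 mul1r !addr0. Qed.

Lemma affine_transX s b k : affine s 1 b 0 -> affine (s ^+ k)%g 1 (fun y => k%:R * b y) 0.
Proof.
move=> H; elim: k => [|k IHk] x y; first by rewrite expg0 perm1 mul0r mul1r !addr0.
by rewrite expgSr permM IHk H -natr1 !addr0; congr (_, _); ring.
Qed.

Lemma affine_neq0 s c b d : affine s c b d -> c != 0.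
Proof.
move=> H; apply/eqP => c0; have := @perm_inj _ s (0, 0) (1, 0).
by rewrite !H c0 !mul0r => /(_ erefl) e; have [/esym/eqP] := pair_inj e; rewrite oner_eq0.
Qed.

Definition regular (S : finType) (N : {group {perm S}}) :=
  (forall z w, exists2 n, n \in N & n z = w) /\
  (forall n z, n \in N -> n z = z -> n = 1%g).

Lemma affineX s c b d k : affine s c b d -> exists b', affine (s ^+ k)%g (c ^+ k) b' (k%:R * d).
Proof.
move=> sE; elim: k => [|k [b' IHk]].
  by exists (fun=> 0) => x y; rewrite perm1 mul1r mul0r !addr0.
exists (fun y => c * b' y + b (y + k%:R * d)) => x y.
have := affineM IHk sE x y; rewrite expgSr => ->; rewrite exprS -natr1 mulrDl mul1r //.
Qed.

Lemma regular_inj (S : finType) (N : {group {perm S}}) m n z :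
  regular N -> m \in N -> n \in N -> m z = n z -> m = n.
Proof.
move=> [_ rN] Nm Nn e; apply/eqP; rewrite eq_mulgV1; apply/eqP/(rN _ z).
  by rewrite groupM ?groupV.
by rewrite permM e -permM mulgV perm1.
Qed.

Lemma card_regular (S : finType) (N : {group {perm S}}) (z : S) : regular N -> #|N| = #|S|.
Proof.
move=> rN; rewrite -(card_in_imset (f := fun n : {perm S} => n z)) => [|m n Nm Nn].
  apply: eq_card => w; rewrite inE; have [n Nn <-] := rN.1 z w.
  by apply/imsetP; exists n.
exact: (regular_inj rN).
Qed.

Lemma card_plane : #|{: T}| = (p * q)%N.
Proof. by rewrite card_prod !card_Fp. Qed.

Section Structure.
Variables (N : {group {perm T}}) (t g : {perm T}) (u v : 'F_p).
Hypotheses (rN : regular N) (nt : t \in 'N(N)%g) (ng : g \in 'N(N)%g).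
Hypotheses (tE : affine t 1 (fun=> 1) 0) (gE : affine g u (fun=> v) 1).

(** An element [tau] of order [p] of [N] spans a normal subgroup, and commutes
    with [t] by [commute_prime_order].  So it acts on each fibre of the second
    projection as a translation, after permuting the [q < p] fibres in a way
    that has order dividing [p] and is therefore trivial.  The translation
    lengths form a geometric progression, because [g] normalises the cycle of
    [tau] and shifts the fibres; its ratio [mu] has [mu ^+ q = 1], since there
    are [q] fibres. *)
Lemma structure_tau : exists mu tau,
  [/\ mu ^+ q = 1, tau \in N, affine tau 1 (pw mu) 0,
      #[tau]%g = p & forall g, g \in 'N(N)%g -> (tau ^ g \in <[tau]>)%g].
Proof.
have cN : #|N| = (p * q)%N by rewrite (card_regular (0, 0) rN) card_plane.
have pN : (p %| #|N|)%N by rewrite cN dvdn_mulr.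
have [tau Nt ot] := Cauchy pp pN.
have nT := normal_prime_subgroup pp pq qp cN Nt ot.
have tp : (t ^+ p)%g = 1%g.
  by apply: (affine_eq (affine_transX p tE) affine1) => y; rewrite Fp_char mul0r.
have ct := commute_prime_order pp ot (nT _ nt) tp.
have tauS x y : tau (x + 1, y) = ((tau (x, y)).1 + 1, (tau (x, y)).2).
  have := congr1 (fun s : {perm T} => s (x, y)) (conjgC tau t).
  rewrite ct !permM [t (x, y)]tE mul1r addr0 => <-.
  by case: (tau (x, y)) => x' y'; rewrite tE mul1r addr0.
pose f y := (tau (0, y)).1; pose s y := (tau (0, y)).2.
have tauE x y : tau (x, y) = (x + f y, s y).
  rewrite -[x]natr_Zp; elim: (x : nat) => [|k IHk]; first by rewrite mulr0n add0r -surjective_pairing.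
  by rewrite -natr1 tauS IHk /= addrAC.
have sI : injective s.
  move=> y y' ss; have : tau (- f y, y) = tau (- f y', y') by rewrite !tauE ss !addNr.
  by move=> /perm_inj e; have [] := pair_inj e.
have s1 y : s y = y.
  suff : perm sI = 1%g by move/permP/(_ y); rewrite permE perm1.
  apply: (perm_small_prime_order pp); first by rewrite card_Fp.
  have sk k z : (perm sI ^+ k)%g z = ((tau ^+ k)%g (0, z)).2.
    elim: k => [|k IHk]; first by rewrite !expg0 !perm1.
    rewrite !expgSr !permM IHk permE.
    by case: ((tau ^+ k)%g (0, z)) => ? ?; rewrite tauE.
  have taup : (tau ^+ p = 1)%g by apply/eqP; rewrite -order_dvdn ot.
  by apply/permP => z; rewrite sk taup !perm1.
have f0 y : f y != 0.
  apply/eqP => fy; have t1 : tau = 1%g.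
    by apply: (rN.2 _ (0, y) Nt); rewrite tauE fy s1 addr0.
  by have := prime_gt1 pp; rewrite -[X in (_ < X)%N]ot t1 order1.
have /cycleP[k tk] := nT g ng.
have tauk j : affine (tau ^+ j)%g 1 (fun y => j%:R * f y) 0.
  by apply: affine_transX => x y; rewrite tauE s1 mul1r addr0.
have u0 := affine_neq0 gE.
have fS y : u * f y = k%:R * f (y + 1).
  have := congr1 (fun s : {perm T} => s (0, y)) (conjgC tau g).
  rewrite tk !permM tauE gE gE tauk s1 => e; have [] := pair_inj e.
  by rewrite mulr0 mul1r add0r [in RHS]add0r [RHS]addrC => /addIr.
have k0 : k%:R != 0 :> 'F_p.
  by apply/eqP => k0; have := fS 0; rewrite k0 mul0r => /eqP; rewrite mulf_eq0 (negPf u0) (negPf (f0 0)).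
pose mu := u / k%:R.
have fS1 y : f (y + 1) = f y * mu.
  apply: (mulfI k0); rewrite -fS /mu mulrA [k%:R * _]mulrC -mulrA mulrC; congr (_ * _).
  by rewrite mulrCA divff ?mulr1.
have fE n : f n%:R = f 0 * mu ^+ n.
  elim: n => [|n IHn]; first by rewrite expr0 mulr1.
  by rewrite -natr1 fS1 IHn exprSr; apply/esym/mulrA.
have muq : mu ^+ q = 1.
  by have := fE q; rewrite Fq_char -{1}[f 0]mulr1 => /(mulfI (f0 0)).
pose j := val ((f 0)^-1).
have tauj : affine (tau ^+ j)%g 1 (pw mu) 0.
  move=> x y; rewrite tauk natr_Zp; congr (_ + _, _).
  by rewrite -[y]natr_Zp fE pwn // mulKf.
have tj1 : (tau ^+ j)%g != 1%g.
  apply: contra_neq (oner_neq0 'F_p) => t1; have := tauj 0 0; rewrite t1 perm1 => e.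
  by have [] := pair_inj e; rewrite mul1r add0r pw0.
have oj : #[tau ^+ j]%g = p.
  have := orderXdvd tau j; rewrite ot => /(primeP pp).2/orP[|/eqP//].
  by rewrite order_eq1 (negPf tj1).
have gj : <[tau ^+ j]>%g = <[tau]>%g.
  by apply/eqP; rewrite eqEcard cycleX /= -!orderE ot oj.
exists mu, (tau ^+ j)%g; split=> //.
- by rewrite groupX.
- by move=> g' ng'; rewrite conjXg gj groupX // nT.
Qed.

Variables (mu : 'F_p) (tau : {perm T}).
Hypotheses (muq : mu ^+ q = 1) (Ntau : tau \in N) (tauE : affine tau 1 (pw mu) 0).
Hypotheses (otau : #[tau]%g = p).
Hypothesis (nT : forall g, g \in 'N(N)%g -> (tau ^ g \in <[tau]>)%g).

Lemma tauX k : affine (tau ^+ k)%g 1 (fun y => k%:R * pw mu y) 0.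
Proof. exact: affine_transX. Qed.

Lemma cycle_tauP n : n \in <[tau]>%g -> exists c : 'F_p, affine n 1 (fun y => c * pw mu y) 0.
Proof. by case/cycleP => k ->; exists k%:R; apply: tauX. Qed.

Lemma tau_fibre x x' y : exists2 n, n \in <[tau]>%g & n (x, y) = (x', y).
Proof.
exists (tau ^+ ((x' - x) / pw mu y)%R)%g; first exact: mem_cycle.
by rewrite tauX natr_Zp divfK ?pw_neq0 // mul1r addrC subrK addr0.
Qed.

Lemma fibre_stable n z : n \in N -> (n z).2 = z.2 -> n \in <[tau]>%g.
Proof.
case: z => x y Nn; case e: (n (x, y)) => [x' y'] /= ey; rewrite ey in e.
have [m Tm me] := tau_fibre x x' y.
have Nm : m \in N by apply: subsetP Tm; rewrite cycle_subG.
by rewrite (regular_inj rN Nn Nm (etrans e (esym me))).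
Qed.

Lemma fibreE n x y : n \in 'N(N)%g -> (n (x, y)).2 = (n (0, y)).2.
Proof.
move=> nn; have [m Tm <-] := tau_fibre 0 x y.
rewrite -permM conjgC permM; have : (m ^ n \in <[tau]>)%g.
  by case/cycleP: Tm => k ->; rewrite conjXg groupX // nT.
by case/cycle_tauP => c cE; case: (n (0, y)) => a b; rewrite cE /= addr0.
Qed.

(** The permutation of the fibres induced by a map that preserves them; by
    [fibreE] the elements of the normaliser of [N] do. *)
Definition fib (n : {perm T}) y := (n (0, y)).2.

Lemma fibM m n y : n \in 'N(N)%g -> fib (m * n)%g y = fib n (fib m y).
Proof. by move=> nn; rewrite /fib permM; case: (m _) => a b; rewrite fibreE. Qed.

Lemma fib_tau n y : n \in <[tau]>%g -> fib n y = y.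
Proof. by case/cycle_tauP => c cE; rewrite /fib cE /= addr0. Qed.

Lemma fib_g y : fib g y = y + 1.
Proof. by rewrite /fib gE. Qed.

(** On the fibres [N] induces a group of order [q], spanned by [s].  Conjugation
    by the shift [g] sends [s] to [s ^+ k], and the order of this automorphism
    divides both [q] and [q - 1], so [s] commutes with the shift and is itself a
    translation. *)
Lemma structure_fib n : n \in N -> exists d, forall y, fib n y = y + d.
Proof.
have nN m : m \in N -> m \in 'N(N)%g by move=> Nm; apply: subsetP (normG N) _ Nm.
have cN : #|N| = (p * q)%N by rewrite (card_regular (0, 0) rN) card_plane.
have qN : (q %| #|N|)%N by rewrite cN dvdn_mull.
have [s Ns os] := Cauchy pq qN.
have decomp m : m \in N -> exists2 k, true & forall y, fib m y = fib (s ^+ k)%g y.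
  move=> Nm; have : m \in (<[tau]> * <[s]>)%g.
    suff -> : (<[tau]> * <[s]> = N)%g by [].
    apply/eqP; rewrite eqEcard mul_subG ?cycle_subG // TI_cardMg.
      by rewrite -!orderE os otau cN leqnn.
    apply: coprime_TIg; rewrite -!orderE os otau prime_coprime //.
    by rewrite dvdn_prime2 // neq_ltn qp orbT.
  case/mulsgP => a b Ta /cycleP[k ->] ->; exists k => // y.
  by rewrite fibM ?nN ?groupX // (fib_tau _ Ta).
have [k _ kE] := decomp (s ^ g)%g (etrans (memJ_norm s ng) Ns).
have step1 j y : fib (s ^+ j)%g y + 1 = fib (s ^+ (k * j))%g (y + 1).
  have -> : fib (s ^+ j)%g y + 1 = fib ((s ^ g) ^+ j)%g (y + 1).
    rewrite -!fib_g -fibM // -fibM; last by rewrite nN ?groupX ?memJ_norm.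
    by rewrite -conjXg -conjgC.
  elim: j y => [|j IHj] y; first by rewrite muln0.
  rewrite expgSr fibM ?nN ?memJ_norm // IHj kE -fibM ?nN ?groupX //.
  by rewrite -expgD mulnS addnC.
have stepn m j y : fib (s ^+ j)%g y + m%:R = fib (s ^+ (k ^ m * j))%g (y + m%:R).
  elim: m j y => [|m IHm] j y; first by rewrite mulr0n !addr0 expn0 mul1n.
  by rewrite -natr1 !addrA IHm step1 mulnA expnS.
have comm y : fib s y + 1 = fib s (y + 1).
  have sk : (s ^+ (k ^ q) = s ^+ k)%g.
    by apply/eqP; rewrite eq_expg_mod_order os fermat_little.
  have := step1 1%N y; rewrite muln1 expg1 => ->.
  by have := stepn q 1%N (y + 1); rewrite Fq_char !addr0 muln1 expg1 sk.
have sE y : fib s y = y + fib s 0.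
  by elim/Fq_ind: y => [|y IHy]; rewrite ?add0r // -comm IHy addrAC.
move=> Nn; have [l _ lE] := decomp n Nn.
exists (l%:R * fib s 0) => y; rewrite lE.
elim: (l) => [|i IHi]; first by rewrite mul0r addr0 /fib perm1.
by rewrite expgSr fibM ?nN // IHi sE -natr1 mulrDl mul1r addrA.
Qed.

(** Take [s] in [N] that sends [(0, 0)] to [(0, 1)].  Its commutator with [t]
    preserves the fibres, so it is a power of [tau], and this makes [s] affine
    on each fibre.  The slopes [c mu^(y + 1) + 1] are all equal because [s]
    normalises the cycle of [tau], which forces [c = 0] or [mu = 1]. *)
Lemma structure_sigma : exists a b sigma,
  [/\ a ^+ q = 1, mu = 1 \/ a = 1, sigma \in N, affine sigma a b 1 & b 0 = 0].
Proof.
have nN m : m \in N -> m \in 'N(N)%g by move=> Nm; apply: subsetP (normG N) _ Nm.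
have [s Ns s00] := rN.1 (0, 0) (0, 1).
have sf x y : (s (x, y)).2 = y + 1.
  rewrite fibreE ?nN //; have [d dE] := structure_fib Ns.
  by have := dE 0; rewrite {1}/fib s00 /= add0r -/(fib s y) dE => ->.
pose n := (t ^ s * t^-1)%g.
have Nn : n \in N.
  have -> : n = (s^-1 * s ^ t^-1)%g by rewrite /n !conjgE invgK !mulgA.
  by rewrite groupM ?groupV ?memJ_norm ?groupV.
have tz z : (t z).2 = z.2 by case: z => x y; rewrite tE addr0.
have tVz z : ((t^-1)%g z).2 = z.2 by rewrite -{2}[z](permKV t) tz.
have Tn : n \in <[tau]>%g.
  apply: (fibre_stable (z := (0, 1))) => //; rewrite permM tVz -s00 -permM -conjgC permM tE.
  by rewrite sf s00 /= !add0r.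
have ts : (t * s = s * (n * t))%g by rewrite /n mulgKV conjgC.
clearbody n; have [c cE] := cycle_tauP Tn.
have sS x y : s (x + 1, y) = ((s (x, y)).1 + (c * pw mu (y + 1) + 1), y + 1).
  have := congr1 (fun r : {perm T} => r (x, y)) ts.
  rewrite !permM tE mul1r addr0 => ->.
  have := sf x y; case: (s (x, y)) => x' y' /= ->.
  by rewrite cE tE !mul1r !addr0 addrA.
pose b y := (s (0, y)).1.
have sE x y : s (x, y) = ((c * pw mu (y + 1) + 1) * x + b y, y + 1).
  rewrite -[x]natr_Zp; elim: (x : nat) => [|k IHk].
    by rewrite mulr0n mulr0 add0r /b -(sf 0 y) -surjective_pairing.
  by rewrite -natr1 sS IHk /= mulrDr mulr1 addrAC.
have [c2 c2E] := cycle_tauP (nT (nN _ Ns)).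
have taus := conjgC tau s; move: (tau ^ s)%g c2E taus => taus c2E etaus.
have lin y : c * pw mu (y + 1) + 1 = c2 * mu.
  have := congr1 (fun r : {perm T} => r (0, y)) etaus.
  rewrite !permM tauE sE sE c2E => e; have [+ _] := pair_inj e.
  rewrite !mulr0 !mul1r !add0r addr0 addrC => e1.
  have e2 : pw mu (y + 1) = mu * pw mu y by rewrite pwD // pw1 mulrC.
  apply: (mulIf (pw_neq0 y muq)); rewrite (addrI _ e1) e2 mulrA //.
pose a := c2 * mu.
have sA : affine s a b 1 by move=> x y; rewrite sE lin.
have b0 : b 0 = 0 by rewrite /b s00.
have ma : mu = 1 \/ a = 1.
  have := lin 0; have := lin (-1); rewrite addNr add0r pw0 pw1 mulr1 -/a => <- /addIr.
  move/eqP; rewrite -subr_eq0 -{2}[c]mulr1 -mulrBr mulf_eq0 subr_eq0 => /orP[/eqP->|/eqP->].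
    by right; rewrite add0r.
  by left.
have [b' s'] := affineX q sA.
exists a, b, s; split=> //.
have : (s ^+ q)%g \in <[tau]>%g.
  by apply: (fibre_stable (z := (0, 0))); rewrite ?groupX // s' mulr1 add0r Fq_char.
by case/cycle_tauP => c3 /(affine_uniq s')[].
Qed.
End Structure.

(** By the last clause the elements of [N] that fix one fibre are the powers of
    [tau]. *)
Lemma regular_structure (N : {group {perm T}}) t g u v :
  regular N -> t \in 'N(N)%g -> g \in 'N(N)%g ->
  affine t 1 (fun=> 1) 0 -> affine g u (fun=> v) 1 ->
  exists mu a b tau sigma, [/\ [/\ mu ^+ q = 1, a ^+ q = 1 & mu = 1 \/ a = 1],
    [/\ tau \in N, affine tau 1 (pw mu) 0 & #[tau]%g = p],
    [/\ sigma \in N, affine sigma a b 1 & b 0 = 0]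
    & forall n z, n \in N -> (n z).2 = z.2 -> n \in <[tau]>%g].
Proof.
move=> rN nt ng tE gE; have [mu [tau [muq Nt tauE ot nT]]] := structure_tau rN nt ng tE gE.
have [a [b [s [aq ma Ns sE b0]]]] := structure_sigma rN nt ng tE gE muq Nt tauE ot nT.
exists mu, a, b, tau, s; split=> // n z.
exact: (fibre_stable rN muq Nt tauE).
Qed.
End Plane.

(** * Normal forms of regular groups *)

Section Presentation.
Variables (p q : nat).
Hypotheses (pp : prime p) (pq : prime q) (qp : (q < p)%N).
Local Notation T := ('F_p * 'F_q)%type.
Implicit Types (N : {group {perm T}}) (u mu a al : 'F_p).

(** A regular group containing these two maps is generated by them.  The
    function [al u^y] is the general solution of [b (y + 1) = u b y], the
    condition imposed by conjugation with [g = (u x, y + 1)]. *)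
Definition presented N u mu a al := exists tau sigma,
  [/\ tau \in N, sigma \in N, affine tau 1 (pw mu) 0 &
      affine sigma a (fun y => al * pw u y) 1].

Lemma fibre_element N u mu a al : regular N -> mu ^+ q = 1 -> presented N u mu a al ->
  forall n z, n \in N -> (n z).2 = z.2 ->
  exists c, affine n 1 (fun y => c * pw mu y) 0.
Proof.
move=> rN muq [tau [_ [Nt _ tE _]]] n [x y] Nn; case e: (n (x, y)) => [x' y'] /= ey.
have tX k : affine (tau ^+ k)%g 1 (fun y => k%:R * pw mu y) 0 by exact: affine_transX.
exists ((x' - x) / pw mu y); suff -> : n = (tau ^+ ((x' - x) / pw mu y)%R)%g.
  by move=> x1 y1; rewrite tX natr_Zp.
apply: (regular_inj rN (z := (x, y))); rewrite ?groupX // tX e ey natr_Zp.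
by rewrite divfK ?pw_neq0 // mul1r addrC subrK addr0.
Qed.

(** Conjugation by [g] gives the recurrence [b (y + 1) = u * b y - k * mu^y] for
    the translation part of [sigma].  If [u <> mu], its solution with [b 0 = 0]
    is a multiple of [u^y - mu^y], and a power of [tau] absorbs the second term.
    If [u = mu], the solution [- k y mu^(y - 1)] has period [q] only for [k =
    0].  When [u = a], the power [sigma ^+ q] translates the fibres by a
    multiple of [q al u^y], while it must be a power of [tau]; so [al = 0]. *)
Lemma regular_presented N t g u :
  regular N -> t \in 'N(N)%g -> g \in 'N(N)%g ->
  affine t 1 (fun=> 1) 0 -> affine g u (fun=> 0) 1 -> u ^+ q = 1 ->
  exists mu a al, [/\ mu ^+ q = 1, a ^+ q = 1, mu = 1 \/ a = 1,
    al = 0 \/ (u != mu /\ u != a) & presented N u mu a al].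
Proof.
move=> rN nt ng tE gE uq.
have [mu [a [b [tau [s [[muq aq ma] [Nt tauE ot] [Ns sE b0] fN]]]]]] :=
  regular_structure pp pq qp rN nt ng tE gE.
have cyc n z : n \in N -> (n z).2 = z.2 -> exists c, affine n 1 (fun y => c * pw mu y) 0.
  move=> Nn /(fN _ _ Nn)/cycleP[k ->]; exists k%:R; exact: affine_transX.
have rec : exists k, forall y, b (y + 1) = u * b y - k * pw mu y.
  have [n Nn ng'] : exists2 n, n \in N & (s * g = g * n)%g.
    by exists (s ^ g)%g; rewrite ?memJ_norm // conjgC.
  pose m := (s^-1 * n)%g; have nE : n = (s * m)%g by rewrite /m mulKVg.
  have Nm : m \in N by rewrite groupM ?groupV.
  have [|c cE] := cyc m (s (0, 0)) Nm.
    have e : n (0, 0) = g (s (0, -1)).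
      have <- : g (0, -1) = (0, 0) by rewrite gE addr0 mulr0 addNr.
      by rewrite -!permM ng'.
    by rewrite -permM -nE e !sE gE /= addNr.
  clearbody m; exists (c * mu ^+ 2) => y.
  have := congr1 (fun r : {perm T} => r (0, y)) ng'; rewrite nE !permM !sE !gE sE cE => e.
  have [+ _] := pair_inj e; rewrite !addr0 !mulr0 !add0r mul1r => ->.
  by rewrite !pwD // !pw1; ring.
case: rec => k rec.
have [um|um] := eqVneq u mu.
  exists mu, a, 0; split=> //; first by left.
  exists tau, s; split=> //; suff b00 y : b y = 0 by move=> x y; rewrite sE b00 mul0r.
  have bn n : b n%:R * mu = - k * n%:R * mu ^+ n.
    elim: n => [|n IHn]; first by rewrite b0 mulr0 !mul0r.
    rewrite -natr1 rec um pwn //.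
    transitivity (mu * (b n%:R * mu) - k * mu ^+ n * mu); first by ring.
    by rewrite IHn exprS; ring.
  have := bn q; rewrite Fq_char // b0 muq mul0r mulr1 => /esym/eqP.
  rewrite mulf_eq0 (negPf (Fp_q_neq0 pp pq qp)) orbF oppr_eq0 => /eqP k0.
  have := bn (y : nat); rewrite natr_Zp k0 oppr0 !mul0r => /eqP.
  by rewrite mulf_eq0 (negPf (root1_neq0 pq muq)) orbF => /eqP.
pose al := - k / (u - mu).
have um0 : u - mu != 0 by rewrite subr_eq0.
have alE : k = al * (mu - u) by rewrite -[mu - u]opprB mulrN /al divfK // opprK.
have bE y : b y = al * (pw u y - pw mu y).
  elim/Fq_ind: y => [|y IHy]; first by rewrite b0 !pw0 subrr mulr0.
  by rewrite rec IHy !pwD // !pw1 alE; ring.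
have [m Nm mE] : exists2 m, m \in N & affine m 1 (fun y => al / mu * pw mu y) 0.
  exists (tau ^+ (al / mu)%R)%g; first by rewrite groupX.
  by move=> x y; rewrite (affine_transX _ tauE) natr_Zp.
have sE' : affine (s * m)%g a (fun y => al * pw u y) 1.
  move=> x y; rewrite permM sE mE addr0 bE pwD // pw1; congr (_, _).
  have e : al / mu * (pw mu y * mu) = al * pw mu y.
    by rewrite [pw mu y * mu]mulrC mulrA divfK ?(root1_neq0 pq).
  by rewrite e; ring.
move: (s * m)%g (groupM Ns Nm) sE' => r Nr sE'.
have pN : presented N u mu a al by exists tau, r.
exists mu, a, al; split=> //.
have [ua|ua] := eqVneq u a; [left | by right].
have [bk bkE] : exists bk, forall k x y, (r ^+ k)%g (x, y) = (a ^+ k * x + bk k y, y + k%:R)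
    /\ a * bk k y = k%:R * al * a ^+ k * pw u y.
  exists (fun k y => ((r ^+ k)%g (0, y)).1) => l.
  elim: l => [|l IHl] x y; first by rewrite expg0 !perm1 /= mul1r !addr0 mulr0 !mul0r.
  rewrite !expgSr; split.
    rewrite 2!permM (IHl x y).1 (IHl 0 y).1 !sE' /= -natr1 addrA exprS; congr (_, _); ring.
  rewrite permM (IHl 0 y).1 sE' /= mulr0 add0r mulrDr (IHl 0 y).2 pwD // pwn // -natr1 ua exprS.
  ring.
have sq : (r ^+ q)%g \in N by rewrite groupX.
have [|c cE] := fibre_element rN muq pN (z := (0, 0)) sq.
  by rewrite (bkE q 0 0).1 Fq_char //= addr0.
have bq (y : 'F_q) : a * (c * pw mu y) = q%:R * al * pw u y.
  have := (bkE q 0 y).2; rewrite aq mulr1 => <-; congr (_ * _).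
  have := cE 0 y; rewrite (bkE q 0 y).1 => e; have [+ _] := pair_inj e.
  by rewrite !mulr0 !add0r.
have := bq 1; rewrite !pw1 mulrA; have := bq 0; rewrite !pw0 !mulr1 => -> /eqP.
rewrite -subr_eq0 -mulrBr mulf_eq0 mulf_eq0 (negPf (Fp_q_neq0 pp pq qp)) /=.
by rewrite subr_eq0 [mu == u]eq_sym (negPf um) orbF => /eqP.
Qed.

(** [tau] is the element of [N] that sends [(0, 0)] to [(1, 0)], and [sigma] is
    determined up to powers of [tau], which change the translation part by
    multiples of [mu^y]; such multiples can affect [al] only for [u = mu], where
    [al = 0]. *)
Lemma presented_uniq N u mu a al mu' a' al' :
  regular N -> u ^+ q = 1 -> mu ^+ q = 1 -> mu' ^+ q = 1 ->
  al = 0 \/ (u != mu /\ u != a) -> al' = 0 \/ (u != mu' /\ u != a') ->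
  presented N u mu a al -> presented N u mu' a' al' -> [/\ mu = mu', a = a' & al = al'].
Proof.
move=> rN uq muq muq' va va' pN [t' [s' [Nt' Ns' tE' sE']]].
have [t [s [Nt Ns tE sE]]] := pN.
have mm : mu = mu'.
  have tt : t = t' by apply: (regular_inj rN (z := (0, 0))); rewrite // tE tE' !pw0.
  by rewrite tt in tE; have [_ /(_ 1)] := affine_uniq tE tE'; rewrite !pw1.
have [||c cE] := fibre_element rN muq pN (z := s (0, 0)) (n := (s^-1 * s')%g).
- by rewrite groupM ?groupV.
- by rewrite -permM mulKVg sE sE'.
have := affineM sE cE; rewrite mulKVg mul1r addr0 => sE2.
have [aa al_al _] := affine_uniq sE2 sE'; split=> //.
have e0 := al_al 0; have e1 := al_al 1.
move: e0 e1; rewrite !pwD // !pw0 !pw1 !mulr1 !mul1r => e0 e1.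
have {e1 e0} : (al' - al) * (u - mu) = 0 by rewrite mulrBr [in _ * u]mulrBl -e1 -e0; ring.
move/eqP; rewrite mulf_eq0 !subr_eq0 => /orP[/eqP->//|/eqP um].
case: va va' => [->|[]]; last by rewrite um eqxx.
by case=> [->//|[]]; rewrite -mm um eqxx.
Qed.

(** If [h] normalises [N], conjugating [sigma] by [h] gives [sigma] times a
    power of [tau].  Compare the terms in [u^y]: the others are multiples of
    [mu^y], as the constant term [(a - 1) v] vanishes for [a = 1]. *)
Lemma presented_full N u mu a al h u' v d :
  regular N -> u ^+ q = 1 -> mu ^+ q = 1 -> mu = 1 \/ a = 1 -> u != mu -> al != 0 ->
  presented N u mu a al -> h \in 'N(N)%g -> affine h u' (fun=> v) d -> u' = pw u d.
Proof.
move=> rN uq muq ma um al0 pN nh hE; have [t [s [Nt Ns tE sE]]] := pN.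
have [n Nn nhE] : exists2 n, n \in N & (s * h = h * n)%g.
  by exists (s ^ h)%g; rewrite ?memJ_norm // conjgC.
pose m := (s^-1 * n)%g; have nE : n = (s * m)%g by rewrite /m mulKVg.
have [||c cE] := fibre_element rN muq pN (z := s (h (0, 0))) (n := m).
- by rewrite groupM ?groupV.
- by rewrite -permM -nE -permM -nhE permM !sE !hE sE /= !add0r addrC.
clearbody m; have e y : u' * (al * pw u y) + v = a * v + al * pw u (y + d) + c * pw mu (y + d + 1).
  have := congr1 (fun r : {perm T} => r (0, y)) nhE; rewrite nE !permM !sE !hE sE cE => e.
  by have [+ _] := pair_inj e; rewrite !mulr0 !add0r mul1r.
have {}e (y : 'F_q) : al * (u' - pw u d) * pw u y = (a - 1) * v + c * pw mu d * mu * pw mu y.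
  transitivity (u' * (al * pw u y) + v - v - al * pw u d * pw u y); first by ring.
  by rewrite e !pwD // !pw1; ring.
have := e 0; have := e 1; rewrite !pw0 !pw1 !mulr1 => e1 e0.
apply/eqP; rewrite -subr_eq0; set D := u' - _ in e0 e1 *.
have [a1|a1] := eqVneq a 1.
  have : al * D * (u - mu) = 0 by rewrite mulrBr e1 e0 a1; ring.
  by move/eqP; rewrite !mulf_eq0 (negPf al0) [u - mu == 0]subr_eq0 (negPf um) orbF.
case: ma => [mu1|/eqP]; last by rewrite (negPf a1).
have : al * D * (u - 1) = 0 by rewrite mulrBr e1 e0 mu1; ring.
by move/eqP; rewrite -mu1 !mulf_eq0 (negPf al0) [u - mu == 0]subr_eq0 (negPf um) orbF.
Qed.

(** [tau] has order [p], and [sigma] normalises its cycle.  If [al <> 0], the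
    translation part of [sigma ^+ q] is a multiple of [(u^q - a^q) / (u - a)],
    so [sigma] has order [q] in every case.  The product of the two cycles has
    order [pq] and is transitive on [pq] points, hence regular. *)
Lemma presented_exists u mu a al :
  u ^+ q = 1 -> mu ^+ q = 1 -> a ^+ q = 1 -> mu = 1 \/ a = 1 ->
  al = 0 \/ (u != mu /\ u != a) ->
  exists N, [/\ regular N /\ presented N u mu a al,
    forall M, regular M -> presented M u mu a al -> M = N,
    forall h u' v d, affine h u' (fun=> v) d -> al * u' = al * pw u d -> h \in 'N(N)%g,
    mu = 1 -> a = 1 -> is_cyclic (p * q) N
  & (mu == 1) && (a == 1) = false -> is_sdprod_cyclic p q N].
Proof.
move=> uq muq aq ma va.
have [tau tE] := @affine_exists p q 1 (pw mu) 0 (oner_neq0 _).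
have [s sE] := @affine_exists p q a (fun y => al * pw u y) 1 (root1_neq0 pq aq).
have tX k : affine (tau ^+ k)%g 1 (fun y => k%:R * pw mu y) 0 by exact: affine_transX.
have tX' (c : 'F_p) : affine (tau ^+ c)%g 1 (fun y => c * pw mu y) 0.
  by move=> x y; rewrite tX natr_Zp.
have t1 : tau != 1%g.
  apply: contra_neq (oner_neq0 'F_p) => t1; have := tE 0 0; rewrite t1 perm1 => e.
  by have [] := pair_inj e; rewrite mul1r add0r pw0.
have s1 : s != 1%g.
  apply: contra_neq (oner_neq0 'F_q) => s1; have := sE 0 0; rewrite s1 perm1 => e.
  by have [_ ->] := pair_inj e; rewrite add0r.
have ot : #[tau]%g = p.
  have : (#[tau]%g %| p)%N.
    rewrite order_dvdn; apply/eqP; apply: (affine_eq (tX p) (@affine1 p q)) => y.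
    by rewrite Fp_char // mul0r.
  by move=> /(primeP pp).2/orP[|/eqP//]; rewrite order_eq1 (negPf t1).
(* Powers of [sigma]: the coefficient is a geometric sum, [(u^k - a^k) / (u -
   a)] for [u <> a]. *)
have [sk skE] : exists sk : nat -> 'F_p, forall k x y, (s ^+ k)%g (x, y) =
    (a ^+ k * x + al * sk k * pw u y, y + k%:R) /\ (u - a) * sk k = u ^+ k - a ^+ k.
  exists (fun k => \sum_(i < k) a ^+ i * u ^+ (k - i.+1)) => k x y.
  elim: k x y => [|k IHk] x y.
    by rewrite expg0 perm1 big_ord0 !mulr0 mul0r mul1r !addr0 !expr0 subrr.
  split; last by rewrite [RHS]subrXX; congr (_ * _); apply: eq_bigr => i _; rewrite subSS mulrC.
  rewrite expgSr permM (IHk x y).1 sE pwD // pwn // -natr1 addrA; congr (_, _).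
  rewrite big_ord_recl /= expr0 mul1r subSS subn0 exprS.
  have -> : \sum_(i < k) a ^+ bump 0 i * u ^+ (k.+1 - (bump 0 i).+1) =
      a * \sum_(i < k) a ^+ i * u ^+ (k - i.+1).
    by rewrite mulr_sumr; apply: eq_bigr => i _; rewrite /bump leq0n add1n exprS subSS mulrA.
  ring.
have os : #[s]%g = q.
  have : (#[s]%g %| q)%N.
    rewrite order_dvdn; apply/eqP/permP => -[x y]; rewrite (skE q x y).1 perm1.
    rewrite aq mul1r Fq_char // addr0; suff -> : al * sk q = 0 by rewrite mul0r addr0.
    case: va => [->|[_ ua]]; first by rewrite mul0r.
    have := (skE q x y).2; rewrite uq aq subrr => /eqP.
    by rewrite mulf_eq0 subr_eq0 (negPf ua) => /eqP->; rewrite mulr0.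
  by move=> /(primeP pq).2/orP[|/eqP//]; rewrite order_eq1 (negPf s1).
have mu0 := root1_neq0 pq muq.
have conj_ts : (tau ^ s = tau ^+ (a / mu)%R)%g.
  apply: (mulgI s); rewrite -conjgC; apply/permP => -[x y].
  rewrite !permM tE sE sE tX' !addr0 pwD // pw1; congr (_, _).
  have e : a / mu * (pw mu y * mu) = a * pw mu y.
    by rewrite [pw mu y * mu]mulrC mulrA divfK.
  by rewrite e; ring.
have nts : s \in 'N(<[tau]>)%g.
  by rewrite inE -cycleJ conj_ts cycle_subG mem_cycle.
have nTS : <[s]>%g \subset 'N(<[tau]>)%g by rewrite cycle_subG.
have co : coprime #|<[tau]>%g| #|<[s]>%g|.
  by rewrite -!orderE ot os prime_coprime // dvdn_prime2 // neq_ltn qp orbT.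
have tiTS := coprime_TIg co.
pose N := (<[tau]> <*> <[s]>)%G.
have NE : N = (<[tau]> * <[s]>)%g :> {set _} by rewrite /= norm_joinEr.
have cN : #|N| = (p * q)%N by rewrite NE TI_cardMg // -!orderE ot os.
have Nt : tau \in N by rewrite NE; apply: (subsetP (mulG_subl _ _)); exact: cycle_id.
have Ns : s \in N by rewrite NE; apply: (subsetP (mulG_subr _ _)); exact: cycle_id.
have tr0 z : exists2 n, n \in N & n (0, 0) = z.
  case: z => x y; have [x0 sy] : exists x0, (s ^+ y)%g (0, 0) = (x0, 0 + (y : nat)%:R).
    by eexists; apply: (skE y 0 0).1.
  exists (s ^+ y * tau ^+ ((x - x0) / pw mu y)%R)%g; first by rewrite groupM ?groupX.
  rewrite permM sy natr_Zp add0r tX' divfK ?pw_neq0 // addr0.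
  by congr (_, _); ring.
have rN : regular N.
  have tr z w : exists2 n, n \in N & n z = w.
    have [n Nn <-] := tr0 z; have [m Nm <-] := tr0 w.
    by exists (n^-1 * m)%g; rewrite ?groupM ?groupV // permM permK.
  split=> // n z Nn nz.
  have /imset_injP inj : #|(fun n : {perm T} => n z) @: N| == #|N|.
    rewrite cN -(card_plane pp pq); apply/eqP/eq_card => w; rewrite inE.
    by have [m Nm <-] := tr z w; apply/imsetP; exists m.
  by apply: inj => //; rewrite perm1.
have pN : presented N u mu a al by exists tau, s.
exists N; split=> //.
- move=> M rM [t' [s' [Mt Ms tE' sE']]].
  rewrite -(affine_eq tE tE') // in Mt; rewrite -(affine_eq sE sE') // in Ms.
  apply/esym/val_inj/eqP; rewrite eqEcard /= join_subG !cycle_subG Mt Ms.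
  by rewrite (card_regular (0, 0) rM) (card_plane pp pq); have /= -> := cN; rewrite leqnn.
- move=> h u' v d hE alu.
  have hV : (tau ^ h \in N)%g.
    suff -> : (tau ^ h = tau ^+ (u' / pw mu d)%R)%g by rewrite groupX.
    apply: (mulgI h); rewrite -conjgC; apply/permP => -[x y].
    rewrite !permM tE hE hE tX' !addr0 pwD //; congr (_, _).
    have e : u' / pw mu d * (pw mu y * pw mu d) = u' * pw mu y.
      by rewrite [pw mu y * _]mulrC mulrA divfK ?pw_neq0.
    by rewrite e; ring.
  have hS : (s ^ h \in N)%g.
    suff -> : (s ^ h = s * tau ^+ ((1 - a) * v / mu)%R)%g by rewrite groupM ?groupX.
    apply: (mulgI h); rewrite -conjgC; apply/permP => -[x y].
    rewrite !permM sE hE hE sE tX' !addr0 addrAC; congr (_, _).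
    have e : (1 - a) * v / mu * pw mu (y + d + 1) = (1 - a) * v.
      rewrite pwD // pw1; case: ma => [->|->]; first by rewrite divr1 pw_1 !mulr1.
      by rewrite subrr !mul0r.
    rewrite e pwD // mulrDr !mulrA [u' * al]mulrC alu; ring.
  by rewrite inE sub_conjg join_subG !cycle_subG !mem_conjgV hV hS.
- move=> m1 a1; split=> //; rewrite NE; apply: cyclicM; rewrite ?cycle_cyclic //.
  have one : nat_of_ord (1 : 'F_p) = 1%N by rewrite (val_Fp_nat pp 1) modn_small ?prime_gt1.
  have cj : (tau ^ s = tau)%g by rewrite conj_ts a1 m1 divr1 one expg1.
  rewrite cycle_subG; apply/centP => x /cycleP[i ->]; apply: commuteX.
  by rewrite /commute -{1}cj -conjgC.
- move=> ma1; exists <[tau]>%G, <[s]>%G; split.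
  + by rewrite sdprodE // -NE.
  + by split; rewrite ?cycle_cyclic.
  + by split; rewrite ?cycle_cyclic.
  apply: prime_TIg; first by rewrite -orderE os.
  rewrite cycle_subG; apply/negP => /centP/(_ tau (cycle_id _)) com.
  have cj : (tau ^ s = tau)%g by rewrite conjgE -com mulKg.
  have := tX' (a / mu) 0 0; rewrite -conj_ts cj tE => e; have [+ _] := pair_inj e.
  rewrite pw0 mul1r !add0r mulr1 => /esym/divr1_eq am; move: ma1; rewrite am.
  by case: ma => [->|am1]; rewrite -?am ?am1 eqxx.
Qed.
End Presentation.

(** * Counting normal forms *)

Lemma cyclic_not_sdprod p q (gT : finGroupType) (N : {group gT}) n :
  (1 < q)%N -> is_cyclic n N -> ~ is_sdprod_cyclic p q N.
Proof.
move=> q1 [cN _] [A [B [/sdprodP[_ defN _ _] _ [_ cB] CB]]].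
have sA : A \subset N by rewrite -defN mulG_subl.
have sB : B \subset N by rewrite -defN mulG_subr.
have : B \subset 'C_B(A)%g.
  rewrite subsetI subxx /=; apply: subset_trans sB _.
  by apply: subset_trans (cyclic_abelian cN) _; apply: centS.
by rewrite CB => /subset_leq_card; rewrite cards1 cB leqNgt q1.
Qed.

Section Roots.
Variables (p q : nat).
Hypotheses (q3 : (3 <= q)%N) (pq : prime q) (pp : prime p) (pE : p = (2 * q + 1)%N).

Lemma q_lt_p : (q < p)%N.
Proof. by rewrite pE addn1 ltnS leq_pmull. Qed.

Lemma Fp_unit_order (u : 'F_p) : u != 0 -> u ^+ (2 * q) = 1.
Proof.
move=> u0; apply: (mulfI u0); rewrite mulr1 -exprS -addn1 -pE.
by have := expf_card u; rewrite card_Fp.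
Qed.

(** The group of units of [F_p] is cyclic of order [p - 1 = 2q]. *)
Lemma exists_primitive : exists w : 'F_p, q.-primitive_root w.
Proof.
have q2 : (0 < 2 * q)%N by rewrite muln_gt0 (prime_gt0 pq).
have /hasP[z _ zP] : has (2 * q).-primitive_root (enum (predC1 (0 : 'F_p))).
  apply: has_prim_root => //; last by rewrite -cardE cardC1 card_Fp // pE addn1.
    apply/allP => x; rewrite mem_enum => x0.
    by apply/unity_rootP/Fp_unit_order.
  exact: enum_uniq.
by exists (z ^+ (2 * q %/ q)); apply: (dvdn_prim_root zP); rewrite dvdn_mull.
Qed.

Lemma card_roots (w : 'F_p) : q.-primitive_root w -> #|[set x : 'F_p | x ^+ q == 1]| = q.
Proof.
move=> wP; rewrite -[RHS]card_ord -(card_imset _ (f := fun i : 'I_q => w ^+ i)).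
  apply: eq_card => x; rewrite inE; apply/eqP/imsetP => [xq|[i _ ->]].
    by have [i ->] := prim_rootP wP xq; exists i.
  by rewrite exprAC (prim_expr_order wP) expr1n.
move=> i j /eqP; rewrite (eq_prim_root_expr wP) !modn_small ?ltn_ord // => /eqP e.
exact: val_inj.
Qed.

(** The triples [(mu, a, al)] of normal forms; [c] tells whether [al <> 0] can
    occur. *)
Definition params (u : 'F_p) (c : bool) : {set 'F_p * 'F_p * 'F_p} :=
  [set x | [&& x.1.1 ^+ q == 1, x.1.2 ^+ q == 1, (x.1.1 == 1) || (x.1.2 == 1)
    & (x.2 == 0) || [&& u != x.1.1, u != x.1.2 & c]]].

Lemma card_shift (b : bool) : #|[set al : 'F_p | (al == 0) || b]| = if b then p else 1%N.
Proof.
case: b; last first.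
  by rewrite -[RHS](cards1 (0 : 'F_p)); apply: eq_card => x; rewrite !inE orbF.
by rewrite -[RHS](card_Fp pp) -cardsT; apply: eq_card => x; rewrite !inE orbT.
Qed.

Lemma card_params_cyclic u c :
  #|params u c :&: [set x | x.1 == (1, 1)]| = if (u != 1) && c then p else 1%N.
Proof.
rewrite -card_shift -(card_imset _ (f := fun al : 'F_p => ((1 : 'F_p, 1 : 'F_p), al))); last first.
  by move=> x y e; have [] := pair_inj e.
apply: eq_card => -[[m a] al]; rewrite !inE /=; apply/andP/imsetP.
  move=> [/and4P[_ _ _ h] /eqP e]; exists al; last by rewrite e.
  by have [m1 a1] := pair_inj e; move: h; rewrite inE m1 a1; case: (u != 1).
case=> al'; rewrite inE => h e; have [e1 ->] := pair_inj e; have [-> ->] := pair_inj e1.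
by rewrite !expr1n !eqxx /=; move: h; case: (u != 1).
Qed.

(** Two families, [a = 1] and [mu = 1], each indexed by the [q - 1] roots of
    unity other than 1.  In both, [al] ranges over [F_p] except when the root
    equals [u], which leaves [p (q - 2) + 1] triples if [u <> 1]. *)
Lemma card_params_nonabelian (w u : 'F_p) c : q.-primitive_root w -> u ^+ q = 1 ->
  #|params u c :&: [set x | x.1 != (1, 1)]| =
  if (u != 1) && c then (2 * p * (q - 2) + 2)%N else (2 * (q - 1))%N.
Proof.
move=> wP uq.
pose S := [set x : 'F_p * 'F_p | (x.1 ^+ q == 1) && (x.1 != 1) &&
  ((x.2 == 0) || [&& u != x.1, u != 1 & c])].
pose R := [set x : 'F_p | x ^+ q == 1].
have cR : #|R :\ 1| = (q - 1)%N.
  have := cardsD1 1 R; rewrite (card_roots wP) inE expr1n eqxx /= => e.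
  by rewrite -[LHS](addKn 1%N) -e.
pose R1 : {set 'F_p} := R :\ 1; rewrite -/R1 in cR.
have cS : #|S| = if (u != 1) && c then (p * (q - 2) + 1)%N else (q - 1)%N.
  rewrite -sum1_card.
  transitivity (\sum_(m in R1) (if [&& u != m, u != 1%R & c] then p else 1))%N.
    transitivity (\sum_(m in R1) \sum_(al : 'F_p | (al == 0%R) || [&& u != m, u != 1%R & c]) 1)%N.
      rewrite pair_big_dep /=; apply: eq_bigl => x; rewrite !inE.
      by rewrite [(x.1 != 1) && _]andbC.
    apply: eq_bigr => m _; rewrite -[RHS](card_shift [&& u != m, u != 1%R & c]) -sum1_card.
    by apply: eq_bigl => x; rewrite inE.
  case: ifP => [/andP[u1 c1]|uc]; last first.
    rewrite -cR -sum1_card; apply: eq_bigr => m _.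
    by rewrite andbF.
  have Ru : u \in R1 by rewrite !inE u1 uq eqxx.
  rewrite (bigD1 u) //= eqxx /= addnC; congr (_ + _)%N.
  transitivity (\sum_(m in R1 :\ u) p)%N.
    apply: eq_big => [m|m]; first by rewrite !inE andbC.
    by case/andP=> _ mu; rewrite eq_sym mu.
  rewrite sum_nat_const mulnC; congr (_ * _)%N.
  have := cardsD1 u (R1); rewrite Ru cR => e.
  by rewrite -[#|_|](addKn 1%N) -e -subnDA.
pose f1 (x : 'F_p * 'F_p) := ((x.1, 1 : 'F_p), x.2).
pose f2 (x : 'F_p * 'F_p) := ((1 : 'F_p, x.1), x.2).
have f1I : injective f1.
  by move=> [m al] [m' al'] e; have [/= e1 ->] := pair_inj e; have [/= -> _] := pair_inj e1.
have f2I : injective f2.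
  by move=> [m al] [m' al'] e; have [/= e1 ->] := pair_inj e; have [/= _ ->] := pair_inj e1.
have -> : params u c :&: [set x | x.1 != (1, 1)] = f1 @: S :|: f2 @: S.
  apply/setP => -[[m a] al]; rewrite !inE /=; apply/andP/orP.
    move=> [/and4P[mq aq /orP[/eqP m1|/eqP a1] h] ma].
      right; apply/imsetP; exists (a, al); last by rewrite /f2 m1.
      rewrite inE /= aq; move: ma h; rewrite m1 xpair_eqE eqxx /= => -> /=.
      by case: (u != 1); case: (u != a).
    left; apply/imsetP; exists (m, al); last by rewrite /f1 a1.
    rewrite inE /= mq; move: ma h; rewrite a1 xpair_eqE eqxx andbT => -> /=.
    by case: (u != 1); case: (u != m).
  case=> /imsetP[[x al'] /=]; rewrite inE /= => /andP[/andP[xq x1] h] e;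
    have [/= e1 ->] := pair_inj e; have [/= -> ->] := pair_inj e1;
    rewrite xq expr1n !eqxx xpair_eqE ?andbT (negPf x1) ?orbT //=; move: h;
    by case: (u != 1); case: (u != x).
rewrite cardsU disjoint_setI0 ?cards0 ?subn0; last first.
  rewrite -setI_eq0; apply/eqP/setP => x; rewrite !inE; apply/andP => -[/imsetP[y]].
  rewrite inE => /andP[/andP[_ y1] _] -> /imsetP[z _ e].
  have [/= e1 _] := pair_inj e; have [/= e2 _] := pair_inj e1.
  by rewrite e2 eqxx in y1.
rewrite !card_imset // cS addnn -mul2n; case: ifP => // _.
by rewrite mulnDr mulnA.
Qed.
End Roots.

(** * Regular groups normalised by an affine group *)

Section RegularsOf.
Variables (p q : nat).
Hypotheses (q3 : (3 <= q)%N) (pq : prime q) (pp : prime p) (pE : p = (2 * q + 1)%N).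
Local Notation T := ('F_p * 'F_q)%type.
Let qp : (q < p)%N := q_lt_p pE.

(** The elements [t] and [g] give the normal form.  The rest of [G] only decides
    whether [al] may be nonzero: by [presented_full] every element must then
    have multiplier [u^d], and [presented_exists] gives the converse. *)
Lemma regulars_param (G : {group {perm T}}) (t g : {perm T}) (u : 'F_p) (c : bool) :
  t \in G -> g \in G -> affine t 1 (fun=> 1) 0 -> affine g u (fun=> 0) 1 -> u ^+ q = 1 ->
  (forall h, h \in G -> exists u' v d, affine h u' (fun=> v) d) ->
  (c -> forall h u' v d, h \in G -> affine h u' (fun=> v) d -> u' = pw u d) ->
  (~~ c -> exists h u' v d, [/\ h \in G, affine h u' (fun=> v) d & u' != pw u d]) ->
  exists nu : 'F_p * 'F_p * 'F_p -> {group {perm T}},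
  [/\ forall x, x \in params q u c -> [/\ regular (nu x), G \subset 'N(nu x)%g
        & if x.1 == (1, 1) then is_cyclic (p * q) (nu x) else is_sdprod_cyclic p q (nu x)],
      {in params q u c &, injective nu}
    & forall N : {group {perm T}}, regular N -> G \subset 'N(N)%g ->
        exists2 x, x \in params q u c & N = nu x].
Proof.
move=> Gt Gg tE gE uq Gaff cT cF.
have vP (x : 'F_p * 'F_p * 'F_p) : x \in params q u c -> [/\ x.1.1 ^+ q = 1, x.1.2 ^+ q = 1,
    x.1.1 = 1 \/ x.1.2 = 1 & x.2 = 0 \/ (u != x.1.1 /\ u != x.1.2)].
  rewrite inE => /and4P[/eqP muq /eqP aq /orP ma h]; split=> //.
    by case: ma => /eqP; [left | right].
  by case/orP: h => [/eqP|/and3P[]]; [left | right].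
have /fin_all_exists[nu nuP] : forall x : 'F_p * 'F_p * 'F_p, exists N : {group {perm T}},
    x \in params q u c -> [/\ regular N /\ presented N u x.1.1 x.1.2 x.2,
    forall M, regular M -> presented M u x.1.1 x.1.2 x.2 -> M = N,
    forall h u' v d, affine h u' (fun=> v) d -> x.2 * u' = x.2 * pw u d -> h \in 'N(N)%g,
    x.1.1 = 1 -> x.1.2 = 1 -> is_cyclic (p * q) N
  & (x.1.1 == 1) && (x.1.2 == 1) = false -> is_sdprod_cyclic p q N].
  move=> x; have [/vP[muq aq ma va]|] := boolP (x \in params q u c); last by exists 1%G.
  have [N NP] := presented_exists pp pq qp uq muq aq ma va.
  by exists N => _.
exists nu; split.
- move=> x Px; have [[rN pN] _ nN cN sN] := nuP x Px; split=> //.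
    apply/subsetP => h Gh; have [u' [v [d hE]]] := Gaff h Gh.
    apply: (nN _ _ _ _ hE); move: Px; rewrite inE => /and4P[_ _ _ /orP[/eqP->|/and3P[_ _ cc]]].
      by rewrite !mul0r.
    by rewrite (cT cc h u' v d).
  case: eqP => [e|ne].
    by apply: cN; rewrite e.
  apply: sN; apply/negP => /andP[/eqP m1 /eqP a1]; apply: ne.
  by rewrite [x.1]surjective_pairing m1 a1.
- move=> x y Px Py e; have [[rN pN] _ _ _ _] := nuP x Px; have [[_ pM] _ _ _ _] := nuP y Py.
  have [muq _ _ va] := vP x Px; have [muq' _ _ va'] := vP y Py; rewrite -e in pM.
  have [] := presented_uniq pq rN uq muq muq' va va' pN pM.
  case: x y {Px Py e rN pN pM muq muq' va va'} => [[m a] al] [[m' a'] al'] /= -> -> -> //.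
- move=> N rN /subsetP nN.
  have [mu [a [al [muq aq ma va pN]]]] := regular_presented pp pq qp rN (nN _ Gt) (nN _ Gg) tE gE uq.
  have Px : (mu, a, al) \in params q u c.
    rewrite inE /= muq aq !eqxx /=; apply/andP; split.
      by case: ma => ->; rewrite eqxx ?orbT.
    have [//|al0] := eqVneq al 0; case: va => [/eqP|[um ua]]; first by rewrite (negPf al0).
    rewrite um ua /=; apply: contraT => /cF[h [u' [v [d [Gh hE]]]]].
    by rewrite (presented_full pq rN uq muq ma um al0 pN (nN _ Gh) hE) eqxx.
  by exists (mu, a, al) => //; have [_ + _ _ _] := nuP _ Px; apply.
Qed.

Lemma regulars_enum (G : {group {perm T}}) (X : {set 'F_p * 'F_p * 'F_p})
    (nu : 'F_p * 'F_p * 'F_p -> {group {perm T}}) (Q : group_prop) k :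
  {in X &, injective nu} ->
  (forall x, x \in X -> regular (nu x) /\ G \subset 'N(nu x)%g) ->
  (forall N : {group {perm T}}, regular N -> G \subset 'N(N)%g -> exists2 x, x \in X & N = nu x) ->
  forall Y : {set 'F_p * 'F_p * 'F_p},
  (forall x, x \in X -> Q _ (nu x) <-> x \in Y) -> #|X :&: Y| = k ->
  exists nu' : 'I_k -> {group {perm T}},
  [/\ forall i, [/\ regular (nu' i), G \subset 'N(nu' i)%g & Q _ (nu' i)], injective nu'
    & forall N : {group {perm T}}, regular N -> G \subset 'N(N)%g -> Q _ N -> exists i, N = nu' i].
Proof.
move=> nuI nuR nuS Y QY cXY; rewrite -{k}cXY.
have inX (i : 'I_#|X :&: Y|) : enum_val i \in X /\ enum_val i \in Y.
  by have := enum_valP i; rewrite inE => /andP.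
exists (fun i => nu (enum_val i)); split.
- by move=> i; have [Xi Yi] := inX i; have [? ?] := nuR _ Xi; split=> //; apply/QY.
- move=> i j e; apply: enum_val_inj; apply: nuI e; exact: (inX _).1.
- move=> N rN nN QN; have [x Xx eN] := nuS N rN nN.
  have XYx : x \in X :&: Y by rewrite inE Xx /=; apply/(QY _ Xx); rewrite -eN.
  by exists (enum_rank_in XYx x); rewrite enum_rankK_in.
Qed.
End RegularsOf.

Section Family.
Variables (p q : nat).
Hypotheses (q3 : (3 <= q)%N) (pq : prime q) (pp : prime p) (pE : p = (2 * q + 1)%N).
Local Notation T := ('F_p * 'F_q)%type.
Let qp : (q < p)%N := q_lt_p pE.

(** [u / w^d] ranges over one of the four subgroups of the group of units, which
    has order [2q]: all units, the q-th roots of unity ([A] alone), the signs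
    ([B] alone) or 1.  When [w ^+ q = 1], the second condition can be stated on
    [u]. *)
Definition fam_cond (A B : bool) (w u : 'F_p) (d : 'F_q) :=
  (A || ((u / pw w d) ^+ 2 == 1)) && (B || (u ^+ q == 1)).

Definition fam_set A B w : {set {perm T}} :=
  [set s : {perm T} | [exists u : 'F_p, exists v : 'F_p, exists d : 'F_q,
    [forall z, s z == (u * z.1 + v, z.2 + d)] && fam_cond A B w u d]].

Lemma fam_setP A B w s :
  reflect (exists u v d, affine s u (fun=> v) d /\ fam_cond A B w u d) (s \in fam_set A B w).
Proof.
rewrite inE; apply: (iffP existsP) => [[u /existsP[v /existsP[d /andP[/forallP sE cE]]]]|].
  by exists u, v, d; split=> // x y; apply/eqP/sE.
case=> u [v [d [sE cE]]]; exists u; apply/existsP; exists v; apply/existsP; exists d.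
by rewrite cE andbT; apply/forallP => -[x y]; rewrite sE.
Qed.

Lemma mem_fam A B w s u v d : affine s u (fun=> v) d ->
  (s \in fam_set A B w) = fam_cond A B w u d.
Proof.
move=> sE; apply/fam_setP/idP => [[u' [v' [d' [sE' c]]]]|c]; last by exists u, v, d.
by have [-> _ ->] := affine_uniq sE sE'.
Qed.

Lemma fam_group_set A B w : w ^+ q = 1 -> group_set (fam_set A B w).
Proof.
move=> wq; apply/group_setP; split.
  by rewrite (mem_fam _ _ _ (@affine1 p q)) /fam_cond pw0 divr1 !expr1n eqxx !orbT.
move=> s s' /fam_setP[u [v [d [sE /andP[c1 c2]]]]] /fam_setP[u' [v' [d' [sE' /andP[c1' c2']]]]].
have sE2 := affineM sE sE'; rewrite (mem_fam _ _ _ sE2) /fam_cond; apply/andP; split.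
  case: A c1 c1' => //= /eqP e /eqP e'.
  have -> : u' * u / pw w (d + d') = (u / pw w d) * (u' / pw w d').
    by rewrite pwD // invfM [u' * u]mulrC mulrACA.
  by rewrite exprMn e e' mulr1.
by case: B c2 c2' => //= /eqP e /eqP e'; rewrite exprMn e e' mulr1.
Qed.
End Family.

(** * Transitive groups in the normaliser of the translations *)

Section Biaffine.
Variables (p q : nat).
Hypotheses (q3 : (3 <= q)%N) (pq : prime q) (pp : prime p) (pE : p = (2 * q + 1)%N).
Local Notation T := ('F_p * 'F_q)%type.
Let qp : (q < p)%N := q_lt_p pE.

(** These maps form the normaliser of the group of translations of the plane. *)
Definition biaffine (s : {perm T}) (u v : 'F_p) (c d : 'F_q) :=
  forall x y, s (x, y) = (u * x + v, c * y + d).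

Lemma biaffineM s s' u v c d u' v' c' d' : biaffine s u v c d -> biaffine s' u' v' c' d' ->
  biaffine (s * s')%g (u' * u) (u' * v + v') (c' * c) (c' * d + d').
Proof. by move=> H H' x y; rewrite permM H H'; congr (_, _); ring. Qed.

Lemma biaffine1 : biaffine 1%g 1 0 1 0.
Proof. by move=> x y; rewrite perm1 !mul1r !addr0. Qed.

Lemma biaffine_uniq s u v c d u' v' c' d' : biaffine s u v c d -> biaffine s u' v' c' d' ->
  [/\ u = u', v = v', c = c' & d = d'].
Proof.
move=> H H'; have [e1 e2] : v = v' /\ d = d'.
  by have := H 0 0; rewrite H' !mulr0 !add0r => e; have [] := pair_inj e.
have [e3 e4] : u = u' /\ c = c'.
  by have := H 1 1; rewrite H' !mulr1 e1 e2 => e; have [/addIr -> /addIr ->] := pair_inj e.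
by [].
Qed.

Lemma biaffineX s u v c d k : biaffine s u v c d -> exists v' d',
  biaffine (s ^+ k)%g (u ^+ k) v' (c ^+ k) d'.
Proof.
move=> H; elim: k => [|k [v' [d' IHk]]]; first by exists 0, 0; apply: biaffine1.
by exists (u * v' + v), (c * d' + d); rewrite expgSr !exprS; apply: biaffineM.
Qed.

Lemma biaffine_neq0 s u v c d : biaffine s u v c d -> u != 0 /\ c != 0.
Proof.
move=> H; split; apply/eqP => z0.
  have := @perm_inj _ s (0, 0) (1, 0); rewrite !H z0 !mul0r => /(_ erefl) e.
  by have [/esym/eqP] := pair_inj e; rewrite oner_eq0.
have := @perm_inj _ s (0, 0) (0, 1); rewrite !H z0 !mul0r => /(_ erefl) e.
by have [_ /esym/eqP] := pair_inj e; rewrite oner_eq0.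
Qed.

Lemma affine_biaffine s u v d : affine s u (fun=> v) d <-> biaffine s u v 1 d.
Proof. by split=> H x y; have := H x y; rewrite mul1r. Qed.

Section Transitive.
Variable D : {group {perm T}}.
Hypothesis trD : forall z w, exists2 h, h \in D & h z = w.
Hypothesis afD : forall h, h \in D -> exists u v c d, biaffine h u v c d.

Lemma trans_p_dvd : (p %| #|D|)%N.
Proof.
have := card_orbit_stab 'P D ((0, 0) : T).
have -> : orbit 'P D ((0, 0) : T) = setT.
  apply/setP => z; rewrite inE; have [h Dh <-] := trD (0, 0) z.
  by apply/orbitP; exists h.
by rewrite cardsT (card_plane pp pq) => <-; rewrite -mulnA dvdn_mulr.
Qed.

(** By transitivity [p] divides the order of [D].  In an element of order [p],
    the multiplier is [u = u ^+ p = 1] and the permutation of the fibres is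
    trivial; a power of it is [t]. *)
Lemma trans_t : exists2 t, t \in D & affine t 1 (fun=> 1) 0.
Proof.
have [h Dh oh] := Cauchy pp trans_p_dvd.
have hp : (h ^+ p = 1)%g by apply/eqP; rewrite -order_dvdn oh.
have [u [v [c [d hE]]]] := afD Dh; have [u0 c0] := biaffine_neq0 hE.
have u1 : u = 1.
  have [v' [d' hE']] := biaffineX p hE; rewrite hp in hE'.
  have [<- _ _ _] := biaffine_uniq hE' biaffine1.
  by have := expf_card u; rewrite card_Fp.
pose f (y : 'F_q) := c * y + d.
have fI : injective f by move=> y y' /addIr/(mulfI c0).
have hs k x y : ((h ^+ k)%g (x, y)).2 = (perm fI ^+ k)%g y.
  elim: k => [|k IHk]; first by rewrite !expg0 !perm1.
  rewrite !expgSr !permM -IHk permE; case: ((h ^+ k)%g (x, y)) => x' y'.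
  by rewrite hE.
have f1 : perm fI = 1%g.
  apply: (perm_small_prime_order pp); first by rewrite card_Fp.
  by apply/permP => y; rewrite -(hs p 0) hp !perm1.
have hE2 : affine h 1 (fun=> v) 0.
  move=> x y; rewrite hE u1 addr0 -/(f y); congr (_, _).
  by have /permP/(_ y) := f1; rewrite permE perm1.
have v0 : v != 0.
  apply/eqP => v0; have h1 : h = 1%g.
    by apply: (affine_eq hE2 (@affine1 p q)) => y.
  by have := prime_gt1 pp; rewrite -[X in (_ < X)%N]oh h1 order1.
exists (h ^+ (v^-1)%R)%g; first by rewrite groupX.
by move=> x y; rewrite (affine_transX _ hE2) natr_Zp mulVf.
Qed.

(** Let [h1] send [(0, 0)] to [(0, 1)].  If it does not act on the fibres as a
    translation, it fixes some fibre [y0]; take [h2] sending [(0, y0)] to [(0,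
    y0 + 1)].  Both preserve the axis [x = 0], and their commutator shifts the
    fibres: it can act trivially on them only if [h2] fixes [y0]. *)
Lemma trans_shift : exists h u d, [/\ h \in D, affine h u (fun=> 0) d & d != 0].
Proof.
have [h1 Dh1 e1] := trD (0, 0) (0, 1); have [u1 [v1 [c1 [d1 h1E]]]] := afD Dh1.
have := e1; rewrite h1E !mulr0 !add0r => e; have [v10 d11] := pair_inj e.
rewrite {}v10 {}d11 in h1E.
have [c11|c11] := eqVneq c1 1.
  exists h1, u1, 1; split=> //.
  by rewrite c11 in h1E; apply/affine_biaffine.
pose y0 := (1 - c1)^-1.
have y0E : c1 * y0 + 1 = y0.
  have : (1 - c1) * y0 = 1 by rewrite divff // subr_eq0 eq_sym.
  by move=> e2; rewrite -[X in _ + X = _]e2; ring.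
have [h2 Dh2 e2] := trD (0, y0) (0, y0 + 1); have [u2 [v2 [c2 [d2 h2E]]]] := afD Dh2.
have := e2; rewrite h2E !mulr0 !add0r => e'; have [v20 d22] := pair_inj e'.
rewrite {}v20 in h2E.
pose k := ((h2 * h1)^-1 * (h1 * h2))%g.
pose d := c2 + d2 - (c1 * d2 + 1).
exists k, 1, d; split.
- by rewrite groupM ?groupV ?groupM.
- move=> x y; rewrite /k permM.
  case ez : ((h2 * h1)^-1%g (x, y)) => [x' y'].
  have : (h2 * h1)%g (x', y') = (x, y) by rewrite -ez permKV.
  rewrite (biaffineM h2E h1E) (biaffineM h1E h2E) => e3; have [<- <-] := pair_inj e3.
  by congr (_, _); rewrite ?/d; ring.
- apply/eqP => d0; have c2E : c2 = (c1 - 1) * d2 + 1.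
    by apply/eqP; rewrite -subr_eq0 -[X in _ == X]d0 /d; apply/eqP; ring.
  have : y0 + 1 = y0.
    have c1y : (c1 - 1) * y0 + 1 = 0.
      by rewrite -(subrr y0) -{2}y0E; ring.
    rewrite -d22 c2E; transitivity (((c1 - 1) * y0 + 1) * d2 + y0); first by ring.
    by rewrite c1y mul0r add0r.
  by move/eqP; rewrite -subr_eq0 addrAC subrr add0r oner_eq0.
Qed.

Lemma affine_scaleX h (u : 'F_p) (d : 'F_q) k : affine h u (fun=> 0) d ->
  affine (h ^+ k)%g (u ^+ k) (fun=> 0) (k%:R * d).
Proof.
move=> H; elim: k => [|k IHk] x y; first by rewrite expg0 perm1 mul1r mul0r !addr0.
by rewrite expgSr permM IHk H exprS -natr1 !addr0 mulrDl mul1r addrA mulrA.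
Qed.

Lemma odd_q : odd q.
Proof. by have := q3; case/even_prime: pq => // ->. Qed.

(** A power of the shift moves the fibres by 1.  Raising it to the power [q +
    1], which is 1 modulo [q] and even, keeps this and makes the multiplier a
    square, that is, a q-th root of unity. *)
Lemma trans_g : exists w g, [/\ g \in D, affine g w (fun=> 0) 1 & w ^+ q = 1].
Proof.
have [h [u [d [Dh hE d0]]]] := trans_shift.
have hE1 := affine_scaleX (d^-1 : 'F_q) hE; rewrite natr_Zp mulVf // in hE1.
have u0 := affine_neq0 hE1; set u' := u ^+ _ in hE1 u0.
have hE2 := affine_scaleX q.+1 hE1.
exists (u' ^+ q.+1), ((h ^+ (d^-1)%R) ^+ q.+1)%g; split.
- by rewrite !groupX.
- by rewrite mulr1 -natr1 Fq_char // add0r in hE2.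
have -> : q.+1 = (2 * uphalf q)%N by rewrite mul2n -[q.+1]odd_double_half /= odd_q.
by rewrite -exprM mulnAC exprM (Fp_unit_order pp pE u0) expr1n.
Qed.

Lemma pw_inj (m : 'F_p) (y z : 'F_q) : m ^+ q = 1 -> m != 1 -> pw m y = pw m z -> y = z.
Proof.
move=> mq m1 e; apply/eqP; rewrite -subr_eq0; apply: contraNT m1 => yz.
have e1 : pw m (y - z) = 1.
  by apply: (mulIf (pw_neq0 pq z mq)); rewrite -pwD // subrK mul1r.
have e2 k : pw m (k%:R * (y - z)) = 1.
  elim: k => [|k IHk]; first by rewrite mul0r pw0.
  by rewrite -natr1 mulrDl mul1r pwD // IHk e1 mulr1.
by have := e2 ((y - z)^-1); rewrite natr_Zp mulVf // pw1 // => ->.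
Qed.

(** Conjugation by [h] turns [tau] and [sigma] into elements of the same normal
    form whose parameters are powers of [mu] or [a] with exponent [c]; one of
    these parameters has order [q]. *)
Lemma trans_c1 (N : {group {perm T}}) w mu a al :
  regular N -> D \subset 'N(N)%g -> presented N w mu a al ->
  mu ^+ q = 1 -> a ^+ q = 1 -> mu = 1 \/ a = 1 -> (mu, a) != (1, 1) ->
  forall h u v c d, h \in D -> biaffine h u v c d -> c = 1.
Proof.
move=> rN /subsetP nN pN muq aq ma ma1 h u v c d Dh hE.
have [t [s [Nt Ns tE sE]]] := pN.
have [mu1|mu1] := eqVneq mu 1; last first.
  have [n Nn en] : exists2 n, n \in N & (t * h = h * n)%g.
    by exists (t ^ h)%g; rewrite ?memJ_norm ?nN // conjgC.
  have [||k kE] := fibre_element pq rN muq pN (z := h (0, 0)) (n := n) => //.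
    by rewrite -permM -en permM tE !hE /= addr0.
  have e y : u * pw mu y = k * pw mu (c * y + d).
    have := congr1 (fun r : {perm T} => r (0, y)) en; rewrite !permM tE !hE kE => e.
    have [+ _] := pair_inj e; rewrite !mulr0 !mul1r !add0r [RHS]addrC => /addIr.
    by [].
  have e0 := e 0; have e1 := e 1; rewrite pw0 mulr1 mulr0 add0r in e0.
  apply: (pw_inj muq mu1); rewrite pw1 //; have [u0 _] := biaffine_neq0 hE.
  apply: (mulfI u0); rewrite pw1 // mulr1 pwD // in e1.
  by rewrite e1 e0 mulrAC mulrA.
have a1 : a != 1 by apply: contra_neq ma1 => ->; rewrite mu1.
have [n Nn en] : exists2 n, n \in N & (s * h = h * n)%g.
  by exists (s ^ h)%g; rewrite ?memJ_norm ?nN // conjgC.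
have [b' sX] := affineX c sE; rewrite natr_Zp mulr1 in sX.
pose m := ((s ^+ c)^-1 * n)%g; have nE : n = (s ^+ c * m)%g by rewrite /m mulKVg.
have Nm : m \in N by rewrite groupM ?groupV ?groupX.
have [|k kE] := fibre_element pq rN muq pN (z := (s ^+ c)%g (h (0, 0))) Nm.
  rewrite -permM -nE -permM -en permM sE !hE sX /=; ring.
clearbody m.
have e x : u * (a * x) = a ^+ c * (u * x).
  have ee z := congr1 (fun r : {perm T} => r (z, 0)) en.
  have := ee x; have := ee 0; rewrite nE !permM !sE !hE !sX !kE => e0 e1.
  have [f0 _] := pair_inj e0; have [f1 _] := pair_inj e1.
  transitivity ((u * (a * x + al * pw w (0 : 'F_q)) + v) - (u * (a * 0 + al * pw w (0 : 'F_q)) + v)).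
    by ring.
  rewrite f1 f0; ring.
apply: (pw_inj aq a1); rewrite pw1 //; have [u0 _] := biaffine_neq0 hE.
apply: (mulIf u0); have := e 1; rewrite !mulr1 => <-; exact: mulrC.
Qed.
End Transitive.
End Biaffine.

(** * Transitive affine groups and their multipliers *)

Section Classify.
Variables (p q : nat).
Hypotheses (q3 : (3 <= q)%N) (pq : prime q) (pp : prime p) (pE : p = (2 * q + 1)%N).
Local Notation T := ('F_p * 'F_q)%type.
Let qp : (q < p)%N := q_lt_p pE.

Lemma primitive_of_root (z : 'F_p) : z ^+ q = 1 -> z != 1 -> q.-primitive_root z.
Proof.
move=> zq z1; have [m mP mq] := prim_order_exists (prime_gt0 pq) zq.
have /orP[/eqP m1|/eqP <- //] := (primeP pq).2 m mq.
by move: (prim_expr_order mP); rewrite m1 expr1 => e; rewrite e eqxx in z1.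
Qed.

Lemma odd_root (x : 'F_p) : x ^+ 2 = 1 -> x ^+ q = 1 -> x = 1.
Proof.
move=> x2; rewrite -[q]odd_double_half (odd_q q3 pq) exprD expr1 -mul2n exprM x2.
by rewrite expr1n mulr1.
Qed.

Lemma unit_sign (u : 'F_p) : u != 0 -> u ^+ q = 1 \/ u ^+ q = -1.
Proof.
move=> u0; have /eqP : (u ^+ q) ^+ 2 = 1 by rewrite -exprM mulnC (Fp_unit_order pp pE u0).
by rewrite sqrf_eq1 => /orP[]/eqP; [left | right].
Qed.

Lemma expN1q : (-1) ^+ q = -1 :> 'F_p.
Proof. by rewrite -signr_odd (odd_q q3 pq). Qed.

Lemma N1_neq1 : (-1 == 1 :> 'F_p) = false.
Proof.
apply/eqP => e; have : (2%:R : 'F_p) == 0 by rewrite -[2%:R]/(1 + 1) -{1}e addNr.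
by rewrite -val_eqE [val _](val_Fp_nat pp 2) modn_small // (leq_trans _ qp) // ltnS (leq_trans _ q3).
Qed.

Definition fam (A B : bool) (w : 'F_p) (wq : w ^+ q = 1) : {group {perm T}} :=
  Group (fam_group_set pq A B wq).

Section Group.
Variables (D : {group {perm T}}) (t g : {perm T}) (w : 'F_p).
Hypotheses (Dt : t \in D) (Dg : g \in D) (wq : w ^+ q = 1).
Hypotheses (tE : affine t 1 (fun=> 1) 0) (gE : affine g w (fun=> 0) 1).
Hypothesis afD : forall h, h \in D -> exists u v d, affine h u (fun=> v) d.

Let inH (u : 'F_p) := [exists s in D, [forall z, s z == (u * z.1, z.2)]].

Let inHP u : reflect (exists2 s, s \in D & affine s u (fun=> 0) 0) (inH u).
Proof.
apply: (iffP exists_inP) => -[s Ds sE]; exists s => //.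
  by move=> x y; rewrite !addr0; apply/eqP/(forallP sE).
by apply/forallP => -[x y]; rewrite sE !addr0.
Qed.

Let inHM u v : inH u -> inH v -> inH (u * v).
Proof.
move=> /inHP[s Ds sE] /inHP[s' Ds' sE']; apply/inHP.
exists (s * s')%g; first by rewrite groupM.
by move=> x y; rewrite permM sE sE' !addr0; congr (_, _); ring.
Qed.

Let inHX u k : inH u -> inH (u ^+ k).
Proof.
move=> Hu; elim: k => [|k IHk]; last by rewrite exprS inHM.
by apply/inHP; exists 1%g; rewrite ?group1 //; apply: affine1.
Qed.

(** Modulo [t] and powers of [g], membership in [D] only depends on [u / w^d]. *)
Let reduce h u v d : affine h u (fun=> v) d -> (h \in D) = inH (u / pw w d).
Proof.
move=> hE; have u0 := affine_neq0 hE.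
have w0 := pw_neq0 pq d wq.
have [s sE] := @affine_exists p q (u / pw w d) (fun=> 0) 0 (mulf_neq0 u0 (invr_neq0 w0)).
have -> : h = (s * (g ^+ d * t ^+ v))%g.
  apply/permP => -[x y]; rewrite !permM sE (affine_scaleX d gE) (affine_transX v tE) hE.
  by rewrite !natr_Zp !addr0 !mulr1 mul1r mulrA -/(pw w d) [_ * (u / _)]mulrC divfK.
rewrite groupMr ?groupM ?groupX //; apply/idP/inHP => [Ds|[s' Ds' sE']]; first by exists s.
by rewrite (affine_eq sE sE').
Qed.

(** [D] is generated by [t], [g] and its maps [(u x, y)].  The multipliers of
    the latter form a subgroup of a cyclic group of order [2q], which is
    determined by whether it contains an element of order other than 1 and 2
    ([A]) and whether it contains -1 ([B]). *)
Lemma classify_family : exists A B, D = fam A B wq.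
Proof.
pose A := [exists u, [&& u != 0, inH u & u ^+ 2 != 1]]; pose B := inH (-1).
have key (u : 'F_p) : u != 0 -> inH u = (A || (u ^+ 2 == 1)) && (B || (u ^+ q == 1)).
  move=> u0; apply/idP/andP => [Hu|[]].
    split.
      have [//|u2] := boolP (u ^+ 2 == 1); rewrite ?orbT // orbF.
      by apply/existsP; exists u; rewrite u0 Hu u2.
    case: (unit_sign u0) => uq; first by rewrite uq eqxx orbT.
    by rewrite /B -uq inHX.
  (* A nontrivial square [y ^+ 2] is a primitive q-th root of unity. *)
  have pos (x : 'F_p) : x ^+ q = 1 -> A || (x ^+ 2 == 1) -> inH x.
    move=> xq /orP[/existsP[y /and3P[y0 Hy y2]]|/eqP x2].
      have yP : q.-primitive_root (y ^+ 2).
        apply: primitive_of_root => //.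
        by rewrite -exprM (Fp_unit_order pp pE y0).
      by have [i ->] := prim_rootP yP xq; do 2!apply: inHX.
    rewrite (odd_root x2 xq).
    by rewrite -(expr0 (-1)); apply/inHP; exists 1%g; rewrite ?group1 //; apply: affine1.
  move=> Au; case: (unit_sign u0) => uq; first by move=> _; apply: pos.
  rewrite uq N1_neq1 orbF => HB; rewrite -[u]opprK -mulN1r inHM // pos ?sqrrN //.
  by rewrite exprNn uq expN1q mulrNN mulr1.
exists A, B; apply/val_inj/setP => h /=.
have aux u v d : affine h u (fun=> v) d -> (h \in D) = (h \in fam_set q A B w).
  move=> hE; have u0 := affine_neq0 hE; have w0 := pw_neq0 pq d wq.
  rewrite (reduce hE) (mem_fam _ _ _ hE) key ?mulf_neq0 ?invr_neq0 // /fam_cond.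
  by rewrite [(_ / _) ^+ q]exprMn exprVn (pw_unit _ wq) invr1 mulr1.
apply/idP/idP => [Dh|Fh].
  by have [u [v [d hE]]] := afD Dh; rewrite -(aux _ _ _ hE).
by have /fam_setP[u [v [d [hE _]]]] := Fh; rewrite (aux _ _ _ hE).
Qed.
End Group.
End Classify.

(** * Reduction to six groups *)

Section Six.
Variables (p q : nat).
Hypotheses (q3 : (3 <= q)%N) (pq : prime q) (pp : prime p) (pE : p = (2 * q + 1)%N).
Local Notation T := ('F_p * 'F_q)%type.
Let qp : (q < p)%N := q_lt_p pE.

Definition six (w : 'F_p) (wq : w ^+ q = 1) (i : nat) : {group {perm T}} :=
  let o : (1 : 'F_p) ^+ q = 1 := expr1n _ q in
  match i with
  | 0%N => fam pq true true o
  | 1%N => fam pq true false o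
  | 2%N => fam pq false true wq
  | 3%N => fam pq false true o
  | 4%N => fam pq false false wq
  | _ => fam pq false false o
  end.

(** Conjugation by the scaling of the second coordinate by [e] replaces [w'^e]
    by [w']. *)
Lemma fam_conj_scale A B (w w' : 'F_p) (wq : w ^+ q = 1) (wq' : w' ^+ q = 1) (e : 'F_q) s :
  biaffine s 1 0 e 0 -> e != 0 -> w = pw w' e -> (fam pq A B wq :^ s)%g = fam pq A B wq' :> {set _}.
Proof.
move=> sE e0 we.
have pwe d : pw w d = pw w' (e * d).
  rewrite we -[d]natr_Zp pwn ?pw_unit //; elim: (d : nat) => [|k IHk]; first by rewrite mulr0 expr0 pw0.
  by rewrite exprSr IHk -natr1 mulrDr mulr1 pwD.
apply/setP => h; apply/imsetP/idP => [[h' /fam_setP[u [v [d [hE c]]]] ->]|].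
  have hE2 : affine (h' ^ s)%g u (fun=> v) (e * d).
    move=> x y; rewrite conjgE !permM.
    case ez : (s^-1%g (x, y)) => [x' y'].
    have : s (x', y') = (x, y) by rewrite -ez permKV.
    by rewrite sE => e1; have [<- <-] := pair_inj e1; rewrite hE sE; congr (_, _); ring.
  by rewrite (mem_fam _ _ _ hE2); move: c; rewrite /fam_cond pwe.
move=> /fam_setP[u [v [d [hE c]]]]; have u0 := affine_neq0 hE.
have [h' hE'] := @affine_exists p q u (fun=> v) (d / e) u0.
exists h'; first by rewrite (mem_fam _ _ _ hE'); move: c; rewrite /fam_cond pwe [e * _]mulrC divfK.
apply/permP => -[x y]; rewrite conjgE !permM; case ez : (s^-1%g (x, y)) => [x' y'].
have : s (x', y') = (x, y) by rewrite -ez permKV.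
rewrite sE => e1; have [<- <-] := pair_inj e1; rewrite hE' sE hE; congr (_, _); first by ring.
by rewrite mulrDr [e * (d / e)]mulrC divfK // !addr0.
Qed.

(** [w] only enters through the sign condition, which is absent here. *)
Lemma fam_true B (w w' : 'F_p) (wq : w ^+ q = 1) (wq' : w' ^+ q = 1) :
  fam pq true B wq = fam pq true B wq'.
Proof. by apply/val_inj/setP => h; apply/fam_setP/fam_setP => -[u [v [d [hE c]]]]; exists u, v, d. Qed.

Lemma scale_exists (e : 'F_q) : e != 0 -> exists s : {perm T}, biaffine s 1 0 e 0.
Proof.
move=> e0; pose f (z : T) : T := (z.1, e * z.2).
have fI : injective f by move=> [x y] [x' y'] h; have [/= -> /(mulfI e0) ->] := pair_inj h.
by exists (perm fI) => x y; rewrite permE mul1r !addr0.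
Qed.

Lemma fam_six A B (w w0 : 'F_p) (wq : w ^+ q = 1) (w0q : w0 ^+ q = 1) :
  q.-primitive_root w0 ->
  exists (s : {perm T}) (i : 'I_6), s (0, 0) = (0, 0) /\ (fam pq A B wq :^ s)%G = six w0q i.
Proof.
move=> w0P; case: A.
  exists 1%g; exists (if B then inord 0 else inord 1); rewrite perm1; split=> //.
  have -> : (fam pq true B wq :^ 1)%G = fam pq true B wq by apply/val_inj; rewrite /= conjsg1.
  by case: B; rewrite /six inordK //; apply: fam_true.
have [e e0 we] : exists2 e : 'F_q, (w != 1 -> e != 0) & w = pw w0 e.
  have [i wi] := prim_rootP w0P wq; exists (i : nat)%:R; last by rewrite pwn.
  by apply: contraNneq => i0; rewrite wi -(pwn (q := q)) // i0 pw0.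
have [w1|w1] := eqVneq w 1.
  exists 1%g; exists (if B then inord 3 else inord 5); rewrite perm1; split=> //.
  have -> : (fam pq false B wq :^ 1)%G = fam pq false B wq by apply/val_inj; rewrite /= conjsg1.
  have o u v (uq : u ^+ q = 1) (vq : v ^+ q = 1) : u = v -> fam pq false B uq = fam pq false B vq.
    by move=> uv; apply/val_inj; rewrite /= uv.
  by case: B o => o; rewrite /six inordK //; apply: o.
have {}e0 := e0 w1; have [s sE] := scale_exists e0.
exists s; exists (if B then inord 2 else inord 4); split; first by rewrite sE !mulr0 !addr0.
apply/val_inj; rewrite /= (fam_conj_scale _ _ _ w0q sE) //.
by case: B; rewrite /six inordK.
Qed.

Lemma nonabelian_params (N : {group {perm T}}) u mu a al :
  regular N -> presented N u mu a al -> u ^+ q = 1 -> mu ^+ q = 1 -> a ^+ q = 1 ->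
  mu = 1 \/ a = 1 -> al = 0 \/ (u != mu /\ u != a) ->
  is_sdprod_cyclic p q N -> (mu, a) != (1, 1).
Proof.
move=> rN pN uq muq aq ma va sN; apply/eqP => e; have [m1 a1] := pair_inj e.
have [M [_ MN _ cM _]] := presented_exists pp pq qp uq muq aq ma va.
rewrite (MN _ rN pN) in sN.
exact: (cyclic_not_sdprod (prime_gt1 pq) (cM m1 a1) sN).
Qed.

Lemma biaffine_six (D N : {group {perm T}}) (w0 : 'F_p) (w0q : w0 ^+ q = 1) :
  q.-primitive_root w0 ->
  (forall z w, exists2 h, h \in D & h z = w) ->
  (forall h, h \in D -> exists u v c d, biaffine h u v c d) ->
  regular N -> D \subset 'N(N)%g -> is_sdprod_cyclic p q N ->
  exists (s : {perm T}) (i : 'I_6), s (0, 0) = (0, 0) /\ (D :^ s)%G = six w0q i.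
Proof.
move=> w0P trD afD rN nN sN.
have [t Dt tE] := trans_t pq pp pE trD afD.
have [w [g [Dg gE wq]]] := trans_g q3 pq pp pE trD afD.
have [mu [a [al [muq aq ma va pN]]]] := regular_presented pp pq qp rN
  (subsetP nN _ Dt) (subsetP nN _ Dg) tE gE wq.
have ma1 := nonabelian_params rN pN wq muq aq ma va sN.
have c1 := trans_c1 pq rN nN pN muq aq ma ma1.
have afD1 h : h \in D -> exists u v d, affine h u (fun=> v) d.
  move=> Dh; have [u [v [c [d hE]]]] := afD h Dh; exists u, v, d.
  by apply/affine_biaffine; rewrite -(c1 _ _ _ _ _ Dh hE).
have [A [B ->]] := classify_family q3 pq pp pE Dt Dg wq tE gE afD1.
exact: fam_six.
Qed.

(** A map that normalises the translations in each of the two directions is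
    affine in each coordinate. *)
Lemma biaffine_of_conj (t e h : {perm T}) k l :
  biaffine t 1 1 1 0 -> biaffine e 1 0 1 1 ->
  (t ^ h = t ^+ k)%g -> (e ^ h = e ^+ l)%g -> exists u v c d, biaffine h u v c d.
Proof.
move=> tE eE th eh.
have tX i x y : (t ^+ i)%g (x, y) = (x + i%:R, y).
  elim: i => [|i IHi]; first by rewrite expg0 perm1 addr0.
  by rewrite expgSr permM IHi tE -natr1 !mul1r addrA addr0.
have eX i x y : (e ^+ i)%g (x, y) = (x, y + i%:R).
  elim: i => [|i IHi]; first by rewrite expg0 perm1 addr0.
  by rewrite expgSr permM IHi eE -natr1 !mul1r addrA addr0.
have hx x y : h (x + 1, y) = ((h (x, y)).1 + k%:R, (h (x, y)).2).
  have := congr1 (fun r : {perm T} => r (x, y)) (conjgC t h).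
  rewrite th !permM tE !mul1r addr0 => ->; case: (h _) => a b; exact: tX.
have hy x y : h (x, y + 1) = ((h (x, y)).1, (h (x, y)).2 + l%:R).
  have := congr1 (fun r : {perm T} => r (x, y)) (conjgC e h).
  rewrite eh !permM eE !mul1r addr0 => ->; case: (h _) => a b; exact: eX.
exists k%:R, (h (0, 0)).1, l%:R, (h (0, 0)).2.
have h0 y : h (0, y) = ((h (0, 0)).1, l%:R * y + (h (0, 0)).2).
  elim/(@Fq_ind q): y => [|y IHy]; first by rewrite mulr0 add0r -surjective_pairing.
  by rewrite hy IHy /=; congr (_, _); ring.
move=> x y; elim/(@Fq_ind p): x => [|x IHx]; first by rewrite h0 mulr0 add0r.
by rewrite hx IHx /=; congr (_, _); ring.
Qed.

Lemma regular_conj (S : finType) (N : {group {perm S}}) (s : {perm S}) :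
  regular N -> regular (N :^ s)%G.
Proof.
move=> [tr fr]; split=> [z w|n z].
  have [n Nn e] := tr (s^-1%g z) (s^-1%g w); exists (n ^ s)%g; first by rewrite memJ_conjg.
  by rewrite conjgE !permM e permKV.
rewrite /= mem_conjg => Nn nz; apply: (conjg_inj s^-1%g); rewrite conj1g.
by apply: (fr _ (s^-1%g z) Nn); rewrite conjgE invgK !permM permKV nz.
Qed.

Lemma sdprod_cyclic_isog m n (gT hT : finGroupType) (G : {group gT}) (H : {group hT}) :
  G \isog H -> is_sdprod_cyclic m n G -> is_sdprod_cyclic m n H.
Proof.
case/isogP => f injf fG [A [B [defG [cA oA] [cB oB] CB]]].
have [_ defAB _ _] := sdprodP defG.
have sAG : A \subset G by rewrite -defAB mulG_subl.
have sBG : B \subset G by rewrite -defAB mulG_subr.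
exists (f @* A)%G, (f @* B)%G; split.
- by rewrite -fG; apply: injm_sdprod.
- by split; rewrite ?morphim_cyclic // card_injm.
- by split; rewrite ?morphim_cyclic // card_injm.
- by rewrite -injm_subcent // CB morphim1.
Qed.

Lemma cyclic_isog n (gT hT : finGroupType) (G : {group gT}) (H : {group hT}) :
  G \isog H -> is_cyclic n G -> is_cyclic n H.
Proof. by move=> GH [cG oG]; split; rewrite -?(isog_cyclic GH) -?(card_isog GH). Qed.

Lemma expg_FpD (gT : finGroupType) (a : gT) r (x y : 'F_r) :
  prime r -> #[a]%g = r -> (a ^+ (x + y)%R = a ^+ x * a ^+ y)%g.
Proof.
move=> pr oa; have aux n : (a ^+ (n %% r) = a ^+ n)%g by rewrite -oa expg_mod_order.
rewrite -expgD -[x in LHS]natr_Zp -[y in LHS]natr_Zp -natrD val_Fp_nat // aux.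
Qed.

(** The orbit map of [N0] at [z0] is a bijection with the plane under which [N0]
    becomes the group of translations; it has unique subgroups of orders [p] and
    [q], which [D] normalises too.  So [D] consists of maps affine in both
    coordinates, and [N1] gives the rest. *)
Lemma common_normaliser (D N0 N1 : {group {perm T}}) (z0 : T) (w0 : 'F_p) (w0q : w0 ^+ q = 1) :
  q.-primitive_root w0 ->
  (forall z w, exists2 h, h \in D & h z = w) ->
  regular N0 -> D \subset 'N(N0)%g -> is_cyclic (p * q) N0 ->
  regular N1 -> D \subset 'N(N1)%g -> is_sdprod_cyclic p q N1 ->
  exists (s : {perm T}) (i : 'I_6), s z0 = (0, 0) /\ (D :^ s)%G = six w0q i.
Proof.
move=> w0P trD rN0 nN0 [cN0 oN0] rN1 nN1 sN1.
have [n0 dN0] := cyclicP cN0.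
have on : #[n0]%g = (p * q)%N by rewrite orderE -dN0.
have p0 := prime_gt0 pp; have q0 := prime_gt0 pq.
pose al := (n0 ^+ q)%g; pose be := (n0 ^+ p)%g.
have oal : #[al]%g = p by rewrite orderXdiv on ?mulnK ?dvdn_mull.
have obe : #[be]%g = q by rewrite orderXdiv on ?mulKn ?dvdn_mulr.
have Nal : al \in N0 by rewrite dN0 mem_cycle.
have Nbe : be \in N0 by rewrite dN0 mem_cycle.
have com : commute al be by apply: commuteX2.
have ti : (<[al]> :&: <[be]> = 1)%g.
  by rewrite coprime_TIg // -!orderE oal obe prime_coprime // dvdn_prime2 // neq_ltn qp orbT.
pose phi (z : T) : T := (al ^+ z.1 * be ^+ z.2)%g z0.
have phiI : injective phi.
  move=> [x y] [x' y'] e0.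
  have Nab i j : (al ^+ i * be ^+ j)%g \in N0 by apply: groupM; apply: groupX.
  have e : (al ^+ x * be ^+ y = al ^+ x' * be ^+ y')%g := regular_inj rN0 (Nab _ _) (Nab _ _) e0.
  have e1 : (al ^- x' * al ^+ x = be ^+ y' * be ^- y)%g.
    by apply: (mulgI (al ^+ x')%g); rewrite mulKVg mulgA -e mulgK.
  have e2 : (al ^- x' * al ^+ x)%g = 1%g.
    apply/set1gP; rewrite -ti inE groupM ?groupV ?mem_cycle //=.
    by rewrite e1 groupM ?groupV ?mem_cycle.
  have ex : x = x'.
    apply/val_inj/eqP; have := e2 => /(canRL (mulKVg _)); rewrite mulg1 => /eqP.
    by rewrite eq_expg_mod_order oal !modn_small // -[X in (_ < X)%N](Fp_cast pp).
  have ey : y = y'.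
    apply/val_inj/eqP; have := e; rewrite ex => /mulgI/eqP.
    by rewrite eq_expg_mod_order obe !modn_small // -[X in (_ < X)%N](Fp_cast pq).
  by rewrite ex ey.
pose s := ((perm phiI)^-1)%g.
have sV z : s^-1%g z = (al ^+ z.1 * be ^+ z.2)%g z0 by rewrite /s invgK permE.
have sz0 : s z0 = (0, 0).
  by apply: (canLR (permKV s)); rewrite sV /= mulg1 perm1.
have sVp x y : s^-1%g (x, y) = (al ^+ x * be ^+ y)%g z0 by rewrite sV.
have one r : prime r -> nat_of_ord (1 : 'F_r) = 1%N.
  by move=> pr; rewrite (val_Fp_nat pr 1) modn_small ?prime_gt1.
have alE : biaffine (al ^ s)%g 1 1 1 0.
  move=> x y; rewrite conjgE !permM sVp !mul1r addr0; apply: (canLR (permKV s)).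
  have com' : (al * (al ^+ x * be ^+ y) = al ^+ x * be ^+ y * al)%g.
    by rewrite -[RHS]mulgA -(commuteX y com) !mulgA -expgS expgSr.
  by rewrite sVp [x + 1]addrC (expg_FpD _ _ pp oal) one // expg1 -mulgA com' !permM.
have beE : biaffine (be ^ s)%g 1 0 1 1.
  move=> x y; rewrite conjgE !permM sVp !mul1r addr0; apply: (canLR (permKV s)).
  by rewrite sVp (expg_FpD _ _ pq obe) one // expg1 mulgA !permM.
pose D' := (D :^ s)%G.
have [s' [i [s'0 eD]]] : exists (s' : {perm T}) (i : 'I_6), s' (0, 0) = (0, 0) /\ (D' :^ s')%G = six w0q i.
  apply: (@biaffine_six _ (N1 :^ s)%G) => //.
  - move=> z w; have [h Dh e] := trD (s^-1%g z) (s^-1%g w).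
    by exists (h ^ s)%g; rewrite ?memJ_conjg // conjgE !permM e permKV.
  - move=> h; rewrite /= mem_conjg => Dh.
    have norm x : x \in N0 -> (x ^ (h ^ s^-1) \in <[x]>)%g.
      move=> Nx; have : (<[x]> \char N0)%g by rewrite sub_cyclic_char // cycle_subG.
      move/char_norm_trans/(_ nN0)/subsetP/(_ _ Dh); rewrite inE => /subsetP; apply.
      by rewrite memJ_conjg cycle_id.
    have conj x k : (x ^ (h ^ s^-1) = x ^+ k -> (x ^ s) ^ h = (x ^ s) ^+ k)%g.
      by move=> xk; rewrite -conjXg -xk -!conjgM [(h ^ _)%g]conjgE invgK -!mulgA mulVg mulg1.
    have /cycleP[k ak] := norm _ Nal; have /cycleP[l bl] := norm _ Nbe.
    exact: (biaffine_of_conj alE beE (conj _ _ ak) (conj _ _ bl)).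
  - exact: regular_conj.
  - by rewrite normJ conjSg.
  exact: sdprod_cyclic_isog (conj_isog _ _) sN1.
exists (s * s')%g, i; split; first by rewrite permM sz0.
by rewrite -eD; apply/val_inj; rewrite /= conjsgM.
Qed.
End Six.

(** * Point stabilisers, orders and complements *)

Section PermGroup.
Variables (T : finType) (z0 : T) (n : nat) (G : {group {perm T}}).
Hypothesis cT : #|T| = n.
Hypothesis trG : forall z w, exists2 h, h \in G & h z = w.

Definition point_stab : {group {perm T}} := 'C_G[z0 | 'P]%G.

Lemma mem_point_stab h : (h \in point_stab) = (h \in G) && (h z0 == z0).
Proof. by rewrite inE; congr (_ && _); apply/astab1P/eqP. Qed.

Fact point_stab_sub : point_stab \subset G.
Proof. exact: subsetIl. Qed.

Fact point_stab_index : #|G : point_stab|%g = n.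
Proof.
rewrite -cT -(card_orbit 'P G z0); apply: eq_card => z; rewrite inE.
by apply/orbitP; have [h Gh <-] := trG z0 z; exists h.
Qed.

Fact point_stab_core : gcore point_stab G = 1%g.
Proof.
apply/trivgP/subsetP => x /bigcapP cx; apply/set1gP/permP => z; rewrite perm1.
have [h Gh <-] := trG z0 z; have := cx h Gh; rewrite mem_conjg mem_point_stab.
case/andP=> _ /eqP e; apply: (@perm_inj _ h^-1%g).
by rewrite permK -[RHS]e conjgE invgK !permM.
Qed.

Definition pg_of : perm_group n :=
  PermGroup point_stab_sub point_stab_index point_stab_core.
End PermGroup.

Section Structures.
Variables (p q : nat).
Hypotheses (q3 : (3 <= q)%N) (pq : prime q) (pp : prime p) (pE : p = (2 * q + 1)%N).
Local Notation T := ('F_p * 'F_q)%type.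
Let qp : (q < p)%N := q_lt_p pE.

Lemma fam_trans A B (w : 'F_p) (wq : w ^+ q = 1) z1 z2 :
  exists2 h, h \in fam pq A B wq & h z1 = z2.
Proof.
suff tr0 z : exists2 h, h \in fam pq A B wq & h (0, 0) = z.
  have [h Fh <-] := tr0 z1; have [k Fk <-] := tr0 z2.
  by exists (h^-1 * k)%g; rewrite ?groupM ?groupV // permM permK.
case: z => v d; have [h hE] := @affine_exists p q (pw w d) (fun=> v) d (pw_neq0 pq d wq).
exists h; last by rewrite hE mulr0 !add0r.
by rewrite (mem_fam _ _ _ hE) /fam_cond divff ?pw_neq0 // expr1n pw_unit // !eqxx !orbT.
Qed.

Definition multipliers (A B : bool) : {set 'F_p} :=
  [set u : 'F_p | [&& u != 0, A || (u ^+ 2 == 1) & B || (u ^+ q == 1)]].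

(** [m w^d], [v] and [d] are free, for [m] a multiplier at [d = 0]. *)
Lemma card_fam A B (w : 'F_p) (wq : w ^+ q = 1) :
  #|fam pq A B wq| = (p * q * #|multipliers A B|)%N.
Proof.
have /fin_all_exists[f fP] : forall x : 'F_p * 'F_p * 'F_q, exists h : {perm T},
    x.1.1 != 0 -> affine h (x.1.1 * pw w x.2) (fun=> x.1.2) x.2.
  move=> x; have [x0|x0] := eqVneq x.1.1 0; first by exists 1%g.
  by have [h hE] := @affine_exists p q (x.1.1 * pw w x.2) (fun=> x.1.2) x.2
    (mulf_neq0 x0 (pw_neq0 pq _ wq)); exists h.
pose X := [set x : 'F_p * 'F_p * 'F_q | x.1.1 \in multipliers A B].
have fI : {in X &, injective f}.
  move=> [[u v] d] [[u' v'] d']; rewrite !inE /= => /andP[u0 _] /andP[u0' _] e.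
  have := fP (u, v, d) u0; rewrite e => h1.
  have [/= e1 /(_ 0) e2 e3] := affine_uniq h1 (fP (u', v', d') u0').
  by move: e1 e2; rewrite /= e3 => /(mulIf (pw_neq0 pq d' wq)) -> ->.
have -> : fam pq A B wq = f @: X :> {set _}.
  apply/setP => h; apply/idP/imsetP => [Fh|[[[u v] d]]].
    have /fam_setP[u [v [d [hE c]]]] := Fh; have u0 := affine_neq0 hE.
    have w0 := pw_neq0 pq d wq.
    have x0 : u / pw w d != 0 by rewrite mulf_neq0 ?invr_neq0.
    exists (u / pw w d, v, d).
      by rewrite !inE /= x0; move: c; rewrite /fam_cond [(u / _) ^+ q]exprMn exprVn pw_unit // invr1 mulr1.
    by have := fP (u / pw w d, v, d) x0; rewrite /= divfK // => hE'; apply: (affine_eq hE hE').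
  rewrite in_set /= => Xu ->; have /and3P[u0 c1 c2] : [&& u != 0, A || (u ^+ 2 == 1) & B || (u ^+ q == 1)].
    by move: Xu; rewrite inE.
  have hE := fP (u, v, d) u0.
  rewrite (mem_fam _ _ _ hE) /fam_cond /= mulfK ?pw_neq0 // c1 /=.
  by rewrite exprMn pw_unit // mulr1.
rewrite card_in_imset //.
have -> : X = setX (setX (multipliers A B) [set: 'F_p]) [set: 'F_q].
  by apply/setP => -[[u v] d]; rewrite !inE !andbT.
by rewrite !cardsX !cardsT !card_Fp // [RHS]mulnC mulnA.
Qed.

Lemma card_multipliers :
  [/\ #|multipliers true true| = (2 * q)%N, #|multipliers true false| = q,
      #|multipliers false true| = 2%N & #|multipliers false false| = 1%N].
Proof.
have q0 := prime_gt0 pq.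
split.
- transitivity #|predC1 (0 : 'F_p)|; last by rewrite cardC1 card_Fp // pE addn1.
  by apply: eq_card => u; rewrite !inE andbT.
- have [w wP] := exists_primitive pq pp pE; rewrite -[RHS](card_roots wP).
  apply: eq_card => u; rewrite !inE /= andb_idl // => /eqP uq.
  exact: (root1_neq0 pq uq).
- rewrite -[RHS](_ : #|[set 1; -1 : 'F_p]| = 2%N); last first.
    by rewrite cards2 eq_sym (N1_neq1 q3 pp pE).
  apply: eq_card => u; rewrite !inE /= andbT sqrf_eq1 andb_idl //.
  by case/orP=> /eqP->; rewrite ?oppr_eq0 oner_eq0.
rewrite -[RHS](cards1 (1 : 'F_p)); apply: eq_card => u; rewrite !inE /=.
apply/and3P/eqP => [[_ /eqP u2 /eqP uq]|->]; last by rewrite !expr1n oner_eq0.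
exact: (odd_root q3 pq).
Qed.

Lemma fam_sub A B (w : 'F_p) (wq : w ^+ q = 1) : fam pq false false wq \subset fam pq A B wq.
Proof.
apply/subsetP => h /fam_setP[u [v [d [hE /andP[/= c1 c2]]]]].
by rewrite (mem_fam _ _ _ hE) /fam_cond c1 c2 !orbT.
Qed.

Lemma fam_ff_mul (w u : 'F_p) (wq : w ^+ q = 1) (d : 'F_q) : u != 0 ->
  fam_cond false false w u d -> u = pw w d.
Proof.
move=> u0 /andP[/= /eqP c1 /eqP c2]; have w0 := pw_neq0 pq d wq.
apply: (mulIf (invr_neq0 w0)); rewrite divff //.
by apply: (odd_root q3 pq); rewrite // exprMn exprVn c2 pw_unit // invr1 mulr1.
Qed.

(** The maps [(w^d x + v, y + d)] form a regular subgroup, normal in every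
    affine group containing it, because conjugation preserves multipliers and
    shifts. *)
Lemma fam_complement A B (w : 'F_p) (wq : w ^+ q = 1) :
  (fam pq false false wq ><| point_stab (0, 0) (fam pq A B wq) = fam pq A B wq)%g.
Proof.
set G := fam pq A B wq; set C := fam pq false false wq; set S := point_stab _ G.
have nC : G \subset 'N(C)%g.
  apply/subsetP => h /fam_setP[u [v [d [hE _]]]]; rewrite inE; apply/subsetP => _ /imsetP[c Cc ->].
  have /fam_setP[u' [v' [d' [cE cc]]]] := Cc; have u0 := affine_neq0 hE.
  suff cE' : affine (c ^ h)%g u' (fun=> u * v' + v - u' * v) d' by rewrite (mem_fam _ _ _ cE').
  move=> x y; rewrite conjgE !permM; case ez : (h^-1%g (x, y)) => [a b].
  have : h (a, b) = (x, y) by rewrite -ez permKV.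
  by rewrite hE => e; have [<- <-] := pair_inj e; rewrite cE hE; congr (_, _); ring.
have nS : S \subset 'N(C)%g := subset_trans (point_stab_sub _ _) nC.
have ti : C :&: S = 1%g.
  apply/trivgP/subsetP => c /setIP[Cc]; rewrite (mem_point_stab (0, 0) G c) => /andP[_ /eqP c0].
  have /fam_setP[u [v [d [cE cc]]]] := Cc; have u0 := affine_neq0 cE.
  have := cE 0 0; rewrite c0 mulr0 !add0r => e; have [v0 d0] := pair_inj e.
  have u1 : u = 1 by rewrite (fam_ff_mul wq u0 cc) -d0 pw0.
  have cE1 : affine c 1 (fun=> v) 0 by move=> x y; rewrite cE u1 -d0.
  by apply/set1gP; apply: (affine_eq cE1 (@affine1 p q)) => y; rewrite -v0.
rewrite sdprodE // -(normC nS); apply/eqP; rewrite eqEsubset; apply/andP; split.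
  by apply: mul_subG; [apply: point_stab_sub | apply: fam_sub].
apply/subsetP => h Gh.
have [c Cc e] := fam_trans false false wq (0, 0) (h (0, 0)).
rewrite -(mulgKV c h); apply: mem_mulg => //.
rewrite (mem_point_stab (0, 0) G) permM -e permK eqxx andbT groupM ?groupV //.
by apply: (subsetP (fam_sub _ _ _)).
Qed.
End Structures.

(** * Structure of the six groups *)

Section Structures.
Variables (p q : nat).
Hypotheses (q3 : (3 <= q)%N) (pq : prime q) (pp : prime p) (pE : p = (2 * q + 1)%N).
Local Notation T := ('F_p * 'F_q)%type.
Let qp : (q < p)%N := q_lt_p pE.

(** [r] has the order of its multiplier [z], and acts on the cycle of [t]
    through [z], hence faithfully. *)
Lemma split_pair (t r : {perm T}) (z : 'F_p) (de : 'F_q) n :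
  affine t 1 (fun=> 1) 0 -> affine r z (fun=> 0) de -> n.-primitive_root z ->
  n%:R * de = 0 -> coprime p n ->
  [/\ (<[t]> ><| <[r]> = <[t]> <*> <[r]>)%g, #[t]%g = p, #[r]%g = n & 'C_<[r]>(<[t]>)%g = 1%g].
Proof.
move=> tE rE zP nde co.
have rX k : affine (r ^+ k)%g (z ^+ k) (fun=> 0) (k%:R * de) by apply: affine_scaleX.
have tX k : affine (t ^+ k)%g 1 (fun=> k%:R * 1) 0 by apply: (affine_transX k tE).
have ot : #[t]%g = p.
  have : (#[t]%g %| p)%N.
    rewrite order_dvdn; apply/eqP; apply: (affine_eq (tX p) (@affine1 p q)) => y.
    by rewrite Fp_char // mul0r.
  move=> /(primeP pp).2/orP[|/eqP//]; rewrite order_eq1 => /eqP t1.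
  have := tE 0 0; rewrite t1 perm1 => e; have [/eqP] := pair_inj e.
  by rewrite mul1r add0r eq_sym oner_eq0.
have or_ : #[r]%g = n.
  apply/eqP; rewrite eqn_dvd; apply/andP; split.
    rewrite order_dvdn; apply/eqP/(affine_eq (rX n)); last by move=> y; exact: erefl.
    by rewrite (prim_expr_order zP) nde; apply: affine1.
  rewrite (prim_order_dvd zP); have := rX #[r]%g; rewrite expg_order => h.
  by have [-> _ _] := affine_uniq h (@affine1 p q).
have tr : (t ^ r = t ^+ z)%g.
  apply: (mulgI r); rewrite -conjgC; apply/permP => -[x y].
  by rewrite !permM tE rE rE tX natr_Zp; congr (_, _); ring.
have nTR : <[r]>%g \subset 'N(<[t]>)%g.
  by rewrite cycle_subG inE -cycleJ tr cycle_subG mem_cycle.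
have ti : <[t]>%g :&: <[r]>%g = 1%g by rewrite coprime_TIg // -!orderE ot or_.
split=> //; first by rewrite sdprodE // norm_joinEr.
apply/trivgP/subsetP => x /setIP[/cycleP[k ->] /centP/(_ t (cycle_id _)) com].
have := congr1 (fun h : {perm T} => h (0, 0)) com.
rewrite !permM rX tE tE rX => e; have [+ _] := pair_inj e.
rewrite !mulr0 !mul1r !add0r mulr1 !addr0 => /esym/eqP zk.
have nk : (n %| k)%N by rewrite (prim_order_dvd zP).
by apply/set1gP/eqP; rewrite -order_dvdn or_.
Qed.

Lemma split_pair_sdprod (t r : {perm T}) (z : 'F_p) (de : 'F_q) n :
  affine t 1 (fun=> 1) 0 -> affine r z (fun=> 0) de -> n.-primitive_root z ->
  n%:R * de = 0 -> coprime p n -> is_sdprod_cyclic p n (<[t]> <*> <[r]>)%G.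
Proof.
move=> tE rE zP nde co; have [sd ot or_ C1] := split_pair tE rE zP nde co.
by exists <[t]>%G, <[r]>%G; split=> //; split; rewrite ?cycle_cyclic.
Qed.

Lemma card_split_pair (t r : {perm T}) (z : 'F_p) (de : 'F_q) n :
  affine t 1 (fun=> 1) 0 -> affine r z (fun=> 0) de -> n.-primitive_root z ->
  n%:R * de = 0 -> coprime p n -> #|<[t]> <*> <[r]>|%g = (p * n)%N.
Proof.
move=> tE rE zP nde co; have [sd ot or_ C1] := split_pair tE rE zP nde co.
by rewrite -(sdprod_card sd) -!orderE ot or_.
Qed.

(** The shift [e = (x, y + 1)] commutes with maps that involve only the first
    coordinate. *)
Lemma split_shift (t r e : {perm T}) (z : 'F_p) n :
  affine t 1 (fun=> 1) 0 -> affine r z (fun=> 0) 0 -> affine e 1 (fun=> 0) 1 ->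
  n.-primitive_root z -> coprime p n ->
  #[e]%g = q /\ (<[e]> \x (<[t]> <*> <[r]>) = <[e]> <*> (<[t]> <*> <[r]>))%g.
Proof.
move=> tE rE eE zP co.
have nde : n%:R * 0 = 0 :> 'F_q by rewrite mulr0.
have [sd ot or_ _] := split_pair tE rE zP nde co.
have eX k : affine (e ^+ k)%g 1 (fun=> 0) k%:R.
  by have := affine_scaleX k eE; rewrite expr1n mulr1.
have oe : #[e]%g = q.
  have : (#[e]%g %| q)%N.
    rewrite order_dvdn; apply/eqP/(affine_eq (eX q)); last by move=> y; exact: erefl.
    by rewrite Fq_char //; apply: affine1.
  move=> /(primeP pq).2/orP[|/eqP//]; rewrite order_eq1 => /eqP e1.
  have := eE 0 0; rewrite e1 perm1 => h; have [_ /eqP] := pair_inj h.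
  by rewrite add0r eq_sym oner_eq0.
split=> //; rewrite dprodEY //.
  rewrite join_subG !cycle_subG; apply/andP; split; apply/centP => x /cycleP[k ->].
    apply: commuteX; apply/permP => -[x' y]; rewrite !permM tE eE eE tE; congr (_, _); ring.
  apply: commuteX; apply/permP => -[x' y]; rewrite !permM rE eE eE rE; congr (_, _); ring.
have [_ TR _ _] := sdprodP sd.
apply/trivgP/subsetP => x /setIP[/cycleP[k ->]]; rewrite /= -TR.
case/mulsgP => a b /cycleP[i ->] /cycleP[j ->] h.
have hX := affineM (affine_transX i tE) (affine_scaleX j rE).
rewrite -h in hX; have [_ _ k0] := affine_uniq (eX k) hX.
apply/set1gP/(affine_eq (eX k)); last by move=> y; exact: erefl.
by rewrite k0 mulr0 addr0; apply: affine1.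
Qed.

Lemma coprime_p2q : coprime p (2 * q).
Proof. by rewrite pE addn1 coprimeSn. Qed.

(** -1 has order 2 and [w] has odd order [q]. *)
Lemma opp_primitive (w : 'F_p) : q.-primitive_root w -> (2 * q).-primitive_root (- w).
Proof.
move=> wP; have wq := prim_expr_order wP.
have wq' : (- w) ^+ q = -1 by rewrite exprNn wq (expN1q p q3 pq) mulr1.
have q0 : (0 < 2 * q)%N by rewrite muln_gt0 (prime_gt0 pq).
have w2q : (- w) ^+ (2 * q) = 1 by rewrite mulnC exprM wq' sqrrN expr1n.
have [m mP m2q] := prim_order_exists q0 w2q.
have mq : ~~ (m %| q)%N by rewrite (prim_order_dvd mP) wq' (N1_neq1 q3 pp pE).
have m2 : ~~ (m %| 2)%N.
  rewrite (prim_order_dvd mP) sqrrN -(prim_order_dvd wP); apply/negP => /dvdn_leq.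
  by move/(_ isT); rewrite leqNgt q3.
suff <- : m = (2 * q)%N by [].
apply/eqP; rewrite eqn_dvd m2q /= Gauss_dvd ?coprime2n ?(odd_q q3 pq) //.
apply/andP; split; apply: contraT.
  by rewrite -prime_coprime // coprime_sym => cm; rewrite Gauss_dvdr // (negPf mq) in m2q.
by rewrite -prime_coprime // coprime_sym => cm; rewrite Gauss_dvdl // (negPf m2) in m2q.
Qed.

Lemma fam_mem A B (v : 'F_p) (vq : v ^+ q = 1) h u b d :
  affine h u (fun=> b) d -> fam_cond A B v u d -> h \in fam pq A B vq.
Proof. by move=> hE c; apply/fam_setP; exists u, b, d. Qed.

Section SixRows.
Variables (w : 'F_p) (wP : q.-primitive_root w) (wq : w ^+ q = 1).
Local Notation G := (six pq wq).

Lemma six_card : [/\ #|G 0| = (2 * p * q ^ 2)%N, #|G 1| = (p * q ^ 2)%N, #|G 2| = (2 * p * q)%N,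
  #|G 3| = (2 * p * q)%N & #|G 4| = (p * q)%N /\ #|G 5| = (p * q)%N].
Proof.
have [m11 m10 m01 m00] := card_multipliers q3 pq pp pE.
split; last split.
- by rewrite [LHS](card_fam pq pp true true) m11 mulnACA mulnn [(p * 2)%N]mulnC.
- by rewrite [LHS](card_fam pq pp true false) m10 -mulnA mulnn.
- by rewrite [LHS](card_fam pq pp false true) m01 mulnC mulnA.
- by rewrite [LHS](card_fam pq pp false true) m01 mulnC mulnA.
- by rewrite [LHS](card_fam pq pp false false) m00 muln1.
- by rewrite [LHS](card_fam pq pp false false) m00 muln1.
Qed.

(** Each group is generated by [t] together with the shift [e], with a map [r =
    (z x, y + d)] whose [z] is a primitive root of order [2q], [q] or 2, or with
    both; comparing orders shows that these generate. *)
Lemma six_structures :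
  [/\ is_dprod (is_cyclic q) (is_sdprod_cyclic p (2 * q)) (G 0),
      is_dprod (is_cyclic q) (is_sdprod_cyclic p q) (G 1),
      is_sdprod_cyclic p (2 * q) (G 2),
      is_dprod (is_dihedral (2 * p)) (is_cyclic q) (G 3)
    & is_sdprod_cyclic p q (G 4) /\ is_cyclic (p * q) (G 5)].
Proof.
have [c0 c1 c2 c3 [c4 c5]] := six_card.
have [t tE] := @affine_exists p q 1 (fun=> 1) 0 (oner_neq0 _).
have [e eE] := @affine_exists p q 1 (fun=> 0) 1 (oner_neq0 _).
have w0 := root1_neq0 pq wq.
have nw0 : - w != 0 by rewrite oppr_eq0.
have n10 : -1 != 0 :> 'F_p by rewrite oppr_eq0 oner_eq0.
have nwP := opp_primitive wP.
have co2q := coprime_p2q; have := co2q; rewrite coprimeMr => /andP[co2 coq].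
have N1P : 2.-primitive_root (-1 : 'F_p).
  have e2 : (-1) ^+ 2 = 1 :> 'F_p by rewrite sqrrN expr1n.
  have [m mP m2] := prim_order_exists (isT : (0 < 2)%N) e2.
  have /orP[/eqP m1|/eqP <- //] := (primeP (isT : prime 2)).2 m m2.
  have := prim_expr_order mP; rewrite m1 expr1 => /eqP.
  by rewrite (N1_neq1 q3 pp pE).
have [r1 r1E] := @affine_exists p q (- w) (fun=> 0) 0 nw0.
have [r2 r2E] := @affine_exists p q w (fun=> 0) 0 w0.
have [r3 r3E] := @affine_exists p q (- w) (fun=> 0) 1 nw0.
have [r4 r4E] := @affine_exists p q (-1) (fun=> 0) 0 n10.
have [r5 r5E] := @affine_exists p q w (fun=> 0) 1 w0.
have ft A B (v : 'F_p) (vq : v ^+ q = 1) : t \in fam pq A B vq.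
  by apply: (fam_mem vq tE); rewrite /fam_cond pw0 divr1 !expr1n eqxx !orbT.
have fe A B (vq : 1 ^+ q = 1) : e \in fam pq A B vq.
  by apply: (fam_mem vq eE); rewrite /fam_cond pw_1 divr1 !expr1n eqxx !orbT.
have z0 n : n%:R * 0 = 0 :> 'F_q by rewrite mulr0.
have q0 : q%:R * 1 = 0 :> 'F_q by rewrite mulr1 Fq_char.
have q20 : (2 * q)%:R * 1 = 0 :> 'F_q by rewrite mulr1 natrM Fq_char // mulr0.
have eqG (H K : {group {perm T}}) : K \subset H -> #|H| = #|K| -> H = K.
  by move=> sKH cHK; apply/val_inj/eqP; rewrite eq_sym eqEcard sKH cHK leqnn.
have dpG (H : {group {perm T}}) r z n : affine r z (fun=> 0) 0 -> n.-primitive_root z -> coprime p n ->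
    t \in H -> e \in H -> r \in H -> #|H| = (q * (p * n))%N ->
    (<[e]> \x (<[t]> <*> <[r]>) = H)%g /\ #[e]%g = q.
  move=> rE zP co Ht He Hr cH; have [oe dp] := split_shift tE rE eE zP co.
  split=> //; rewrite dp; apply/esym; apply: (congr1 val); apply: eqG.
    by rewrite !join_subG !cycle_subG He Ht Hr.
  rewrite cH; have /= <- := dprod_card dp; rewrite -orderE oe.
  by rewrite (card_split_pair tE rE zP (z0 n) co).
have spG (H : {group {perm T}}) r z de n : affine r z (fun=> 0) de -> n.-primitive_root z ->
    n%:R * de = 0 -> coprime p n -> t \in H -> r \in H -> #|H| = (p * n)%N ->
    is_sdprod_cyclic p n H.
  move=> rE zP nde co Ht Hr cH.
  have -> : H = (<[t]> <*> <[r]>)%G.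
    by apply: eqG; rewrite ?join_subG ?cycle_subG ?Ht ?Hr //= cH (card_split_pair tE rE zP nde co).
  exact: (split_pair_sdprod tE rE zP nde co).
split.
- have r1G : r1 \in G 0 by apply: (fam_mem (expr1n _ q) r1E).
  have cG : #|G 0| = (q * (p * (2 * q)))%N.
    by rewrite c0 -mulnn [RHS]mulnA [RHS]mulnACA [(q * 2)%N]mulnC mulnACA.
  have [dp oe] := dpG (G 0) r1 (- w) (2 * q)%N r1E nwP co2q (ft _ _ _ _) (fe _ _ _) r1G cG.
  exists <[e]>%G, (<[t]> <*> <[r1]>)%G; split=> //; first by split; rewrite ?cycle_cyclic.
  exact: (split_pair_sdprod tE r1E nwP (z0 _) co2q).
- have r2G : r2 \in G 1 by apply: (fam_mem (expr1n _ q) r2E); rewrite /fam_cond /= wq.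
  have cG : #|G 1| = (q * (p * q))%N by rewrite c1 -mulnn mulnCA.
  have [dp oe] := dpG (G 1) r2 w q r2E wP coq (ft _ _ _ _) (fe _ _ _) r2G cG.
  exists <[e]>%G, (<[t]> <*> <[r2]>)%G; split=> //; first by split; rewrite ?cycle_cyclic.
  exact: (split_pair_sdprod tE r2E wP (z0 _) coq).
- have r3G : r3 \in G 2.
    by apply: (fam_mem wq r3E); rewrite /fam_cond /= pw1 // mulNr divff // sqrrN expr1n eqxx.
  apply: (spG (G 2) r3 _ _ _ r3E nwP q20 co2q (ft _ _ _ _) r3G).
  by rewrite c2 mulnCA mulnA.
- have r4G : r4 \in G 3.
    by apply: (fam_mem (expr1n _ q) r4E); rewrite /fam_cond /= pw_1 divr1 sqrrN expr1n eqxx.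
  have cG : #|G 3| = (q * (p * 2))%N by rewrite c3 mulnC [(p * 2)%N]mulnC.
  have [dp oe] := dpG (G 3) r4 (-1) 2 r4E N1P co2 (ft _ _ _ _) (fe _ _ _) r4G cG.
  exists (<[t]> <*> <[r4]>)%G, <[e]>%G; split.
  + by rewrite dprodC.
  + have [_ ot or_ _] := split_pair tE r4E N1P (z0 _) co2.
    have cD := card_split_pair tE r4E N1P (z0 _) co2.
    have yE : affine (r4 * t)%g (-1) (fun=> 1) 0.
      by move=> x y; rewrite permM r4E tE; congr (_, _); ring.
    have oy : #[r4 * t]%g = 2%N.
      have : (#[r4 * t]%g %| 2)%N.
        rewrite order_dvdn expgS expg1; apply/eqP/permP => -[x y].
        by rewrite perm1 permM !yE; congr (_, _); ring.
      move=> /(primeP (isT : prime 2)).2/orP[|/eqP//]; rewrite order_eq1 => /eqP y1.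
      rewrite y1 in yE; have [/eqP] := affine_uniq yE (@affine1 p q).
      by rewrite (N1_neq1 q3 pp pE).
    have xy : r4 != (r4 * t)%g.
      apply/eqP => h; rewrite -h in yE; have [_ /(_ 0)/esym/eqP] := affine_uniq r4E yE.
      by rewrite oner_eq0.
    have := involutions_gen_dihedral or_ oy xy.
    have -> : <<[set r4; (r4 * t)%g]>>%g = (<[t]> <*> <[r4]>)%g.
      apply/eqP; rewrite eqEsubset gen_subG join_subG !cycle_subG; apply/and3P; split.
      - have rJ : r4 \in (<[t]> <*> <[r4]>)%g by rewrite mem_gen // inE cycle_id orbT.
        have tJ : t \in (<[t]> <*> <[r4]>)%g by rewrite mem_gen // inE cycle_id.
        by apply/subsetP => x /set2P[] ->; rewrite ?groupM.
      - have rJ : r4 \in <<[set r4; (r4 * t)%g]>>%g by rewrite mem_gen // set21.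
        have yJ : (r4 * t)%g \in <<[set r4; (r4 * t)%g]>>%g by rewrite mem_gen // set22.
        by have := groupM (groupVr rJ) yJ; rewrite mulKg.
      by rewrite mem_gen // set21.
    by rewrite /= cD mulnC.
  by split; rewrite ?cycle_cyclic.
split.
  have r5G : r5 \in G 4.
    by apply: (fam_mem wq r5E); rewrite /fam_cond /= pw1 // divff // wq expr1n !eqxx.
  exact: (spG (G 4) r5 _ _ _ r5E wP q0 coq (ft _ _ _ _) r5G c4).
split=> //.
have [_ ot _ _] := split_pair tE r2E wP (z0 _) coq.
have [oe _] := split_shift tE r2E eE wP coq.
have cte : <[e]>%g \subset 'C(<[t]>)%g.
  rewrite cycle_subG; apply/centP => x /cycleP[k ->]; apply: commuteX.
  by apply/permP => -[x' y]; rewrite !permM tE eE eE tE; congr (_, _); ring.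
have co : coprime #|<[t]>%g| #|<[e]>%g| by rewrite -!orderE ot oe.
have -> : G 5 = (<[t]> <*> <[e]>)%G.
  apply: eqG; first by rewrite join_subG !cycle_subG (ft false false _ _) (fe false false).
  by rewrite c5 /= cent_joinEr // TI_cardMg ?coprime_TIg // -!orderE ot oe.
by rewrite /= cent_joinEr //; apply: cyclicM; rewrite ?cycle_cyclic.
Qed.
End SixRows.
End Structures.

(** * Enumerations and isomorphism classes *)

Section Counting.
Variables (p q : nat).
Hypotheses (q3 : (3 <= q)%N) (pq : prime q) (pp : prime p) (pE : p = (2 * q + 1)%N).
Local Notation T := ('F_p * 'F_q)%type.
Let qp : (q < p)%N := q_lt_p pE.

Definition enumerated (G : {group {perm T}}) (Q : group_prop) (k : nat) :=
  exists nu : 'I_k -> {group {perm T}},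
  [/\ forall i, [/\ regular (nu i), G \subset 'N(nu i)%g & Q _ (nu i)], injective nu
    & forall N : {group {perm T}}, regular N -> G \subset 'N(N)%g -> Q _ N -> exists i, N = nu i].

Lemma primitive_neq1 (w : 'F_p) : q.-primitive_root w -> w != 1.
Proof.
move=> wP; apply/eqP => w1; have := prim_order_dvd wP 1; rewrite w1 expr1n eqxx.
by rewrite dvdn1 => /eqP q1; have := q3; rewrite q1.
Qed.

(** [al] can be nonzero only if all multipliers are [w^d], which holds for [A =
    B = false]; otherwise a map with [d = 0] and multiplier a primitive root or
    -1 prevents it. *)
Lemma fam_enum A B (w w0 : 'F_p) (wq : w ^+ q = 1) : q.-primitive_root w0 ->
  enumerated (fam pq A B wq) (is_cyclic (p * q))
    (if (w != 1) && (~~ A && ~~ B) then p else 1%N) /\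
  enumerated (fam pq A B wq) (is_sdprod_cyclic p q)
    (if (w != 1) && (~~ A && ~~ B) then (2 * p * (q - 2) + 2)%N else (2 * (q - 1))%N).
Proof.
move=> w0P; set G := fam pq A B wq; set c := ~~ A && ~~ B.
have w00 := root1_neq0 pq (prim_expr_order w0P).
have [t tE] := @affine_exists p q 1 (fun=> 1) 0 (oner_neq0 _).
have [g gE] := @affine_exists p q w (fun=> 0) 1 (root1_neq0 pq wq).
have Gt : t \in G by apply: (fam_mem pq wq tE); rewrite /fam_cond pw0 divr1 !expr1n eqxx !orbT.
have Gg : g \in G.
  by apply: (fam_mem pq wq gE); rewrite /fam_cond pw1 // divff ?(root1_neq0 pq wq) // expr1n wq !eqxx !orbT.
have aff h : h \in G -> exists u' v d, affine h u' (fun=> v) d.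
  by move=> /fam_setP[u [v [d [hE _]]]]; exists u, v, d.
have cT : c -> forall h u' v d, h \in G -> affine h u' (fun=> v) d -> u' = pw w d.
  move=> /andP[/negPf A0 /negPf B0] h u v d Gh hE; have u0 := affine_neq0 hE.
  apply: (fam_ff_mul q3 pq wq u0).
  have : fam_cond A B w u d by rewrite -(mem_fam A B w hE).
  by rewrite /fam_cond A0 B0.
have cF : ~~ c -> exists h u' v d, [/\ h \in G, affine h u' (fun=> v) d & u' != pw w d].
  rewrite negb_and !negbK; have [A1 _|A0 /= B1] := boolP A.
    have [r rE] := @affine_exists p q w0 (fun=> 0) 0 w00.
    exists r, w0, 0, 0; rewrite pw0 (primitive_neq1 w0P); split=> //.
    by apply: (fam_mem pq wq rE); rewrite /fam_cond A1 (prim_expr_order w0P) eqxx orbT.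
  have n10 : -1 != 0 :> 'F_p by rewrite oppr_eq0 oner_eq0.
  have [r rE] := @affine_exists p q (-1) (fun=> 0) 0 n10.
  exists r, (-1), 0, 0; rewrite pw0 (N1_neq1 q3 pp pE); split=> //.
  by apply: (fam_mem pq wq rE); rewrite /fam_cond B1 pw0 divr1 sqrrN expr1n eqxx orbT.
have [nu [nuP nuI nuS]] := regulars_param pq pp pE Gt Gg tE gE wq aff cT cF.
have nuR x : x \in params q w c -> regular (nu x) /\ G \subset 'N(nu x)%g.
  by move=> /nuP[].
split.
  apply: (regulars_enum nuI nuR nuS (Y := [set x | x.1 == (1, 1)])); last first.
    exact: card_params_cyclic.
  move=> x Xx; have [_ _] := nuP x Xx; rewrite inE; case: eqP => // _ sN; split=> // cN.
  by case: (cyclic_not_sdprod (prime_gt1 pq) cN sN).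
apply: (regulars_enum nuI nuR nuS (Y := [set x | x.1 != (1, 1)])); last first.
  exact: (card_params_nonabelian pp c w0P wq).
move=> x Xx; have [_ _] := nuP x Xx; rewrite inE; case: eqP => // _ cN; split=> // sN.
by case: (cyclic_not_sdprod (prime_gt1 pq) cN sN).
Qed.

Section SixFacts.
Variables (w : 'F_p) (wP : q.-primitive_root w) (wq : w ^+ q = 1).
Local Notation G := (six pq wq).

Lemma six_enum (i : 'I_6) :
  enumerated (G i) (is_cyclic (p * q)) (if i == 4 :> nat then p else 1%N) /\
  enumerated (G i) (is_sdprod_cyclic p q)
    (if i == 4 :> nat then (2 * p * (q - 2) + 2)%N else (2 * (q - 1))%N).
Proof.
have w1 := primitive_neq1 wP.
have E A B (v : 'F_p) (vq : v ^+ q = 1) := fam_enum A B vq wP.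
case: i => -[|[|[|[|[|[|//]]]]]] /= _.
- by have := E true true _ (expr1n _ q); rewrite eqxx.
- by have := E true false _ (expr1n _ q); rewrite eqxx.
- by have := E false true _ wq; rewrite andbF.
- by have := E false true _ (expr1n _ q); rewrite eqxx.
- by have := E false false _ wq; rewrite w1.
- by have := E false false _ (expr1n _ q); rewrite eqxx.
Qed.

Lemma six_complement (i : 'I_6) :
  exists C : {group {perm T}}, (C ><| point_stab (0, 0) (G i) = G i)%g.
Proof.
have o : (1 : 'F_p) ^+ q = 1 := expr1n _ q.
case: i => -[|[|[|[|[|[|//]]]]]] /= _.
- by exists (fam pq false false o); apply: (fam_complement q3 pq true true o).
- by exists (fam pq false false o); apply: (fam_complement q3 pq true false o).
- by exists (fam pq false false wq); apply: (fam_complement q3 pq false true wq).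
- by exists (fam pq false false o); apply: (fam_complement q3 pq false true o).
- by exists (fam pq false false wq); apply: (fam_complement q3 pq false false wq).
- by exists (fam pq false false o); apply: (fam_complement q3 pq false false o).
Qed.

Lemma six_trans (i : nat) z1 z2 : exists2 h, h \in G i & h z1 = z2.
Proof.
case: i => [|[|[|[|[|i]]]]].
- exact: (fam_trans pq true true).
- exact: (fam_trans pq true false).
- exact: (fam_trans pq false true).
- exact: (fam_trans pq false true).
- exact: (fam_trans pq false false).
- exact: (fam_trans pq false false).
Qed.

(** Commuting with [t] and with [(- w x, y + 1)] leaves only translations [(x, y
    + d)], and in this group these have [(w^d)^2 = 1], hence [d = 0]. *)
Lemma center_six2 : 'Z(G 2)%g = 1%g.
Proof.
apply/trivgP/subsetP => x /centerP[Gx cx].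
have /fam_setP[u [v [d [xE c]]]] := Gx.
have [t tE] := @affine_exists p q 1 (fun=> 1) 0 (oner_neq0 _).
have nw0 : - w != 0 by rewrite oppr_eq0 (root1_neq0 pq wq).
have [r rE] := @affine_exists p q (- w) (fun=> 0) 1 nw0.
have Gt : t \in G 2.
  by apply: (fam_mem (A:=false) (B:=true) pq wq tE); rewrite /fam_cond pw0 divr1 !expr1n eqxx.
have Gr : r \in G 2.
  apply: (fam_mem (A:=false) (B:=true) pq wq rE).
  by rewrite /fam_cond /= pw1 // mulNr divff ?(root1_neq0 pq wq) // sqrrN expr1n eqxx.
have e1 := congr1 (fun s : {perm T} => s (0, 0)) (cx t Gt).
rewrite !permM tE xE tE xE in e1; have [f1 _] := pair_inj e1.
have u1 : u = 1.
  apply/eqP; rewrite -subr_eq0; apply/eqP.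
  transitivity ((u * (1 * 0 + 1) + v) - (1 * (u * 0 + v) + 1)); first by ring.
  by apply/eqP; rewrite subr_eq0 f1.
have e2 := congr1 (fun s : {perm T} => s (0, 0)) (cx r Gr).
rewrite !permM rE xE rE xE in e2; have [f2 _] := pair_inj e2.
have w1 : - w != 1.
  apply/eqP => h; have := prim_order_dvd (opp_primitive q3 pq pp pE wP) 1.
  by rewrite h expr1n eqxx dvdn1 muln_eq1.
have v0 : v = 0.
  have : (1 - - w) * v = 0.
    transitivity ((u * (- w * 0 + 0) + v) - (- w * (u * 0 + v) + 0)); first by ring.
    by apply/eqP; rewrite subr_eq0 f2.
  by move/eqP; rewrite mulf_eq0 subr_eq0 eq_sym (negPf w1) => /eqP.
have d0 : d = 0.
  have /andP[/= /eqP c2 _] := c.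
  apply: (pw_inj pq wq (primitive_neq1 wP)); rewrite pw0 -[LHS]invrK -[RHS]invr1; congr _^-1.
  apply: (odd_root q3 pq); last by rewrite exprVn pw_unit // invr1.
  by move: c2; rewrite u1 mul1r.
by apply/set1gP/(affine_eq xE); [rewrite u1 d0; apply: affine1 | move=> y; rewrite v0].
Qed.

(** The shift [(x, y + 1)] commutes with all maps [(u x + v, y + d)]. *)
Lemma center_six3 : 'Z(G 3)%g != 1%g.
Proof.
have [e eE] := @affine_exists p q 1 (fun=> 0) 1 (oner_neq0 _).
have Ze : e \in 'Z(G 3)%g.
  apply/centerP; split.
    by apply: (fam_mem (A:=false) (B:=true) pq (expr1n _ q) eE); rewrite /fam_cond pw_1 divr1 !expr1n eqxx.
  move=> h /fam_setP[u [v [d [hE _]]]]; apply/permP => -[x y].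
  by rewrite !permM eE hE hE eE; congr (_, _); ring.
apply: contraTneq Ze => ->; apply/negP => /set1gP e1.
have := eE 0 0; rewrite e1 perm1 => h; have [_ /eqP] := pair_inj h.
by rewrite add0r eq_sym oner_eq0.
Qed.

(** The orders leave two pairs to separate: one by the centres, the other
    because one group is cyclic. *)
Lemma six_isog_inj (i j : 'I_6) : G i \isog G j -> i = j.
Proof.
have [c0 c1 c2 c3 [c4 c5]] := six_card q3 pq pp pE wq.
have [_ _ _ _ [s4 s5]] := six_structures q3 pq pp pE wP wq.
pose m (k : nat) := nth 1%N [:: (2 * q)%N; q; 2%N; 2%N; 1%N; 1%N] k.
have cE (k : 'I_6) : #|G k| = (p * q * m k)%N.
  case: k => -[|[|[|[|[|[|k]]]]]] lk //.
  - by apply: (etrans c0); rewrite /m /= -mulnn [(2 * p)%N]mulnC mulnACA.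
  - by apply: (etrans c1); rewrite /m /= -mulnn mulnA.
  - by apply: (etrans c2); rewrite /m /= [RHS]mulnC mulnA.
  - by apply: (etrans c3); rewrite /m /= [RHS]mulnC mulnA.
  - by apply: (etrans c4); rewrite /m /= muln1.
  - by apply: (etrans c5); rewrite /m /= muln1.
have n23 : ~ G 2 \isog G 3.
  move=> h; have e : #|'Z(G 2)%g| = #|'Z(G 3)%g| := card_isog (isog_center h).
  have e1 : #|'Z(G 3)%g| = 1%N by rewrite -e center_six2 cards1.
  by have /eqP := center_six3; case; apply/eqP; rewrite trivg_card1 e1.
have n45 : ~ G 5 \isog G 4.
  by move=> h; apply: (cyclic_not_sdprod (prime_gt1 pq) (cyclic_isog h s5) s4).
move=> ij; have mm : m i = m j.
  apply/eqP; rewrite -(@eqn_pmul2l (p * q)) ?muln_gt0 ?prime_gt0 //.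
  by apply/eqP; rewrite -!cE; apply: card_isog.
have alt (k l : nat) : m k = m l -> (k < l < 6)%N -> (k, l) = (2%N, 3%N) \/ (k, l) = (4%N, 5%N).
  move: k l => [|[|[|[|[|[|k]]]]]] [|[|[|[|[|[|l]]]]]]; rewrite /m /= => e kl;
    try (by left); try (by right); exfalso; have := q3; clear -e kl; lia.
apply: val_inj; case: (ltngtP i j) => //= lt.
  have [|e|e] := alt _ _ mm; first by rewrite lt ltn_ord.
    by have [ei ej] := pair_inj e; exfalso; move: ij; rewrite ei ej; exact: n23.
  by have [ei ej] := pair_inj e; exfalso; move: ij; rewrite isog_sym ei ej; exact: n45.
have [|e|e] := alt _ _ (esym mm); first by rewrite lt ltn_ord.
  by have [ei ej] := pair_inj e; exfalso; move: ij; rewrite isog_sym ei ej; exact: n23.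
by have [ei ej] := pair_inj e; exfalso; move: ij; rewrite ei ej; exact: n45.
Qed.
End SixFacts.
End Counting.

(** * Artin's theorem and fraction fields *)

Section Artin.
Variables (F : fieldType) (gT : finGroupType) (act : gT -> {rmorphism F -> F}) (x : F).
Hypothesis actM : forall g h y, act (g * h)%g y = act h (act g y).
Hypothesis xI : injective (fun g => act g x).

Lemma act1g y : act 1%g y = y.
Proof. by apply: (fmorph_inj (act 1%g)); rewrite -actM mulg1. Qed.

Definition fixed : {pred F} := fun y => [forall g, act g y == y].

Lemma fixedP y : reflect (forall g, act g y = y) (y \in fixed).
Proof. by apply: (iffP forallP) => h g; apply/eqP/h. Qed.

Fact fixed_divring : divring_closed fixed.
Proof.
split; first by apply/fixedP => g; rewrite rmorph1.
- by move=> a b /fixedP fa /fixedP fb; apply/fixedP => g; rewrite rmorphB fa fb.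
- by move=> a b /fixedP fa /fixedP fb; apply/fixedP => g; rewrite fmorph_div fa fb.
Qed.
HB.instance Definition _ := GRing.isDivringClosed.Build F fixed fixed_divring.

Record fixed_field := FixedField { fval : F; fvalP : fval \in fixed }.
HB.instance Definition _ := [isSub for fval].
HB.instance Definition _ := [Choice of fixed_field by <:].
HB.instance Definition _ := [SubChoice_isSubIntegralDomain of fixed_field by <:].
HB.instance Definition _ := [SubIntegralDomain_isSubField of fixed_field by <:].
Local Notation K := fixed_field.

(** A copy of [F] that carries the structure of a vector space over the fixed
    field. *)
Definition over_fixed : Type := F.
Local Notation E := over_fixed.
HB.instance Definition _ := GRing.Field.on E.
Definition fixed_scale (a : K) (u : E) : E := fval a * u.
Fact fixed_scaleA a b u : fixed_scale a (fixed_scale b u) = fixed_scale (a * b) u.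
Proof. exact: mulrA. Qed.
Fact fixed_scale1 : left_id 1 fixed_scale.
Proof. exact: mul1r. Qed.
Fact fixed_scaleDr : right_distributive fixed_scale +%R.
Proof. by move=> a u v; apply: mulrDr. Qed.
Fact fixed_scaleDl u : {morph fixed_scale^~ u : a b / a + b}.
Proof. by move=> a b; apply: mulrDl. Qed.
HB.instance Definition _ := GRing.Zmodule_isLmodule.Build K E
  fixed_scaleA fixed_scale1 fixed_scaleDr fixed_scaleDl.
Fact fixed_scaleAl (a : K) (u v : E) : a *: (u * v) = (a *: u) * v.
Proof. exact: mulrA. Qed.
HB.instance Definition _ := GRing.Lmodule_isLalgebra.Build K E fixed_scaleAl.
Fact fixed_scaleAr (a : K) (u v : E) : a *: (u * v) = u * (a *: v).
Proof. exact: mulrCA. Qed.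
HB.instance Definition _ := GRing.Lalgebra_isAlgebra.Build K E fixed_scaleAr.

Lemma fixed_scaleE (a : K) (u : E) : a *: u = val a * u :> F.
Proof. by []. Qed.

Local Notation m := #|gT|.
Definition conjugates : 'rV[F]_m := \row_i act (enum_val i) x.
(** The coefficients [c] with [y = \sum_k c k * x ^+ k], found by interpolation
    from the conjugates of [y]. *)
Definition lagrange (y : F) : 'rV[F]_m :=
  (\row_i act (enum_val i) y) *m invmx (Vandermonde m conjugates).

Fact vandermonde_unit : Vandermonde m conjugates \in unitmx.
Proof.
rewrite unitmxE det_Vandermonde unitfE; apply/prodf_neq0 => i _.
apply/prodf_neq0 => j ij; rewrite !mxE subr_eq0; apply: contraTneq ij => e.
by rewrite (enum_val_inj (xI e)) ltnn.
Qed.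

Lemma lagrange_unique (c : 'rV[F]_m) y :
  (forall g, act g y = \sum_k c 0 k * act g x ^+ k) -> c = lagrange y.
Proof.
move=> cE; have -> : c = c *m Vandermonde m conjugates *m invmx (Vandermonde m conjugates).
  by rewrite mulmxK ?vandermonde_unit.
congr (_ *m _); apply/rowP => i; rewrite !mxE cE; apply: eq_bigr => k _.
by rewrite !mxE.
Qed.

Lemma lagrangeE y g : act g y = \sum_k lagrange y 0 k * act g x ^+ k.
Proof.
have e : lagrange y *m Vandermonde m conjugates = \row_i act (enum_val i) y.
  exact: (mulmxKV vandermonde_unit).
have := congr1 (fun M : 'rV_m => M 0 (enum_rank g)) e.
rewrite [RHS]mxE enum_rankK => <-; rewrite mxE; apply: eq_bigr => k _.
by rewrite [Vandermonde _ _ _ _]mxE [conjugates _ _]mxE enum_rankK.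
Qed.

(** Applying [h] permutes the equations that determine the coefficients. *)
Lemma lagrange_fixed y k : lagrange y 0 k \in fixed.
Proof.
apply/fixedP => h; suff e : map_mx (act h) (lagrange y) = lagrange y.
  by rewrite -[in RHS]e [RHS]mxE.
apply: lagrange_unique => g.
have := lagrangeE y (g * h^-1)%g => /(congr1 (act h)); rewrite -actM mulgKV => ->.
by rewrite rmorph_sum; apply: eq_bigr => j _; rewrite rmorphM rmorphXn /= -actM mulgKV [map_mx _ _ _ _]mxE.
Qed.

Definition coords (y : E) : 'rV[K]_m := \row_k FixedField (lagrange_fixed y k).
Definition of_coords (r : 'rV[K]_m) : E := \sum_k r 0 k *: (x ^+ k : E).

Lemma coordsK : cancel coords of_coords.
Proof.
move=> y; rewrite -[RHS]act1g lagrangeE; apply: eq_bigr => k _.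
by rewrite fixed_scaleE mxE act1g.
Qed.

Lemma act_of_coords g r : act g (of_coords r) = \sum_k val (r 0 k) * act g x ^+ k.
Proof.
rewrite rmorph_sum; apply: eq_bigr => k _; rewrite fixed_scaleE rmorphM rmorphXn /=.
by have /fixedP -> := valP (r 0 k).
Qed.

Lemma of_coordsK : cancel of_coords coords.
Proof.
move=> r; apply/rowP => k; apply: val_inj; rewrite mxE /=.
suff <- : map_mx val r = lagrange (of_coords r) by rewrite [LHS]mxE.
by apply: lagrange_unique => g; rewrite act_of_coords; apply: eq_bigr => j _; rewrite [map_mx _ _ _ _]mxE.
Qed.

Fact of_coords_linear : linear of_coords.
Proof.
move=> a r s; rewrite /of_coords scaler_sumr -big_split; apply: eq_bigr => k _.
by rewrite !mxE scalerDl scalerA.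
Qed.
HB.instance Definition _ := GRing.isLinear.Build K 'rV[K]_m E _ of_coords of_coords_linear.

Fact over_fixed_vector : Vector.axiom m E.
Proof.
exists coords; first by apply: can2_linear of_coordsK coordsK.
by exists of_coords; [apply: coordsK | apply: of_coordsK].
Qed.
HB.instance Definition _ := Lmodule_hasFinDim.Build K E over_fixed_vector.

Lemma mem_over_fixed1 (y : E) : (y \in 1%VS) = (y \in fixed).
Proof.
apply/idP/idP => [/vlineP[k ->]|fy]; first by rewrite fixed_scaleE mulr1 (valP k).
by apply/vlineP; exists (FixedField fy); rewrite fixed_scaleE mulr1.
Qed.

Definition orbit_poly : {poly E} := \prod_(g : gT) ('X - (act g x : E)%:P).

Lemma orbit_poly_over : orbit_poly \is a polyOver 1%VS.
Proof.
apply/polyOverP => k; rewrite mem_over_fixed1; apply/fixedP => h.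
rewrite -coef_map; congr (nth 0 (polyseq _) k); rewrite rmorph_prod [RHS](reindex_inj (mulIg h)).
by apply: eq_bigr => g _; rewrite rmorphB /= map_polyX map_polyC /= -actM.
Qed.

Fact over_fixed_splitting : splitting_field_axiom E.
Proof.
exists orbit_poly; first exact: orbit_poly_over.
exists [seq act g x : E | g <- index_enum gT]; first by rewrite big_map eqpxx.
apply/eqP; rewrite eqEsubv subvf; apply/subvP => y _.
have xr : (x : E) \in <<1 & [seq act g x : E | g <- index_enum gT]>>%AS.
  by apply/seqv_sub_adjoin/mapP; exists 1%g; rewrite ?mem_index_enum ?act1g.
by rewrite -[y]coordsK; apply: memv_suml => k _; apply/memvZ/rpredX.
Qed.
HB.instance Definition _ := FieldExt_isSplittingField.Build K E over_fixed_splitting.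

Fact act_linear g : linear (act g : E -> E).
Proof.
move=> a u v; rewrite !fixed_scaleE rmorphD rmorphM /=.
by have /fixedP -> := valP a.
Qed.

Local Notation gE := (gal_of {:E}).

Lemma act_gal g : exists s : gE, forall y : E, s y = act g y.
Proof.
pose f : {linear E -> E} := HB.pack (act g : E -> E) (GRing.isLinear.Build K E E *:%R _ (act_linear g)).
have fE y : linfun f y = act g y by rewrite lfunE.
have homf : kHom 1 {:E} (linfun f).
  apply/kHomP_tmp; split=> [a|a b _ _]; last by rewrite !fE rmorphM.
  by rewrite mem_over_fixed1 => /fixedP fa; rewrite fE.
have autf : kAut 1 {:E} (linfun f) by rewrite kAutfE.
by have [s _ sE] := kAut_to_gal autf; exists s => y; rewrite -sE ?memvf ?fE.
Qed.

(** An automorphism sends [x] to a root of [orbit_poly], that is, to a conjugate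
    of [x], and [x] generates [E]. *)
Lemma gal_is_act (s : gE) : exists g, forall y : E, s y = act g y.
Proof.
have ps : map_poly s orbit_poly = orbit_poly.
  by apply: (fixedPoly_gal (sub1v _)) orbit_poly_over; rewrite gal_full.
have px : root orbit_poly x.
  by rewrite /root horner_prod (bigD1 1%g) //= !hornerE act1g subrr mul0r.
have : root orbit_poly (s x) by rewrite -ps fmorph_root.
rewrite /root horner_prod => /eqP/eqP/prodf_eq0[g _]; rewrite !hornerE subr_eq0 => /eqP sx.
exists g => y; rewrite -[y]coordsK [RHS]act_of_coords linear_sum /=.
by apply: eq_bigr => k _; rewrite linearZ /= rmorphXn /= sx.
Qed.

Lemma artin_isom : exists phi : {morphism [set: gT] >-> gE},
  ('injm phi)%g /\ (phi @* [set: gT] = 'Gal({:E} / 1))%g.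
Proof.
have /fin_all_exists[phi phiE] := act_gal.
have phiM : {in setT &, {morph phi : g h / (g * h)%g}}.
  move=> g h _ _; apply/eqP/gal_eqP => y _.
  by rewrite galM ?memvf // !phiE actM.
exists (Morphism phiM); split.
  by apply/injmP => g h _ _ /= e; apply: xI; rewrite -!phiE e.
apply/eqP; rewrite eqEsubset; apply/andP; split; apply/subsetP => s; first by rewrite gal_full.
move=> _; have [g sE] := gal_is_act s.
have -> : s = phi g by apply/eqP/gal_eqP => y _; rewrite phiE sE.
by apply: (mem_morphim (Morphism phiM)); rewrite inE.
Qed.

Lemma fixed_galois : galois 1 {:E}.
Proof.
apply/galois_fixedField/eqP; rewrite eqEsubv; apply/andP; split; last first.
  by rewrite galois_connection_subv ?sub1v.
apply/subvP => y yf; rewrite mem_over_fixed1; apply/fixedP => g.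
have [s <-] := act_gal g; have [_] := mem_fixedFieldP yf; apply.
by rewrite gal_full.
Qed.
End Artin.

Section Realise.
Variables (K : fieldType) (E : splittingFieldType K).
Hypothesis galE : galois 1 {:E}.
Variables (n : nat) (P : perm_group n) (f : {morphism P >-> gal_of {:E}}).
Hypotheses (injf : ('injm f)%g) (imf : (f @* P = 'Gal({:E} / 1))%g).

(** A normal subfield that contains the fixed field of the point stabiliser has
    for Galois group a normal subgroup inside the stabiliser, which is trivial
    as the core is. *)
Lemma core_free_closure : realises (fixedField_aspace (f @* pg_stab P)%g) P.
Proof.
set A := (f @* pg_stab P)%G.
have galA : 'Gal({:E} / fixedField A)%g = A := gal_fixedField A.
split; last by exists f; split=> //; rewrite galA.
have /and3P[_ sepE _] := galE; split; first exact: separableSr (subvf _) sepE.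
move=> M sLM nM.
have nGM : ('Gal({:E} / M) <| 'Gal({:E} / 1))%g.
  by apply: normalField_normal; rewrite ?sub1v ?subvf.
have sMA : 'Gal({:E} / M)%g \subset A by rewrite -galA galS.
have trM : 'Gal({:E} / M)%g :=: 1%g.
  have sMf : 'Gal({:E} / M)%g \subset (f @* P)%g by rewrite imf (normal_sub nGM).
  apply/trivgP; suff : (f @* (f @*^-1 'Gal({:E} / M)) \subset f @* 1)%g.
    by rewrite morphpreK // morphim1.
  apply: morphimS.
  rewrite -(pg_core P); apply: gcore_max.
    by rewrite -(injmK injf (pg_stab_sub P)) morphpreS.
  have := normal_norm nGM; rewrite -{1}imf => nM'.
  by apply: subset_trans (morphpre_norm _ _); rewrite -sub_morphim_pre.
apply/val_inj => /=; have galM : galois M {:E} by apply: galoisS galE; rewrite sub1v subvf.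
have /galois_fixedField := galM; rewrite trM => <-.
apply/eqP; rewrite eqEsubv subvf; apply/subvP => y _; apply/fixedFieldP; rewrite ?memvf //.
by move=> s /set1gP ->; rewrite gal_id.
Qed.
End Realise.

Section Fractions.
Import FracField.
Variables (R : idomainType) (s : {rmorphism R -> R}).
Hypothesis sI : injective s.
Local Notation Q := {fraction R}.

Lemma fraction_ratio (r : {ratio R}) : \pi_Q%qT r = (tofrac \n_r) / (tofrac \d_r) :> Q.
Proof.
have d0 : \d_r != 0 by apply: denom_ratioP.
apply: (canRL (mulfK _)); first by rewrite tofrac_eq0.
apply/eqP; rewrite !piE.
by rewrite equivfE /mulf !numden_Ratio ?mulf_neq0 ?oner_eq0 // !mulr1 mulrC.
Qed.

Lemma fraction_ind (D : Q -> Prop) :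
  (forall a b, b != 0 -> D (tofrac a / tofrac b)) -> forall y, D y.
Proof. by move=> Dab; elim/quotW => r; rewrite fraction_ratio; apply/Dab/denom_ratioP. Qed.

(** The extension of [s] to fractions; [frac_map_ratio] shows that the choice of
    a representative does not matter. *)
Definition frac_map (y : Q) : Q :=
  tofrac (s \n_(generic_quotient.repr y)) / tofrac (s \d_(generic_quotient.repr y)).

Fact mapped_neq0 b : b != 0 -> tofrac (s b) != 0.
Proof. by rewrite tofrac_eq0; apply: contra_neq => e; apply: sI; rewrite e rmorph0. Qed.

Lemma frac_map_ratio a b : b != 0 -> frac_map (tofrac a / tofrac b) = tofrac (s a) / tofrac (s b).
Proof.
move=> b0; set y : Q := _ / _.
have d0 : \d_(generic_quotient.repr y) != 0 by apply: denom_ratioP.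
have e : tofrac \n_(generic_quotient.repr y) / tofrac \d_(generic_quotient.repr y) = tofrac a / tofrac b :> Q.
  by rewrite -fraction_ratio reprK.
apply/eqP; rewrite eqr_div ?mapped_neq0 // -!tofracM -!rmorphM tofrac_eq /=.
move/eqP: e; rewrite eqr_div ?tofrac_eq0 // -!tofracM tofrac_eq.
by move=> /eqP ->.
Qed.

Lemma frac_map_tofrac a : frac_map (tofrac a) = tofrac (s a).
Proof. by have := frac_map_ratio a (oner_neq0 _); rewrite !rmorph1 !divr1. Qed.

Fact frac_map_zmod_morphism : zmod_morphism frac_map.
Proof.
elim/fraction_ind => a b b0; elim/fraction_ind => c d d0.
rewrite -mulNr addf_div ?tofrac_eq0 // -!tofracN -!tofracM -tofracD.
rewrite !frac_map_ratio ?mulf_neq0 // -mulNr addf_div ?mapped_neq0 //.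
by rewrite -tofracN -!tofracM -tofracD -(rmorphN s) -!(rmorphM s) -(rmorphD s).
Qed.

Fact frac_map_monoid_morphism : monoid_morphism frac_map.
Proof.
split; first by rewrite -[1]/(tofrac 1 : Q) frac_map_tofrac !rmorph1.
elim/fraction_ind => a b b0; elim/fraction_ind => c d d0.
rewrite mulf_div -!tofracM !frac_map_ratio ?mulf_neq0 // mulf_div.
by rewrite -!tofracM -!(rmorphM s).
Qed.
HB.instance Definition _ := GRing.isZmodMorphism.Build Q Q frac_map frac_map_zmod_morphism.
HB.instance Definition _ := GRing.isMonoidMorphism.Build Q Q frac_map frac_map_monoid_morphism.

Lemma frac_rmorphism : exists f : {rmorphism Q -> Q}, forall a b, b != 0 ->
  f (tofrac a / tofrac b) = tofrac (s a) / tofrac (s b).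
Proof. by exists frac_map => a b; apply: frac_map_ratio. Qed.
End Fractions.

(** * Every permutation group is realised *)

(** Cayley's theorem: the group permutes indeterminates indexed by its elements,
    and the one indexed by 1 has distinct conjugates. *)
Lemma faithful_action (gT : finGroupType) : exists (F : fieldType)
    (act : gT -> {rmorphism F -> F}) (x : F),
  (forall g h y, act (g * h)%g y = act h (act g y)) /\ injective (fun g => act g x).
Proof.
pose m := #|gT|; pose R : idomainType := mpoly.mpoly m rat.
have sI (g : gT) : injective (fun i : 'I_m => enum_rank (enum_val i * g)%g).
  by move=> i j /enum_rank_inj/mulIg/enum_val_inj.
pose s g := perm (sI g).
have sM g h : s (g * h)%g = (s g * s h)%g.
  by apply/permP => i; rewrite permM !permE enum_rankK mulgA.
pose sR g : {rmorphism R -> R} := mpoly.msym (s g).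
have sRI g : injective (sR g) by apply: mpoly.inj_msym.
have /fin_all_exists[act actE] := fun g => frac_rmorphism (sRI g).
pose X (g : gT) : R := mpoly.mpolyX rat (mpoly.mnm1 (enum_rank g)).
have actF g (a : R) : act g (FracField.tofrac a) = FracField.tofrac (sR g a).
  by have := actE g a 1 (oner_neq0 _); rewrite !rmorph1 !divr1.
exists {fraction R}, act, (FracField.tofrac (X 1%g)); split=> [g h|].
  elim/fraction_ind => a b b0; rewrite !fmorph_div /= !actF.
  by rewrite /sR /= sM !mpoly.msymMm.
have actX g : act g (FracField.tofrac (X 1%g)) = FracField.tofrac (X g).
  rewrite actF; congr FracField.tofrac; rewrite /sR /= mpoly.msymX; congr mpoly.mpolyX.
  apply/mpoly.mnmP => i; rewrite mpoly.mnmE !mpoly.mnm1E.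
  rewrite -(inj_eq (@perm_inj _ (s g))) permKV permE enum_rankK mul1g.
  by [].
move=> g h /=; rewrite !actX => /eqP; rewrite tofrac_eq => /eqP e.
have := congr1 (fun p => mpoly.mcoeff (mpoly.mnm1 (enum_rank g)) p) e.
rewrite !mpoly.mcoeffX eqxx; case: eqP => // e' _.
have := congr1 (fun u : mpoly.multinom m => u (enum_rank g)) e'.
by rewrite !mpoly.mnm1E eqxx; case: eqP => // /enum_rank_inj.
Qed.

(** Artin's theorem for the action of [P] on rational functions; the extension
    of the fixed field that realises [P] is the fixed field of the point
    stabiliser. *)
Lemma exists_realisation n (P : perm_group n) :
  exists (K : fieldType) (E : splittingFieldType K) (L : {subfield E}), realises L P.
Proof.
have [F [act [x [actM xI]]]] := faithful_action (subg_of P).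
have [phi [phiI phiS]] := artin_isom actM xI.
have fM : {in P &, {morph (fun y => phi (subg P y)) : y z / (y * z)%g}}.
  by move=> y z Py Pz /=; rewrite subgM // morphM ?inE.
pose f := Morphism fM.
have injf : ('injm f)%g.
  apply/injmP => y z Py Pz /= /(injmP phiI) e.
  by rewrite -[y](@subgK _ P) // -[z](@subgK _ P) // e ?inE.
have imf : (f @* P = phi @* [set: subg_of P])%g.
  apply/setP => t; apply/morphimP/morphimP => [[y _ Py ->]|[u _ _ ->]].
    by exists (subg P y); rewrite ?inE.
  by exists (sgval u); rewrite ?subgP //= sgvalK.
do 2!eexists; exists (fixedField_aspace (f @* pg_stab P)%g).
by apply: (core_free_closure (fixed_galois actM xI) injf); rewrite imf phiS.
Qed.

Local Close Scope ring_scope.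
Local Open Scope group_scope.

(** * Transport of regular groups to cosets *)

Section Transport.
Variables (T S : finType) (phi : T -> S).
Hypothesis phiI : injective phi.
Local Notation X := [set phi z | z : T].

Lemma transport_exists (n : {perm T}) :
  exists m : {perm S}, perm_on X m /\ forall z, m (phi z) = phi (n z).
Proof.
pose f Y := if [pick z | phi z == Y] is Some z then phi (n z) else Y.
have fphi z : f (phi z) = phi (n z).
  by rewrite /f; case: pickP => [w /eqP/phiI -> //|/(_ z)]; rewrite eqxx.
have fout Y : Y \notin X -> f Y = Y.
  rewrite /f; case: pickP => // w /eqP <-; by rewrite imset_f ?inE.
have fI : injective f.
  move=> Y Z; have [/imsetP[y _ ->]|nY] := boolP (Y \in X);
    have [/imsetP[z _ ->]|nZ] := boolP (Z \in X); rewrite ?fphi ?fout //.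
  - by move/phiI/perm_inj ->.
  - by move=> e; case/negP: nZ; rewrite -e imset_f ?inE.
  - by move=> e; case/negP: nY; rewrite e imset_f ?inE.
exists (perm fI); split=> [|z]; last by rewrite permE.
by apply/subsetP => Y; rewrite !inE permE; apply: contraR => /fout ->.
Qed.

(** Permutations of [T] correspond to permutations of the range of [phi],
    extended by the identity. *)
Lemma transport_morphism : exists Phi : {morphism [set: {perm T}] >-> {perm S}},
  [/\ 'injm Phi, forall n, perm_on X (Phi n), forall n z, Phi n (phi z) = phi (n z)
    & forall m, perm_on X m -> exists n, Phi n = m].
Proof.
have /fin_all_exists[Phi PhiP] := transport_exists.
have PhiX n : perm_on X (Phi n) by case: (PhiP n).
have PhiE n z : Phi n (phi z) = phi (n z) by case: (PhiP n).
have ext m m' : perm_on X m -> perm_on X m' -> (forall z, m (phi z) = m' (phi z)) -> m = m'.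
  move=> Xm Xm' e; apply/permP => Y; have [/imsetP[y _ ->]|nY] := boolP (Y \in X); first exact: e.
  by rewrite (out_perm Xm nY) (out_perm Xm' nY).
have PhiM : {in setT &, {morph Phi : n n' / n * n'}}.
  move=> n n' _ _; apply: ext => // [|z]; last by rewrite permM !PhiE permM.
  exact: perm_onM.
exists (Morphism PhiM); split=> //= [|m Xm].
  apply/injmP => n n' _ _ /= e; apply/permP => z.
  by apply: phiI; rewrite -!PhiE e.
have /fin_all_exists[g gE] z : exists w, phi w = m (phi z).
  have : m (phi z) \in X by rewrite perm_closed // imset_f ?inE.
  by case/imsetP=> w _ ->; exists w.
have gI : injective g by move=> z w e; apply/phiI/(@perm_inj _ m); rewrite -!gE e.
by exists (perm gI); apply: ext => // z; rewrite PhiE permE gE.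
Qed.
End Transport.

Section Bridge.
Variables (K : fieldType) (E : splittingFieldType K) (L : {subfield E}).
Local Notation gE := (gal_of {:E}).
Local Notation Gamma := ('Gal({:E} / 1))%G.
Local Notation Gamma' := ('Gal({:E} / L))%G.
Variables (T : finType) (z0 : T) (D : {group {perm T}}) (f : {morphism D >-> gE}).
Hypotheses (trD : forall z w, exists2 h, h \in D & h z = w).
Hypotheses (injf : 'injm f) (imf : f @* D = Gamma) (ims : f @* point_stab z0 D = Gamma').

(** The point [z] goes to the coset of [f s], for any [s] in [D] that sends [z0]
    to [z]; right multiplication of cosets is the action of [D] on points. *)
Lemma coset_param : exists phi : T -> {set gE},
  [/\ injective phi, [set phi z | z : T] = cosetX L
    & forall h z, h \in D -> phi (h z) = lambda (f h) (phi z)].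
Proof.
have /fin_all_exists[s sP] z : exists s, (s \in D) && (s z0 == z).
  by have [s Ds sz] := trD z0 z; exists s; rewrite Ds sz eqxx.
have sD z : s z \in D by case/andP: (sP z).
have sE z : s z z0 = z by case/andP: (sP z) => _ /eqP.
have stab h : h \in D -> h z0 = z0 -> f h \in Gamma'.
  move=> Dh hz; have : f h \in f @* point_stab z0 D.
    by rewrite mem_morphim // mem_point_stab Dh hz eqxx.
  by rewrite ims.
have same g h : g \in D -> h \in D -> (Gamma' :* f g == Gamma' :* f h) = (g z0 == h z0).
  move=> Dg Dh; apply/eqP/eqP => [e|e].
    have : f g \in Gamma' :* f h by rewrite -e rcoset_refl.
    rewrite mem_rcoset -ims -morphV // -morphM ?groupV // => /morphimP[c Dc].
    rewrite mem_point_stab => /andP[_ /eqP cz] /(injmP injf) e'.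
    have {e'} e' : g * h^-1 = c by apply: e'; rewrite ?groupM ?groupV.
    by have := congr1 (fun k : {perm T} => h (k z0)) e'; rewrite permM permKV cz.
  apply/rcoset_eqP; rewrite mem_rcoset -morphV // -morphM ?groupV //.
  by apply: stab; rewrite ?groupM ?groupV // permM e permK.
pose phi z : {set gE} := Gamma' :* f (s z).
have phiE h : h \in D -> phi (h z0) = Gamma' :* f h.
  by move=> Dh; apply/eqP; rewrite same // sE.
exists phi; split=> [z w /eqP|| h z Dh].
- by rewrite same // !sE => /eqP.
- apply/setP => Y; apply/imsetP/rcosetsP => [[z _ ->]|[g Gg ->]].
    by exists (f (s z)); rewrite // gal_full.
  move: Gg; rewrite -imf => /morphimP[h Dh _ ->].
  by exists (h z0); rewrite ?inE // phiE.
- by rewrite lambdaE -rcosetM -morphM // -[in LHS](sE z) -permM phiE ?groupM.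
Qed.

Variable phi : T -> {set gE}.
Hypotheses (phiI : injective phi) (phiX : [set phi z | z : T] = cosetX L).
Hypothesis phiJ : forall h z, h \in D -> phi (h z) = lambda (f h) (phi z).
Variable Phi : {morphism [set: {perm T}] >-> {perm {set gE}}}.
Hypotheses (PhiI : 'injm Phi) (PhiX : forall n, perm_on [set phi z | z : T] (Phi n)).
Hypothesis PhiE : forall n z, Phi n (phi z) = phi (n z).

(** [lambda (f h)] is not supported on the cosets, but it permutes them, as does
    its inverse. *)
Lemma transport_conj h n : h \in D -> Phi n ^ lambda (f h) = Phi (n ^ h).
Proof.
move=> Dh; apply/permP => Y.
have lV g : (lambda g)^-1 = lambda g^-1 :> {perm {set gE}}.
  apply/eqP; rewrite eq_invg_mul -lambdaM mulgV; apply/eqP/permP => A.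
  by rewrite lambdaE perm1 mulg1.
have [/imsetP[y _ ->]|nY] := boolP (Y \in [set phi z | z : T]).
  by rewrite PhiE !conjgE !permM lV -morphV // -phiJ ?groupV // PhiE -phiJ.
rewrite (out_perm (PhiX _) nY) conjgE !permM (out_perm (PhiX _)) ?permKV //.
apply: contra nY; rewrite lV -morphV // => /imsetP[w _ e].
apply/imsetP; exists (h w); rewrite ?inE // phiJ // -e morphV // -lV permKV //.
Qed.

Lemma mem_transport (N : {group {perm T}}) n : (Phi n \in Phi @* N) = (n \in N).
Proof.
apply/idP/idP => [/morphimP[n' _ Nn' /(injmP PhiI) ->] //|Nn]; rewrite ?inE //.
by rewrite mem_morphim ?inE.
Qed.

Lemma transport_regular (N : {group {perm T}}) :
  regular N <-> regular_on_cosets L (Phi @* N).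
Proof.
have memP := mem_transport N.
split=> [[tr fr]|[_ /imsetP[Y0 XY0 orb] fr]].
  split.
  - by move=> _ /morphimP[n _ Nn ->]; rewrite -phiX; apply: PhiX.
  - apply/imsetP; exists (phi z0); first by rewrite -phiX imset_f ?inE.
    apply/setP => Y; rewrite -phiX; apply/imsetP/orbitP => [[w _ ->]|[_ /morphimP[n _ Nn ->]]].
      by have [n Nn nw] := tr z0 w; exists (Phi n); rewrite ?memP //= /aperm PhiE nw.
    by rewrite /= /aperm PhiE => <-; exists (n z0); rewrite ?inE.
  - move=> Y; rewrite -phiX => /imsetP[z _ ->]; apply/trivgP/subsetP
      => _ /setIP[/morphimP[n _ Nn ->]] /astab1P; rewrite /= /aperm PhiE => /phiI nz.
    by rewrite (fr n z Nn nz) morph1 inE.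
split=> [z w|n z Nn nz].
  have zX : phi z \in cosetX L by rewrite -phiX imset_f ?inE.
  have wX : phi w \in cosetX L by rewrite -phiX imset_f ?inE.
  have : phi w \in orbit 'P (Phi @* N) (phi z).
    rewrite orb in zX wX; move: zX; rewrite -orbit_eq_mem => /eqP ->.
    exact: wX.
  case/orbitP=> _ /morphimP[n _ Nn ->]; rewrite /= /aperm PhiE => /phiI nz.
  by exists n.
have zX : phi z \in cosetX L by rewrite -phiX imset_f ?inE.
apply/(injmP PhiI); rewrite ?inE // morph1; apply/set1gP; rewrite -(fr _ zX).
by apply/setIP; split; rewrite ?memP //; apply/astab1P; rewrite /= /aperm PhiE nz.
Qed.

Lemma transport_normalised (N : {group {perm T}}) :
  D \subset 'N(N) <-> normalised_by_lambda (Phi @* N).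
Proof.
have memP := mem_transport N.
split=> [/subsetP nN g|nN].
  rewrite -imf => /morphimP[h Dh _ ->]; rewrite inE; apply/subsetP => _ /imsetP[_ /morphimP[n _ Nn ->] ->].
  by rewrite transport_conj // memP memJ_norm ?nN.
apply/subsetP => h Dh; rewrite inE; apply/subsetP => _ /imsetP[n Nn ->].
by rewrite -memP -transport_conj // memJ_norm ?memP // nN // -imf mem_morphim.
Qed.
End Bridge.

(** * Extensions and permutations of an arbitrary set of points *)

Definition isog_invariant (Q : group_prop) := forall (gT hT : finGroupType)
  (G : {group gT}) (H : {group hT}), G \isog H -> Q _ G -> Q _ H.

Section Bridge.
Variables (K : fieldType) (E : splittingFieldType K) (L : {subfield E}).
Local Notation gE := (gal_of {:E}).
Local Notation Gamma := ('Gal({:E} / 1))%G.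
Local Notation Gamma' := ('Gal({:E} / L))%G.
Variables (T : finType) (z0 : T) (D : {group {perm T}}) (f : {morphism D >-> gE}).
Hypotheses (trD : forall z w, exists2 h, h \in D & h z = w).
Hypotheses (injf : 'injm f) (imf : f @* D = Gamma) (ims : f @* point_stab z0 D = Gamma').

(** The regular groups on [T] that [D] normalises are those of the
    correspondence of Greither and Pareigis, for an extension with group [D]. *)
Lemma transported_groups : exists Tr : {group {perm T}} -> {group {perm {set gE}}},
  [/\ injective Tr /\ forall N : {group {perm T}}, N \isog Tr N,
      forall N : {group {perm T}}, regular N <-> regular_on_cosets L (Tr N),
      forall N : {group {perm T}}, D \subset 'N(N) <-> normalised_by_lambda (Tr N)
    & forall M, regular_on_cosets L M -> exists N, Tr N = M].
Proof.
have [phi [phiI phiX phiJ]] := coset_param trD injf imf ims.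
have [Phi [PhiI PhiX PhiE PhiS]] := transport_morphism phiI.
exists (fun N => (Phi @* N)%G); split; first split.
- move=> N M /(congr1 val) /= e; apply/val_inj => /=.
  by apply: (injm_morphim_inj PhiI) e; rewrite subsetT.
- by move=> N; apply: sub_isog; rewrite ?subsetT.
- exact: (transport_regular z0 phiI phiX PhiI PhiX PhiE).
- exact: (transport_normalised imf phiJ PhiI PhiX PhiE).
move=> M [onM _ _]; exists (Phi @*^-1 M)%G; apply/val_inj => /=; apply: morphpreK.
apply/subsetP => m Mm; have [|n <-] := PhiS m; first by rewrite phiX onM.
by apply: mem_morphim; rewrite ?inE.
Qed.

Lemma bridge_number (Q : group_prop) k : isog_invariant Q -> galois 1 {:E} ->
  (exists nu : 'I_k -> {group {perm T}},
    [/\ forall i, [/\ regular (nu i), D \subset 'N(nu i) & Q _ (nu i)], injective nu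
      & forall N : {group {perm T}}, regular N -> D \subset 'N(N) -> Q _ N ->
          exists i, N = nu i]) ->
  hg_number (@hg_of_type K E L Q) k.
Proof.
move=> QI galE [nu [nuP nuI nuS]].
have [Tr [[TrI Tris] Trr Trn TrS]] := transported_groups.
apply: (hg_number_of_groups galE (nu := fun i => Tr (nu i))).
- move=> i; have [rN nN QN] := nuP i; split; [exact/Trr|exact/Trn|exact: QI (Tris _) QN].
- by move=> i j /TrI/nuI.
move=> M rM nM QM; have [N eM] := TrS M rM; subst M.
have [|||i ->] := nuS N; [exact/Trr|exact/Trn| |by exists i].
by apply: QI QM; rewrite isog_sym.
Qed.

Lemma bridge_regular (Q : group_prop) (S : hopf_galois (subvs_of L)) :
  isog_invariant Q -> hg_of_type Q S ->
  exists N : {group {perm T}}, [/\ regular N, D \subset 'N(N) & Q _ N].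
Proof.
move=> QI [M [rM nM _ QM]]; have [Tr [[_ Tris] Trr Trn TrS]] := transported_groups.
have [N eM] := TrS M rM; subst M; exists N; split; [exact/Trr|exact/Trn|].
by apply: QI QM; rewrite isog_sym.
Qed.
End Bridge.

Section Model.
Variables (n : nat) (P : perm_group n) (T : finType).
Hypothesis cT : #|T| = n.

(** The action on the cosets of the point stabiliser, faithful because the core
    is trivial; the points are renamed along a bijection with [T]. *)
Lemma permutation_model : exists (z0 : T) (r : {morphism P >-> {perm T}}),
  [/\ 'injm r, forall z w, exists2 h, h \in r @* P & h z = w
    & r @* pg_stab P = point_stab z0 (r @* P)].
Proof.
pose X := rcosets (pg_stab P) P.
have cX : #|X| = #|T| by rewrite cT; apply: pg_index P.
pose b (z : T) : {set pg_type P} := enum_val (cast_ord (esym cX) (enum_rank z)).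
have bI : injective b by move=> z w /enum_val_inj/cast_ord_inj/enum_rank_inj.
have bX z : b z \in X by apply: enum_valP.
have bS Y : Y \in X -> exists z, b z = Y.
  move=> XY; exists (enum_val (cast_ord cX (enum_rank_in XY Y))).
  by rewrite /b enum_valK cast_ordK enum_rankK_in.
have XR Y h : Y \in X -> h \in P -> Y :* h \in X.
  by case/rcosetsP=> g Pg -> Ph; rewrite -rcosetM; apply/rcosetsP; exists (g * h); rewrite ?groupM.
have [z0 bz0] : exists z, b z = pg_stab P.
  by apply/bS/rcosetsP; exists 1; rewrite ?mulg1.
have /fin_all_exists[r rP] h : exists s : {perm T}, h \in P -> forall z, b (s z) = b z :* h.
  have [Ph|_] := boolP (h \in P); last by exists 1.
  have /fin_all_exists[s sE] z : exists w, b w = b z :* h by apply/bS/XR.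
  have sI : injective s.
    by move=> z w e; apply/bI/(rcoset_inj (x := h)); rewrite -!sE e.
  by exists (perm sI) => _ z; rewrite permE.
have rM : {in P &, {morph r : g h / g * h}}.
  move=> g h Pg Ph; apply/permP => z; apply: bI.
  by rewrite permM !rP ?groupM // rcosetM.
exists z0, (Morphism rM).
have injr : 'injm (Morphism rM).
  apply/subsetP => h /morphpreP[Ph /set1gP rh]; rewrite -(pg_core P).
  apply/bigcapP => g Pg; rewrite mem_conjg.
  have [z bz] : exists z, b z = pg_stab P :* g by apply/bS/rcosetsP; exists g.
  have := rP h Ph z; rewrite [r h]rh perm1 bz -rcosetM => /eqP; rewrite eq_sym => /eqP/rcoset_eqP.
  by rewrite mem_rcoset conjgE invgK !mulgA.
have rz h : h \in P -> (r h z0 == z0) = (h \in pg_stab P).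
  move=> Ph; rewrite -(inj_eq bI) rP // bz0.
  by apply/eqP/idP => [<-|Sh]; [rewrite rcoset_refl | rewrite rcoset_id].
split=> //.
  move=> z w; have /rcosetsP[g Pg bz] := bX z; have /rcosetsP[h Ph bw] := bX w.
  exists (r (g^-1 * h)); first by rewrite (mem_morphim (Morphism rM)) ?groupM ?groupV.
  by apply: bI; rewrite rP ?groupM ?groupV // bz bw -rcosetM mulKVg.
apply/setP => s; apply/morphimP/idP => [[h Ph Sh ->]|].
  rewrite mem_point_stab (mem_morphim (Morphism rM)) //=.
  by rewrite rz.
rewrite mem_point_stab => /andP[/morphimP[h Ph _ ->]] /=; rewrite rz // => Sh.
by exists h.
Qed.
End Model.

(** * The classification *)

Lemma compose_injm (aT bT cT : finGroupType) (A A' : {group aT}) (B B' : {group bT})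
    (f : {morphism A >-> bT}) (g : {morphism B >-> cT}) :
  A' \subset A -> 'injm f -> f @* A = B -> f @* A' = B' -> 'injm g ->
  exists h : {morphism A >-> cT}, [/\ 'injm h, h @* A = g @* B & h @* A' = g @* B'].
Proof.
move=> sA injf fA fA' injg.
have fB x : x \in A -> f x \in B by move=> Ax; rewrite -fA mem_morphim.
have hM : {in A &, {morph (fun x => g (f x)) : x y / x * y}}.
  by move=> x y Ax Ay; rewrite !morphM ?fB.
have im (S : {group aT}) (S' : {group bT}) : S \subset A -> f @* S = S' -> Morphism hM @* S = g @* S'.
  move=> sSA fS; apply/setP => z; apply/morphimP/morphimP => [[x Ax Sx ->]|[y By]].
    by exists (f x); rewrite ?fB // -fS mem_morphim.
  by rewrite -fS => /morphimP[x Ax Sx ->] ->; exists x.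
exists (Morphism hM); split; [|exact: im|exact: im].
by apply/injmP => x y Ax Ay /= /(injmP injg) e; apply: (injmP injf) => //; apply: e; apply: fB.
Qed.

Lemma pg_isog_trans n (P Q R : perm_group n) : pg_isog P Q -> pg_isog Q R -> pg_isog P R.
Proof.
case=> [f [injf fP fS]] [g [injg gQ gS]].
have [h [injh hP hS]] := compose_injm (pg_stab_sub P) injf fP fS injg.
by exists h; rewrite hP hS.
Qed.

Lemma realises_isog n (P Q : perm_group n) (K : fieldType) (E : splittingFieldType K)
  (L : {subfield E}) : pg_isog P Q -> realises L Q -> realises L P.
Proof.
case=> [f [injf fP fS]] [clL [g [injg gQ gS]]]; split=> //.
have [h [injh hP hS]] := compose_injm (pg_stab_sub P) injf fP fS injg.
by exists h; rewrite hP hS.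
Qed.

Lemma pg_isog_sym n (P Q : perm_group n) : pg_isog P Q -> pg_isog Q P.
Proof.
case=> [f [injf fP fS]].
have gM : {in Q &, {morph invm injf : x y / x * y}}.
  by move=> x y; rewrite -fP => Qx Qy; rewrite morphM.
have im (S : {group pg_type P}) (S' : {group pg_type Q}) :
    S \subset P -> f @* S = S' -> Morphism gM @* S' = S.
  move=> /subsetP sSP fS'; apply/setP => x; apply/morphimP/idP => [[y Qy Sy ->]|Sx] /=.
    by move: Sy; rewrite -fS' => /morphimP[z Pz Sz ->]; rewrite /= invmE.
  exists (f x); rewrite /= ?invmE ?sSP // -?fP -?fS' mem_morphim ?sSP //.
exists (Morphism gM); split; [|exact: (im P Q)|exact: im (pg_stab_sub P) fS].
have Qf x : x \in Q -> exists2 z, z \in P & x = f z.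
  by rewrite -fP => /morphimP[z Pz _ ->]; exists z.
apply/injmP => _ _ /Qf[x Px ->] /Qf[y Py ->] /=.
by rewrite !invmE // => ->.
Qed.

Section Classification.
Variables (p q : nat).
Hypotheses (q3 : (3 <= q)%N) (pq : prime q) (pp : prime p) (pE : p = (2 * q + 1)%N).
Variables (w : 'F_p) (wP : q.-primitive_root%R w) (wq : (w ^+ q)%R = 1%R).
Local Notation T := ('F_p * 'F_q)%type.
Local Notation G := (@six p q pq w wq).
Local Notation O := ((0, 0)%R : T).

Definition six_groups (i : nat) : perm_group (p * q) :=
  pg_of O (card_plane pp pq) (six_trans pq wq i).

Fact is_cyclic_isog m : isog_invariant (is_cyclic m).
Proof. by move=> gT hT A B; apply: cyclic_isog. Qed.

Fact is_sdprod_cyclic_isog m n : isog_invariant (is_sdprod_cyclic m n).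
Proof. by move=> gT hT A B; apply: sdprod_cyclic_isog. Qed.

Lemma enumerated_number i Q k :
  isog_invariant Q -> enumerated (G i) Q k -> number_of_type Q (six_groups i) k.
Proof.
move=> QI enu K E L [clL [f [injf imf ims]]].
exact: (bridge_number (six_trans pq wq i) injf imf ims QI (separable_closure_galois clL) enu).
Qed.

Lemma realised_regular (P : perm_group (p * q)) (z0 : T) (D : {group {perm T}})
    (trD : forall z w, exists2 h, h \in D & h z = w) Q :
  isog_invariant Q -> pg_isog P (pg_of z0 (card_plane pp pq) trD) -> realised_by_type Q P ->
  exists N : {group {perm T}}, [/\ regular N, D \subset 'N(N) & Q _ N].
Proof.
move=> QI PD [K [E [L [rL [S SQ]]]]].
have [clL [f [injf imf ims]]] := realises_isog (pg_isog_sym PD) rL.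
exact: (bridge_regular trD injf imf ims QI SQ).
Qed.

(** The two types may come from different extensions, but both give regular
    groups normalised by the same group of permutations of the plane, to which
    [common_normaliser] applies. *)
Lemma realised_by_both (P : perm_group (p * q)) :
  realised_by_type (is_cyclic (p * q)) P -> realised_by_type (is_sdprod_cyclic p q) P ->
  exists i : 'I_6, pg_isog P (six_groups i).
Proof.
move=> cP nP; have [z0 [r [injr trD rS]]] := permutation_model P (card_plane pp pq).
set D := (r @* P)%G in trD rS.
have PD : pg_isog P (pg_of z0 (card_plane pp pq) trD) by exists r.
have [N0 [rN0 nN0 cN0]] := realised_regular (@is_cyclic_isog _) PD cP.
have [N1 [rN1 nN1 cN1]] := realised_regular (@is_sdprod_cyclic_isog _ _) PD nP.
have [s [i [sz Ds]]] := common_normaliser q3 pq pp pE z0 wq wP trD rN0 nN0 cN0 rN1 nN1 cN1.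
exists i; apply: pg_isog_trans PD _; exists (conjgm_morphism D s); split.
- exact: injm_conj.
- by rewrite /= morphim_conj setIid; apply: congr1 Ds.
rewrite /= morphim_conj (setIidPr (point_stab_sub _ _)).
apply/setP => h; rewrite mem_conjg !mem_point_stab -mem_conjg.
have -> : (h \in D :^ s) = (h \in G i) by rewrite -Ds.
by rewrite conjgE invgK !permM sz -(inj_eq (@perm_inj _ s)) permKV sz.
Qed.

(** Some extension realises [P], and it carries [k > 0] structures. *)
Lemma number_realised (P : perm_group (p * q)) Q k :
  (0 < k)%N -> number_of_type Q P k -> realised_by_type Q P.
Proof.
move=> k0 PQ; have [K [E [L rL]]] := exists_realisation P.
exists K, E, L; split=> //; have [s [sP _ _]] := PQ K E L rL.
by exists (s (Ordinal k0)); apply: sP.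
Qed.

Lemma realised_by_type_isog (P R : perm_group (p * q)) Q :
  pg_isog P R -> realised_by_type Q R -> realised_by_type Q P.
Proof.
move=> PR [K [E [L [rL SQ]]]]; exists K, E, L; split=> //.
exact: realises_isog PR rL.
Qed.

Lemma six_groups_complemented (i : 'I_6) (K : fieldType) (E : splittingFieldType K)
  (L : {subfield E}) : realises L (six_groups i) -> almost_classically_galois L.
Proof.
case=> clL [f [injf imf ims]]; have [C sC] := six_complement q3 pq wq i.
exists (f @* C)%G; rewrite /= -[X in _ ><| X]ims -imf.
exact: injm_sdprod.
Qed.
End Classification.

Local Close Scope group_scope.

Theorem theorem4p18 (p q : nat)
    (q_ge3 : (3 <= q)%N) (q_prime : prime q) (p_prime : prime p)
    (p_def : p = (2 * q + 1)%N) :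
  exists G : nat -> perm_group (p * q),
  [/\ (forall i j : 'I_6, pg_isog (G i) (G j) -> i = j),
      (forall P : perm_group (p * q),
         (realised_by_type (is_cyclic (p * q)) P /\
          realised_by_type (is_sdprod_cyclic p q) P) <->
         exists i : 'I_6, pg_isog P (G i)),
      ([/\ row (G 0%N) (2 * p * q ^ 2)
             (is_dprod (is_cyclic q) (is_sdprod_cyclic p (2 * q))) 1 (2 * (q - 1)),
           row (G 1%N) (p * q ^ 2)
             (is_dprod (is_cyclic q) (is_sdprod_cyclic p q)) 1 (2 * (q - 1)),
           row (G 2%N) (2 * p * q)
             (is_sdprod_cyclic p (2 * q)) 1 (2 * (q - 1))
         & row (G 3%N) (2 * p * q)
             (is_dprod (is_dihedral (2 * p)) (is_cyclic q)) 1 (2 * (q - 1))] /\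
       row (G 4%N) (p * q)
         (is_sdprod_cyclic p q) p (2 * p * (q - 2) + 2) /\
       row (G 5%N) (p * q)
         (is_cyclic (p * q)) 1 (2 * (q - 1)))
    & (forall (i : 'I_6) (K : fieldType) (E : splittingFieldType K)
              (L : {subfield E}),
         realises L (G i) -> almost_classically_galois L)].
Proof.
have [w wP] := exists_primitive q_prime p_prime p_def.
have wq : (w ^+ q = 1)%R := prim_expr_order wP.
pose G := six_groups q_prime p_prime wq; exists G.
have counts (i : 'I_6) :
    number_of_type (is_cyclic (p * q)) (G i) (if i == 4 :> nat then p else 1) /\
    number_of_type (is_sdprod_cyclic p q) (G i)
      (if i == 4 :> nat then 2 * p * (q - 2) + 2 else 2 * (q - 1)).
  have [cn dn] := six_enum q_ge3 q_prime p_prime p_def wP wq i.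
  by split; [apply: enumerated_number (@is_cyclic_isog _) cn
            |apply: enumerated_number (@is_sdprod_cyclic_isog _ _) dn].
have [o0 o1 o2 o3 [o4 o5]] := six_card q_ge3 q_prime p_prime p_def wq.
have [s0 s1 s2 s3 [s4 s5]] := six_structures q_ge3 q_prime p_prime p_def wP wq.
split.
- move=> i j [f [injf fG _]].
  apply: (six_isog_inj q_ge3 p_prime p_def wP (pq := q_prime) (wq := wq)).
  by apply/isogP; exists f.
- move=> P; split=> [[cP nP]|[i Pi]]; first exact: realised_by_both.
  have [ci ni] := counts i; split; apply: realised_by_type_isog Pi _.
    by apply: number_realised ci; case: ifP => // _; apply: prime_gt0.
  by apply: number_realised ni; case: ifP => _; [rewrite addn2 | rewrite muln_gt0 subn_gt0 prime_gt1].
- have [[c0 n0] [c1 n1]] := (counts (@Ordinal 6 0 isT), counts (@Ordinal 6 1 isT)).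
  have [[c2 n2] [c3 n3]] := (counts (@Ordinal 6 2 isT), counts (@Ordinal 6 3 isT)).
  have [[c4 n4] [c5 n5]] := (counts (@Ordinal 6 4 isT), counts (@Ordinal 6 5 isT)).
  split; [split | split].
  + exact: And4 o0 s0 c0 n0.
  + exact: And4 o1 s1 c1 n1.
  + exact: And4 o2 s2 c2 n2.
  + exact: And4 o3 s3 c3 n3.
  + exact: And4 o4 s4 c4 n4.
  + exact: And4 o5 s5 c5 n5.
- exact: six_groups_complemented.
Qed.
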